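(* Let $1\leq q\leq p<q^\star\leq\infty$, where $q^\star=\frac{qn}{n-q}$ if $q<n$ and $q^\star=\infty$ if $q\geq n$. Then a bounded domain $\Omega\subset\mathbb{R}^n$ is a $(W^{1,p},W^{1,q})$-extension domain if and only if it is an $(L^{1,p},L^{1,q})$-extension domain.
   Context: A domain is a nonempty connected open set. For a domain $\Omega\subset\mathbb{R}^n$ and $1\leq p\leq\infty$, the homogeneous Sobolev space $L^{1,p}(\Omega)$ consists of all $u\in L^1_{\rm loc}(\Omega)$ whose distributional gradient $\nabla u$ belongs to $L^p(\Omega;\mathbb{R}^n)$, with semi-norm $\|u\|_{L^{1,p}(\Omega)}=\|\nabla u\|_{L^p(\Omega)}$. The Sobolev space $W^{1,p}(\Omega)$ consists of all $u\in L^{1,p}(\Omega)$ that also belong to $L^p(\Omega)$, with norm $\|u\|_{W^{1,p}(\Omega)}=\left(\int_\Omega |u|^p+|\nabla u|^p\,dx\right)^{1/p}$ for $p<\infty$ and $\|u\|_{W^{1,\infty}(\Omega)}=\operatorname{ess\,sup}_\Omega(|u|+|\nabla u|)$. For (semi-)normed function spaces $\mathcal{X}(\Omega)$ on $\Omega$ and $\mathcal{Y}(\mathbb{R}^n)$ on $\mathbb{R}^n$, $\Omega$ is an $(\mathcal{X},\mathcal{Y})$-extension domain if there exists a bounded extension operator $E:\mathcal{X}(\Omega)\to\mathcal{Y}(\mathbb{R}^n)$, that is, there is a constant $C>0$ such that for every $u\in\mathcal{X}(\Omega)$ one has $E(u)|_\Omega= u$ (almost everywhere) and $\|E(u)\|_{\mathcal{Y}(\mathbb{R}^n)}\leq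 C\|u\|_{\mathcal{X}(\Omega)}$. (Linearity of $E$ is not part of the definition.) *)

(* Defs.v *)
From HB Require Import structures.
From mathcomp Require Import all_boot all_order all_algebra.
From mathcomp Require Import all_classical all_reals all_analysis.

Set Implicit Arguments.
Unset Strict Implicit.
Unset Printing Implicit Defensive.
Import Order.TTheory GRing.Theory Num.Theory.
Import numFieldNormedType.Exports.

Local Open Scope classical_set_scope.
Local Open Scope ring_scope.

(** * Lebesgue measure on R^n *)

(* 'rV[R]_n carries the sigma-algebra generated by its coordinate functions,
   which is the Borel sigma-algebra (cf. the library's n.-tuple T).  Every
   Lebesgue measurable function is almost everywhere equal to a measurable
   function for this sigma-algebra. *)
Section measurable_rV.
Context (R : realType) (n : nat).

Let coord (i : 'I_n) (v : 'rV[R]_n) : R := v ord0 i.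

Let rV_set0 : g_sigma_preimage coord set0.
Proof. exact: sigma_algebra0. Qed.

Let rV_setC A : g_sigma_preimage coord A -> g_sigma_preimage coord (~` A).
Proof. exact: sigma_algebraC. Qed.

Let rV_bigcup (F : _^nat) : (forall i, g_sigma_preimage coord (F i)) ->
  g_sigma_preimage coord (\bigcup_i (F i)).
Proof. exact: sigma_algebra_bigcup. Qed.

HB.instance Definition _ :=
  @isMeasurable.Build (measure_tuple_display default_measure_display)
    'rV[R]_n (g_sigma_preimage coord) rV_set0 rV_setC rV_bigcup.

End measurable_rV.

Lemma measurable_coord (R : realType) n (i : 'I_n) :
  measurable_fun [set: 'rV[R]_n] (fun v : 'rV[R]_n => v ord0 i).
Proof.
move=> _ Y mY; rewrite setTI; apply: sub_sigma_algebra => /=.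
rewrite -bigcup_seq/=; exists i => /=; first by rewrite mem_index_enum.
by exists Y => //; rewrite setTI.
Qed.

Lemma measurable_fun_coordP d (T : measurableType d) (R : realType) n
    (f : T -> 'rV[R]_n) :
  (forall i, measurable_fun [set: T] (fun x => f x ord0 i)) ->
  measurable_fun [set: T] f.
Proof.
move=> mf _ A mA; rewrite setTI; move: A mA.
suff : @measurable _ 'rV[R]_n `<=` [set A | measurable (f @^-1` A)] by [].
apply: smallest_sub.
  split => /=.
  - by rewrite preimage_set0.
  - by move=> A mA; rewrite setTD -preimage_setC; exact: measurableC.
  - by move=> F mF; rewrite preimage_bigcup; exact: bigcupT_measurable.
move=> A; rewrite -bigcup_seq => -[i _ [B mB <-]] /=.
by rewrite setTI -[X in measurable X]setTI; exact: mf.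
Qed.

Definition cons_rV (R : realType) n (x : R * 'rV[R]_n) : 'rV[R]_n.+1 :=
  row_mx (const_mx x.1 : 'rV_1) x.2.

Lemma measurable_cons_rV (R : realType) n :
  measurable_fun [set: measurableTypeR R * 'rV[R]_n] (@cons_rV R n).
Proof.
apply: measurable_fun_coordP => i; rewrite /cons_rV.
have [j ij|j ij] := split_ordP (i : 'I_(1 + n)).
  rewrite (_ : (fun _ => _) = fst)//; apply/funext => -[x v] /=.
  by rewrite ij; apply: etrans (row_mxEl _ _ _ _) _; rewrite mxE.
rewrite (_ : (fun _ => _) = (fun v : 'rV[R]_n => v ord0 j) \o snd).
  exact: (measurableT_comp (measurable_coord j)).
by apply/funext => -[x v] /=; rewrite ij; exact: row_mxEr.
Qed.

Section lebesgue_rV_succ.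
Context (R : realType) (n : nat) (mu : {measure set 'rV[R]_n -> \bar R}).

Definition lebesgue_rV_succ : set 'rV[R]_n.+1 -> \bar R :=
  pushforward (lebesgue_measure \x^ mu)%E (@cons_rV R n).

Let lebesgue_rV_succ0 : lebesgue_rV_succ set0 = 0%E.
Proof. by apply: measure0; exact: measurable_cons_rV. Qed.

Let lebesgue_rV_succ_ge0 A : (0 <= lebesgue_rV_succ A)%E.
Proof. by apply: measure_ge0; exact: measurable_cons_rV. Qed.

Let lebesgue_rV_succ_sigma_additive : semi_sigma_additive lebesgue_rV_succ.
Proof.
by apply: measure_semi_sigma_additive; exact: measurable_cons_rV.
Qed.

HB.instance Definition _ := isMeasure.Build _ _ _ lebesgue_rV_succ
  lebesgue_rV_succ0 lebesgue_rV_succ_ge0 lebesgue_rV_succ_sigma_additive.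

End lebesgue_rV_succ.

Fixpoint lebesgue_rV (R : realType) (n : nat) :
    {measure set 'rV[R]_n -> \bar R} :=
  match n with
  | 0 => \d_ (0 : 'rV[R]_0)
  | m.+1 => lebesgue_rV_succ (lebesgue_rV R m)
  end.

Lemma lebesgue_rV_box (R : realType) n (A : 'I_n -> set R) :
  (forall i, measurable (A i)) ->
  (lebesgue_rV R n [set v | forall i, A i (v ord0 i)]
   = \prod_(i < n) lebesgue_measure (A i))%E.
Proof.
elim: n A => [|n IH] A mA.
  by rewrite big_ord0 /= diracE mem_set//= => -[].
have E0 x (v : 'rV[R]_n) : cons_rV (x, v) ord0 ord0 = x.
  have -> : ord0 = lshift n (ord0 : 'I_1) :> 'I_(1 + n) by exact/val_inj.
  by apply: etrans (row_mxEl _ _ _ _) _; rewrite mxE.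
have ES x (v : 'rV[R]_n) i : cons_rV (x, v) ord0 (lift ord0 i) = v ord0 i.
  have -> : lift ord0 i = rshift 1 i :> 'I_(1 + n) by exact/val_inj.
  exact: row_mxEr.
pose B := [set v : 'rV[R]_n | forall i, A (lift ord0 i) (v ord0 i)].
have mB : measurable B.
  have -> : B = \big[setI/setT]_(i < n)
      ((fun v : 'rV[R]_n => v ord0 i) @^-1` A (lift ord0 i)).
    rewrite -bigcap_seq; apply/seteqP; split => [v /= Av i _|v /= Av i].
      exact: Av.
    by apply: Av; rewrite /= mem_index_enum.
  apply: bigsetI_measurable => i _.
  by rewrite -[X in measurable X]setTI; exact: measurable_coord.
rewrite big_ord_recl -(IH (fun i => A (lift ord0 i)))//.
rewrite -product_measure2E//=; last exact: mA.
rewrite /lebesgue_rV_succ /pushforward; congr (_ _).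
apply/seteqP; split => -[x v] /=.
  move=> Av; split => [/=|i /=]; first by rewrite -(E0 x v).
  by rewrite -(ES x v).
move=> [/= Ax Av] i; have [j ->|->] := unliftP ord0 i; last by rewrite E0.
by rewrite ES; exact: Av.
Qed.

(** * Weak derivatives and Sobolev spaces *)

Section sobolev.
Context (R : realType) (n : nat).
Implicit Types (D : set 'rV[R]_n) (u phi : 'rV[R]_n -> R)
  (g : 'rV[R]_n -> 'rV[R]_n) (p q : \bar R).

Local Notation mu := (lebesgue_rV R n).

Definition domain D := [/\ D !=set0, open D & connected D].

(* The library norm on 'rV[R]_n is the sup norm. *)
Definition euclidean_norm (v : 'rV[R]_n) : R :=
  Num.sqrt (\sum_(i < n) v ord0 i ^+ 2).

Definition partial (i : 'I_n) phi : 'rV[R]_n -> R :=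
  fun x => 'D_(delta_mx ord0 i) phi x.

(* C^oo: the iterated partial derivatives of all orders are differentiable. *)
Definition smooth phi :=
  forall (s : seq 'I_n) x, differentiable (foldr partial phi s) x.

Definition test_function D phi :=
  [/\ smooth phi, compact (closure [set x | phi x != 0]) &
      closure [set x | phi x != 0] `<=` D].

Definition locally_integrable_rV D u :=
  measurable_fun D u /\
  forall K, K `<=` D -> compact K -> (\int[mu]_(x in K) `|u x|%:E < +oo)%E.

Definition is_weak_gradient D u g :=
  forall i : 'I_n,
    locally_integrable_rV D (fun x => g x ord0 i) /\
    forall phi, test_function D phi ->
      \int[mu]_(x in D) (u x * partial i phi x) =
      - \int[mu]_(x in D) (g x ord0 i * phi x).

(* A choice of the weak gradient, which is unique up to a null set of D. *)
Definition weak_gradient D u : 'rV[R]_n -> 'rV[R]_n :=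
  xget (fun=> 0) [set g | is_weak_gradient D u g].

Lemma weak_gradientP D u :
  (exists g, is_weak_gradient D u g) -> is_weak_gradient D u (weak_gradient D u).
Proof. by move=> ex_g; apply: xgetPex ex_g. Qed.

Definition grad_norm D u : 'rV[R]_n -> R :=
  fun x => euclidean_norm (weak_gradient D u x).

(* The L^p norm over D, as that of the extension by 0 outside of D. *)
Definition Lnorm_on D p u : \bar R := 'N[mu]_p[EFin \o (u \_ D)].

(* A (semi-)normed space of functions on a subset of R^n; only the values on
   that subset matter, and functions are not quotiented by a.e. equality. *)
Record fun_space := FunSpace {
  fun_space_mem : set ('rV[R]_n -> R) ;
  fun_space_norm : ('rV[R]_n -> R) -> \bar R }.

Definition L1p_mem D p : set ('rV[R]_n -> R) := [set u |
  [/\ locally_integrable_rV D u,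
      exists g, is_weak_gradient D u g &
      (Lnorm_on D p (grad_norm D u) < +oo)%E]].

Definition L1p p D : fun_space :=
  FunSpace (L1p_mem D p) (fun u => Lnorm_on D p (grad_norm D u)).

Definition W1p_norm D p u : \bar R :=
  match p with
  | r%:E => ((\int[mu]_(x in D) (`|u x| `^ r + grad_norm D u x `^ r)%:E)
              `^ r^-1)%E
  | _ => Lnorm_on D p (fun x => `|u x| + grad_norm D u x)
  end.

Definition W1p p D : fun_space :=
  FunSpace [set u | L1p_mem D p u /\ (Lnorm_on D p u < +oo)%E] (W1p_norm D p).

Definition extension_domain (X Y : set 'rV[R]_n -> fun_space) D :=
  exists (E : ('rV[R]_n -> R) -> ('rV[R]_n -> R)) (C : R), 0 < C /\
    forall u, fun_space_mem (X D) u ->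
      [/\ fun_space_mem (Y setT) (E u),
          {ae mu, forall x, D x -> E u x = u x} &
          (fun_space_norm (Y setT) (E u) <= C%:E * fun_space_norm (X D) u)%E].

Definition sobolev_conjugate q : \bar R :=
  match q with
  | r%:E => if r < n%:R then (r * n%:R / (n%:R - r))%:E else +oo%E
  | _ => +oo%E
  end.

End sobolev.

(* Main.v *)
(* A W^{1,p} extension of a bounded domain Om comes from a homogeneous one by
   multiplying with a cutoff function equal to 1 on Om: the Poincare inequality
   on a large cube, together with the L^q norm on Om, bounds the L^q norm of the
   homogeneous extension.

   Conversely, a (W^{1,p}, W^{1,q}) extension and the Sobolev inequality on a
   cube embed W^{1,p}(Om) into L^r(Om) for some r > p, since p < q^*.  As Om is
   connected, chains of overlapping cubes give a Poincare inequality on subsets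
   of Om of almost full measure; by the gain r > p the remaining small set is
   absorbed, whence |u - c|_p <= C |grad u|_p on all of Om, first for u in
   W^{1,p} and then, by truncation, for u in L^{1,p}.  Extending u - c and adding
   c back yields the homogeneous extension.

   The weak gradient enters through the identity
   u (x + h) - u x = \int_0^1 grad u (x + t h) . h dt, valid for each h at almost
   every x.  It yields the Poincare inequality on cubes, and the
   (non-endpoint) Sobolev inequality follows by summing over dyadic subcubes. *)

Require Import Defs.
From mathcomp Require Import all_boot all_order all_algebra.
From mathcomp Require Import all_classical all_reals all_analysis.
From mathcomp Require Import measurable_realfun ring lra.
From HB Require Import structures.
Import Order.TTheory GRing.Theory Num.Theory.
Import numFieldNormedType.Exports.
Local Open Scope classical_set_scope.
Local Open Scope ring_scope.

(** * Borel sets and Lebesgue measure *)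

(** Estimates are stated for integrals of powers, [pint], with real exponents and lossy constants;
    Hoelder's inequality is replaced by the pointwise comparison [powR_interp]. The strict
    inequality between [p] and the Sobolev conjugate enters only through an exponent [r > p] with
    [r + n - n r / q > 0]. This number is the power of the side length by which the dyadic
    corrections shrink, so they sum like a geometric series; the endpoint, where it vanishes, is
    never touched. Sobolev functions are never approximated by smooth ones. Weak gradients are
    handled through test functions and the line identity, and the latter also carries the chain
    rule, by difference quotients of small step. That argument wants a Lipschitz derivative, which
    is why [u] is truncated as [k sin (u / k)] and not by a cut at height [k]. The constants [c] in
    Poincare inequalities are existential, not means. Each is controlled on a set of positive
    measure on which both the function and its difference with [c] are bounded; this one device
    serves the gluing of sets, the dyadic step, the cutoff and the truncation. *)

Section box.
Context {R : realType} {n : nat}.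
Implicit Types a b x : 'rV[R]_n.

Definition box a b : set 'rV[R]_n :=
  [set x | forall i, a ord0 i < x ord0 i < b ord0 i].

Lemma measurable_box a b : measurable (box a b).
Proof.
have -> : box a b = \big[setI/setT]_(i < n)
    ((fun v : 'rV[R]_n => v ord0 i) @^-1` `]a ord0 i, b ord0 i[%classic).
  rewrite -bigcap_seq; apply/seteqP; split => [v /= Av i _|v /= Av i].
    by rewrite /= in_itv/=.
  by have := Av i (mem_index_enum _); rewrite /= in_itv.
apply: bigsetI_measurable => i _.
by rewrite -[X in measurable X]setTI; exact: measurable_coord.
Qed.

Lemma boxI a b c d : box a b `&` box c d =
  box (\row_i Num.max (a ord0 i) (c ord0 i)) (\row_i Num.min (b ord0 i) (d ord0 i)).
Proof.
apply/seteqP; split => x.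
  move=> [xab xcd] i; rewrite !mxE gt_max lt_min.
  by move: (xab i) (xcd i) => /andP[-> ->] /andP[-> ->].
move=> xI; split => i; move: (xI i); rewrite !mxE gt_max lt_min.
  by move=> /andP[/andP[-> _] /andP[-> _]].
by move=> /andP[/andP[_ ->] /andP[_ ->]].
Qed.

Lemma setI_closed_box : setI_closed [set A | exists a b, A = box a b].
Proof. by move=> _ _ [a [b ->]] [c [d ->]]; rewrite boxI; do 2 eexists. Qed.

Lemma box_cover :
  \bigcup_k (box (const_mx (- k%:R)) (const_mx k%:R)) = [set: 'rV[R]_n].
Proof.
apply/seteqP; split => // x _.
exists (Num.truncn `|x|).+1 => // i; rewrite !mxE -ltr_norml.
apply: le_lt_trans (truncnS_gt _).
rewrite [in leRHS]/Num.norm /= mx_normrE.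
by apply/bigmax_geP; right => /=; exists (ord0, i).
Qed.

(** A coordinate strip is the countable union of the boxes whose other sides are [(-k, k)], so open
    boxes generate the sigma-algebra. Being stable under intersection, they form the pi-system of
    [rV_measure_unique]. *)
Lemma measurable_rV_box : (@measurable _ 'rV[R]_n) =
  <<s [set A | exists a b, A = box a b] >>.
Proof.
apply/seteqP; split; last first.
  apply: smallest_sub; first exact: sigma_algebra_measurable.
  by move=> _ [a [b ->]]; exact: measurable_box.
pose G := [set A : set 'rV[R]_n | exists a b, A = box a b].
pose T := g_sigma_algebraType G.
apply: smallest_sub; first exact: smallest_sigma_algebra.
move=> A; rewrite -bigcup_seq => -[i _].
suff mi : measurable_fun [set: T] (fun v : T => (v : 'rV[R]_n) ord0 i : R).
  by move=> [B mB <-]; exact: (mi measurableT).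
apply: (measurability (@RGenOpens.G R)); first exact: RGenOpens.measurableE.
move=> _ [_ [x [y ->]] <-]; rewrite setTI.
pose a k : 'rV[R]_n := \row_j if j == i then x else - k%:R.
pose b k : 'rV[R]_n := \row_j if j == i then y else k%:R.
have -> : (fun v : T => (v : 'rV[R]_n) ord0 i) @^-1` `]x, y[ =
    \bigcup_k (box (a k) (b k)).
  apply/seteqP; split => v /=; rewrite in_itv/=.
    move=> vi.
    have [k _ vk] : (\bigcup_k (box (const_mx (- k%:R)) (const_mx k%:R))) v.
      by rewrite box_cover.
    exists k => // j; rewrite !mxE; have [->//|ji] := eqVneq j i.
    by have := vk j; rewrite !mxE.
  by move=> [k _] /(_ i); rewrite !mxE eqxx.
by apply: bigcup_measurable => k _; apply: sub_sigma_algebra; eexists; eexists.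
Qed.

Lemma rV_measure_unique (m1 m2 : {measure set 'rV[R]_n -> \bar R}) :
  (forall a b, m1 (box a b) < +oo)%E ->
  (forall a b, m1 (box a b) = m2 (box a b)) ->
  forall A, measurable A -> m1 A = m2 A.
Proof.
move=> m1oo m12 A.
apply: (measure_unique [set A | exists a b, A = box a b]
  (fun k => box (const_mx (- k%:R)) (const_mx k%:R))).
- exact: measurable_rV_box.
- exact: setI_closed_box.
- by move=> k; eexists; eexists.
- exact: box_cover.
- by move=> _ [a [b ->]].
- by move=> k; exact: m1oo.
Qed.

Lemma ball_rV (a x : 'rV[R]_n) (e : R) : 0 < e ->
  ball a e x <-> forall i, `|a ord0 i - x ord0 i| < e.
Proof.
move=> e0; split => [[_ +] i|h]; first by move=> /(_ ord0 i).
by split => // i j; rewrite ord1; exact: h.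
Qed.

Lemma ball_box (a : 'rV[R]_n) (e : R) : 0 < e ->
  ball a e = box (a - const_mx e) (a + const_mx e).
Proof.
move=> e0; apply/seteqP; split => x.
  by move=> /ball_rV => /(_ e0) h i; move: (h i); rewrite !mxE distrC ltr_distl.
by move=> h; apply/ball_rV => // i; move: (h i); rewrite !mxE distrC ltr_distl.
Qed.

Lemma measurable_ball (a : 'rV[R]_n) (e : R) : measurable (ball a e).
Proof.
have [e0|e0] := ltP 0 e; first by rewrite ball_box//; exact: measurable_box.
suff -> : ball a e = set0 by [].
by apply/seteqP; split => // x [/lt_le_trans/(_ e0)]; rewrite ltxx.
Qed.

(** Balls of half the admissible radius around rational centres still cover. The factor 2 is a
    reserve: a closed or half-open cube around each small ball remains inside [A], as [ae_open_box]
    and [poincare_set_exhaust] require. *)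
Lemma open_bigcup_ball (A : set 'rV[R]_n) : open A -> A =
  \bigcup_(q in [set q : {ffun 'I_n -> rat} * nat |
    ball (\row_i ratr (q.1 i) : 'rV[R]_n) (2 * q.2.+1%:R^-1 : R) `<=` A])
   ball (\row_i ratr (q.1 i) : 'rV[R]_n) (q.2.+1%:R^-1 : R).
Proof.
move=> oA; apply/seteqP; split => [x Ax|x [q /= qA qx]]; last first.
  by apply: qA; apply: le_ball qx; rewrite ler_peMl ?invr_ge0// ler1n.
have /nbhs_ballP[e /= e0 eA] : nbhs x A by exact: open_nbhs_nbhs.
(* Three radii [1 / (k + 1)] must fit into [e]: one for the distance from [x] to the rational
   centre, two for the doubled ball. *)
pose k := Num.truncn (3 / e).
have kpos : (0 : R) < k.+1%:R^-1 by rewrite invr_gt0 ltr0n.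
have ke : (k.+1%:R^-1 : R) + 2 * k.+1%:R^-1 <= e.
  have /ltW h : 3 / e < k.+1%:R := truncnS_gt _.
  rewrite (_ : _ + _ = 3 / k.+1%:R); last by ring.
  by rewrite ler_pdivrMr ?ltr0n//; move: h; rewrite ler_pdivrMr// mulrC.
have h (i : 'I_n) : exists q : rat, `|x ord0 i - ratr q| < k.+1%:R^-1.
  have /rat_in_itvoo[q] : x ord0 i - k.+1%:R^-1 < x ord0 i + k.+1%:R^-1.
    by rewrite ltrD2l gtrN.
  by rewrite in_itv/= -ltr_distl distrC => qx; exists q.
pose f := [ffun i => projT1 (cid (h i))].
have bx : ball (\row_i ratr (f i) : 'rV[R]_n) (k.+1%:R^-1) x.
  apply/ball_rV => // i; rewrite mxE ffunE; case: cid => q /=.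
  by rewrite distrC.
exists (f, k) => //= y fy; apply: eA; apply: le_ball ke _ _.
by apply: ball_triangle fy; exact: ball_sym.
Qed.

Lemma open_measurable_rV (A : set 'rV[R]_n) : open A -> measurable A.
Proof.
move=> oA; rewrite (open_bigcup_ball _ oA).
rewrite bigcup_mkcond; apply: countable_bigcupT_measurable.
  exact: countableP.
by move=> q; case: ifPn => // _; exact: measurable_ball.
Qed.

Lemma closed_measurable_rV (A : set 'rV[R]_n) : closed A -> measurable A.
Proof.
move=> cA; rewrite -(setCK A); apply: measurableC; apply: open_measurable_rV.
exact: closed_openC.
Qed.

Lemma compact_measurable_rV (A : set 'rV[R]_n) : compact A -> measurable A.
Proof.
by move=> cA; apply: closed_measurable_rV; apply: compact_closed.
Qed.

Lemma continuous_measurable_rV (f : 'rV[R]_n -> R) :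
  continuous f -> measurable_fun [set: 'rV[R]_n] f.
Proof.
move=> cf; apply: (measurability (@RGenOpens.G R)).
  exact: RGenOpens.measurableE.
move=> _ [_ [x [y ->]] <-]; rewrite setTI; apply: open_measurable_rV.
by apply: open_comp => // z _; exact: cf.
Qed.

End box.

(* A constant for the sigma-finite instance below to attach to: [lebesgue_rV] is
   a fixpoint into the type of measures. *)
Definition leb (R : realType) (n : nat) : set 'rV[R]_n -> \bar R :=
  lebesgue_rV R n.
HB.instance Definition _ R n := Measure.copy (@leb R n) (lebesgue_rV R n).

Section lebesgue_rV_basics.
Context {R : realType} {n : nat}.
Implicit Types a b x h : 'rV[R]_n.
Local Notation mu := (lebesgue_rV R n).

Lemma lebesgue_box a b :
  mu (box a b) = (\prod_(i < n) Num.max 0 (b ord0 i - a ord0 i))%:E.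
Proof.
transitivity (\prod_(i < n) lebesgue_measure `]a ord0 i, b ord0 i[%classic)%E; last first.
  rewrite -prodEFin; apply: eq_bigr => i _.
  rewrite lebesgue_measure_itv/= lte_fin; case: ltP => ab.
    by rewrite -EFinB max_r// subr_ge0 ltW.
  by rewrite max_l// subr_le0.
rewrite -lebesgue_rV_box; last by move=> i; exact: measurable_itv.
by congr (mu _); apply/seteqP; split => v /= h i; have := h i;
  rewrite /= in_itv.
Qed.

Lemma lebesgue_box_fin a b : (mu (box a b) < +oo)%E.
Proof. by rewrite lebesgue_box ltry. Qed.

Lemma lebesgue_rV_sigma_finite : sigma_finite setT (@leb R n).
Proof.
exists (fun k => box (const_mx (- k%:R)) (const_mx k%:R)).
  by rewrite box_cover.
by move=> k; split; [exact: measurable_box|exact: lebesgue_box_fin].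
Qed.

HB.instance Definition _ :=
  @Measure_isSigmaFinite.Build _ _ _ (@leb R n) lebesgue_rV_sigma_finite.

Lemma bounded_sub_box (A : set 'rV[R]_n) : bounded_set A ->
  exists2 k : nat, (0 < k)%N &
    A `<=` box (const_mx (- k%:R)) (const_mx k%:R).
Proof.
move=> [M [_ /(_ (`|M| + 1))]]; rewrite ltr_pwDr ?ler_norm// => /(_ isT) AM.
exists (Num.truncn (`|M| + 1)).+1 => // x /AM xM i; rewrite !mxE -ltr_norml.
apply: le_lt_trans (truncnS_gt _); apply: le_trans xM.
rewrite [in leRHS]/Num.norm /= mx_normrE.
by apply/bigmax_geP; right => /=; exists (ord0, i).
Qed.

Lemma bounded_set_lebesgue_fin (A : set 'rV[R]_n) : measurable A ->
  bounded_set A -> (mu A < +oo)%E.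
Proof.
move=> mA /bounded_sub_box[k _ Ak]; apply: le_lt_trans (lebesgue_box_fin _ _).
by apply: le_measure Ak; rewrite inE//; exact: measurable_box.
Qed.

Lemma compact_lebesgue_fin (A : set 'rV[R]_n) : compact A -> (mu A < +oo)%E.
Proof.
move=> cA; apply: bounded_set_lebesgue_fin; first exact: compact_measurable_rV.
exact: compact_bounded.
Qed.

Lemma measurable_shift h :
  measurable_fun [set: 'rV[R]_n] (fun x => x + h).
Proof.
apply: measurable_fun_coordP => i.
rewrite (_ : (fun _ => _) = fun x : 'rV[R]_n => x ord0 i + h ord0 i).
  by apply: measurable_funD => //; exact: measurable_coord.
by apply/funext => x; rewrite mxE.
Qed.

(** Translation preserves the side lengths of boxes, and two measures that agree on boxes and are
    finite there coincide. *)
Lemma lebesgue_rV_shift h (A : set 'rV[R]_n) : measurable A ->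
  mu ((fun x => x + h) @^-1` A) = mu A.
Proof.
move=> mA; rewrite -/(pushforward mu (fun x : 'rV[R]_n => x + h) A).
apply: rV_measure_unique => //.
- exact: measurable_shift.
- move=> mS a b; rewrite /= /pushforward.
  rewrite (_ : _ @^-1` _ = box (a - h) (b - h)) ?lebesgue_box_fin//.
  by apply/seteqP; split => x /= + i => /(_ i); rewrite !mxE ltrBlDr ltrBrDr.
- move=> mS a b; rewrite /= /pushforward.
  rewrite (_ : _ @^-1` _ = box (a - h) (b - h)).
    rewrite !lebesgue_box; congr (_%:E); apply: eq_bigr => i _; rewrite !mxE.
    by congr Num.max; ring.
  by apply/seteqP; split => x /= + i => /(_ i); rewrite !mxE ltrBlDr ltrBrDr.
Qed.

Lemma ge0_integral_shift h (f : 'rV[R]_n -> \bar R) :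
  measurable_fun setT f -> (forall x, 0 <= f x)%E ->
  (\int[mu]_x f (x + h)%R = \int[mu]_x f x)%E.
Proof.
move=> mf f0.
have mS := measurable_shift h.
rewrite -[LHS](@ge0_integral_pushforward _ _ _ _ _ _ mS mu setT f)//.
by apply: eq_measure_integral => A mA _; rewrite /= -[RHS](lebesgue_rV_shift h).
Qed.

Lemma integral_shift h (f : 'rV[R]_n -> \bar R) :
  measurable_fun setT f ->
  (\int[mu]_x f (x + h)%R = \int[mu]_x f x)%E.
Proof.
move=> mf; rewrite integralE [RHS]integralE; congr (_ - _)%E.
  rewrite -[RHS](ge0_integral_shift h).
  - by apply: eq_integral => x _; rewrite !funeposE.
  - exact: measurable_funepos.
  - by move=> x; exact: funepos_ge0.
rewrite -[RHS](ge0_integral_shift h).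
- by apply: eq_integral => x _; rewrite !funenegE.
- exact: measurable_funeneg.
- by move=> x; exact: funeneg_ge0.
Qed.

Lemma integrable_shift h (f : 'rV[R]_n -> \bar R) :
  mu.-integrable setT f -> mu.-integrable setT (fun x => f (x + h)).
Proof.
move=> /integrableP[mf foo]; apply/integrableP; split.
  exact: measurableT_comp mf (measurable_shift h).
rewrite (ge0_integral_shift h (fun x => `|f x|%E))//.
exact: measurableT_comp.
Qed.

Lemma tonelli_rV (f : 'rV[R]_n -> 'rV[R]_n -> \bar R) :
  measurable_fun setT (fun z : 'rV[R]_n * 'rV[R]_n => f z.1 z.2) ->
  (forall x y, 0 <= f x y)%E ->
  (\int[mu]_x \int[mu]_y f x y = \int[mu]_y \int[mu]_x f x y)%E.
Proof.
move=> mf f0.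
exact: (@fubini_tonelli _ _ _ _ _ (@leb R n) (@leb R n) _ mf
  (fun z => f0 z.1 z.2)).
Qed.

Lemma measurable_tonelli_rV (f : 'rV[R]_n -> 'rV[R]_n -> \bar R) :
  measurable_fun setT (fun z : 'rV[R]_n * 'rV[R]_n => f z.1 z.2) ->
  (forall x y, 0 <= f x y)%E ->
  measurable_fun setT (fun x => \int[mu]_y f x y)%E.
Proof.
move=> mf f0.
exact: (@measurable_fun_fubini_tonelli_F _ _ _ _ _ (@leb R n) _ mf
  (fun z => f0 z.1 z.2)).
Qed.

Local Notation leb1 := (@lebesgue_measure R).

Lemma tonelli_rV_R (f : 'rV[R]_n -> R -> \bar R) :
  measurable_fun setT (fun z : 'rV[R]_n * measurableTypeR R => f z.1 z.2) ->
  (forall x y, 0 <= f x y)%E ->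
  (\int[mu]_x \int[leb1]_t f x t = \int[leb1]_t \int[mu]_x f x t)%E.
Proof.
move=> mf f0.
exact: (@fubini_tonelli _ _ _ _ _ (@leb R n) leb1 _ mf
  (fun z => f0 z.1 z.2)).
Qed.

Lemma measurable_tonelli_rV_R (f : 'rV[R]_n -> R -> \bar R) :
  measurable_fun setT (fun z : 'rV[R]_n * measurableTypeR R => f z.1 z.2) ->
  (forall x y, 0 <= f x y)%E ->
  measurable_fun setT (fun x => \int[leb1]_t f x t)%E.
Proof.
move=> mf f0.
exact: (@measurable_fun_fubini_tonelli_F _ _ _ _ _ leb1 _ mf
  (fun z => f0 z.1 z.2)).
Qed.

Lemma fubini_rV_R (f : 'rV[R]_n -> R -> \bar R) :
  measurable_fun setT (fun z : 'rV[R]_n * measurableTypeR R => f z.1 z.2) ->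
  (\int[leb1]_t \int[mu]_x `|f x t| < +oo)%E ->
  (\int[mu]_x \int[leb1]_t f x t = \int[leb1]_t \int[mu]_x f x t)%E.
Proof.
move=> mf foo.
have intf : ((@leb R n \x leb1)%E).-integrable setT
    (fun z : 'rV[R]_n * measurableTypeR R => f z.1 z.2).
  by apply/integrable21ltyP.
exact: (Fubini intf).
Qed.

End lebesgue_rV_basics.

(** * Smooth functions and test functions *)

Section smooth.
Context {R : realType} {n : nat}.
Implicit Types phi psi : 'rV[R]_n -> R.

Lemma smooth_differentiable phi x : smooth phi -> differentiable phi x.
Proof. by move=> /(_ [::]). Qed.

Lemma smooth_partial phi i : smooth phi -> smooth (partial i phi).
Proof. by move=> sphi s x; have := sphi (rcons s i) x; rewrite -cats1 foldr_cat. Qed.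

Lemma smooth_continuous phi : smooth phi -> continuous phi.
Proof.
by move=> sphi x; exact/differentiable_continuous/smooth_differentiable.
Qed.

(** Iterated partial derivatives never leave [S], so smoothness is proved by exhibiting an invariant
    class instead of by a separate induction for each function. *)
Lemma smooth_coind (S : ('rV[R]_n -> R) -> Prop) :
  (forall phi, S phi -> forall x, differentiable phi x) ->
  (forall phi, S phi -> forall i, S (partial i phi)) ->
  forall phi, S phi -> smooth phi.
Proof.
move=> Sd Sp phi Sphi s; suff : S (foldr (@partial R n) phi s) by move=> /Sd.
by elim: s => [//|i s IH]; exact: Sp.
Qed.

Lemma smooth_cst (c : R) : smooth (cst c : 'rV[R]_n -> R).
Proof.
apply: (smooth_coind (fun phi => exists c, phi = cst c)); last by exists c.
- by move=> _ [d ->] x; exact: differentiable_cst.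
- by move=> _ [d ->] i; exists 0; apply/funext => x; rewrite /partial derive_cst.
Qed.

Lemma partial_shift phi h i x :
  partial i (fun x => phi (x + h)) x = partial i phi (x + h).
Proof.
rewrite /partial /derive; congr (lim _).
rewrite [X in X @ _ = _](_ : _ = (fun t : R => t^-1 *:
  ((phi \o shift (x + h)) (t *: delta_mx ord0 i) - phi (x + h))))//.
by apply/funext => t /=; rewrite addrA.
Qed.

Lemma smooth_shift phi h : smooth phi -> smooth (fun x => phi (x + h)).
Proof.
move=> sphi.
apply: (smooth_coind (fun psi => exists2 f, smooth f & psi = (fun x => f (x + h)))).
- move=> _ [f sf ->] x.
  apply: (@differentiable_comp _ _ _ _ (fun x => x + h) f); last exact: smooth_differentiable.
  exact: differentiableD.
- move=> _ [f sf ->] i; exists (partial i f); first exact: smooth_partial.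
  by apply/funext => x; exact: partial_shift.
- by exists phi.
Qed.

(** The operations are those whose differentiation rules stay within the list: the derivative of a
    product is a sum of products, that of an inverse a product of inverses. This gives an invariant
    class for [smooth_coind], which products alone would not. *)
Inductive smooth_closure : ('rV[R]_n -> R) -> Prop :=
| SmoothBase phi : smooth phi -> smooth_closure phi
| SmoothAdd phi psi : smooth_closure phi -> smooth_closure psi ->
    smooth_closure (fun x => phi x + psi x)
| SmoothMul phi psi : smooth_closure phi -> smooth_closure psi ->
    smooth_closure (fun x => phi x * psi x)
| SmoothInv phi : smooth_closure phi -> (forall x, phi x != 0) ->
    smooth_closure (fun x => (phi x)^-1).

Lemma smooth_closure_differentiable phi x :
  smooth_closure phi -> differentiable phi x.
Proof.
elim => {phi}.
- by move=> phi; exact: smooth_differentiable.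
- by move=> phi psi _ ? _ ?; exact: differentiableD.
- by move=> phi psi _ ? _ ?; exact: differentiableM.
- by move=> phi _ ? ?; exact: differentiableV.
Qed.

Lemma smooth_closure_partial phi i :
  smooth_closure phi -> smooth_closure (partial i phi).
Proof.
elim => {phi}.
- by move=> phi; move=> ?; apply: SmoothBase; exact: smooth_partial.
- move=> phi psi cphi Pphi cpsi Ppsi.
  rewrite [partial _ _](_ : _ = (fun x => partial i phi x + partial i psi x)).
    exact: SmoothAdd.
  by apply/funext => x; rewrite /partial deriveD//; apply: diff_derivable;
    exact: smooth_closure_differentiable.
- move=> phi psi cphi Pphi cpsi Ppsi.
  rewrite [partial _ _](_ : _ = (fun x => phi x * partial i psi x + psi x * partial i phi x)).
    by apply: SmoothAdd; exact: SmoothMul.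
  by apply/funext => x; rewrite /partial deriveM//; apply: diff_derivable;
    exact: smooth_closure_differentiable.
- move=> phi cphi Pphi phi0.
  rewrite [partial _ _](_ : _ = (fun x => ((-1) * ((phi x)^-1 * (phi x)^-1)) * partial i phi x)).
    do 2 (apply: SmoothMul => //); first exact/SmoothBase/smooth_cst.
    by apply: SmoothMul; exact: SmoothInv.
  apply/funext => x; rewrite /partial deriveV//; last first.
    by apply: diff_derivable; exact: smooth_closure_differentiable.
  by rewrite -invfM -expr2 mulN1r.
Qed.

Lemma smooth_closureP phi : smooth_closure phi -> smooth phi.
Proof.
apply: smooth_coind.
- by move=> ? ? ?; exact: smooth_closure_differentiable.
- by move=> ? ? ?; exact: smooth_closure_partial.
Qed.

Lemma smoothD phi psi : smooth phi -> smooth psi -> smooth (fun x => phi x + psi x).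
Proof. by move=> ? ?; apply/smooth_closureP/SmoothAdd; exact: SmoothBase. Qed.

Lemma smoothM phi psi : smooth phi -> smooth psi -> smooth (fun x => phi x * psi x).
Proof. by move=> ? ?; apply/smooth_closureP/SmoothMul; exact: SmoothBase. Qed.

Lemma smoothV phi : smooth phi -> (forall x, phi x != 0) ->
  smooth (fun x => (phi x)^-1).
Proof. by move=> ? ?; apply/smooth_closureP/SmoothInv => //; exact: SmoothBase. Qed.

Lemma smooth_prod (I : Type) (r : seq I) (F : I -> 'rV[R]_n -> R) :
  (forall i, smooth (F i)) -> smooth (fun x => \prod_(i <- r) F i x).
Proof.
move=> sF; elim: r => [|i r IH].
  rewrite (_ : (fun _ => _) = cst 1); first exact: smooth_cst.
  by apply/funext => x; rewrite big_nil.
rewrite (_ : (fun _ => _) = (fun x => F i x * \prod_(j <- r) F j x)).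
  exact: smoothM.
by apply/funext => x; rewrite big_cons.
Qed.

Lemma differentiable_affine_coord (i : 'I_n) (s a : R) (x : 'rV[R]_n) :
  differentiable (fun x : 'rV[R]_n => s * x ord0 i + a) x.
Proof.
apply: differentiableD; last exact: differentiable_cst.
apply: differentiableM; first exact: differentiable_cst.
exact: differentiable_coord.
Qed.

Lemma partial_affine_coord (i j : 'I_n) (s a : R) (x : 'rV[R]_n) :
  partial j (fun x : 'rV[R]_n => s * x ord0 i + a) x = s * (i == j)%:R.
Proof.
rewrite /partial /derive; apply/cvg_lim => //.
apply: cvg_near_cst; exists 1 => //= t _ t0.
rewrite !mxE eqxx/= /GRing.scale/=.
transitivity (t^-1 * t * (s * (i == j)%:R)); last by rewrite mulVf ?mul1r.
ring.
Qed.

Lemma differentiable_affine_comp (h : R -> R) (i : 'I_n) (s a : R) (x : 'rV[R]_n) :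
  (forall t, derivable h t 1) ->
  differentiable (fun x : 'rV[R]_n => h (s * x ord0 i + a)) x.
Proof.
move=> dh.
apply: (@differentiable_comp _ _ _ _ (fun x : 'rV[R]_n => s * x ord0 i + a) h).
  exact: differentiable_affine_coord.
exact/derivable1_diffP.
Qed.

Lemma partial_affine_comp (h : R -> R) (i j : 'I_n) (s a : R) (x : 'rV[R]_n) :
  (forall t, derivable h t 1) ->
  partial j (fun x : 'rV[R]_n => h (s * x ord0 i + a)) x =
  s * (i == j)%:R * h^`()%classic (s * x ord0 i + a).
Proof.
move=> dh; have dl := differentiable_affine_coord i s a x.
have dhl : differentiable h (s * x ord0 i + a) by exact/derivable1_diffP.
rewrite /partial deriveE; last exact: differentiable_affine_comp.
rewrite (@diff_comp _ _ _ _ (fun x : 'rV[R]_n => s * x ord0 i + a) h)//=.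
have -> : 'd (fun x : 'rV[R]_n => s * x ord0 i + a) x (delta_mx ord0 j) =
    s * (i == j)%:R by rewrite -deriveE//; exact: partial_affine_coord.
by rewrite diff1E.
Qed.

(** The chain rule turns a member into a constant times another member of the same family of
    one-variable functions; hence the factor [c] in the invariant class. *)
Lemma smooth_coord_class (S : (R -> R) -> Prop) :
  (forall h, S h -> forall t, derivable h t 1) ->
  (forall h, S h -> S (h^`()%classic)) ->
  forall h, S h -> forall (i : 'I_n) (s a : R),
  smooth (fun x : 'rV[R]_n => h (s * x ord0 i + a)).
Proof.
move=> Sd S' h Sh i s a.
apply: (smooth_coind (fun phi => exists c g, S g /\
   phi = (fun x : 'rV[R]_n => c * g (s * x ord0 i + a)))).
- move=> _ [c [g [Sg ->]]] x.
  apply: differentiableM; first exact: differentiable_cst.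
  by apply: differentiable_affine_comp; exact: Sd.
- move=> _ [c [g [Sg ->]]] j; exists (c * (s * (i == j)%:R)), (g^`()%classic).
  split; first exact: S'.
  apply/funext => x; rewrite /partial deriveMl; last first.
    apply: diff_derivable; apply: differentiable_affine_comp; exact: Sd.
  by rewrite -/(partial _ _ _) partial_affine_comp ?mulrA//; exact: Sd.
- by exists 1, h; split => //; apply/funext => x; rewrite mul1r.
Qed.

End smooth.

(** * Smooth bump functions from [exp (- c / t)] *)

Section flat.
Context {R : realType}.

(** The classical flat function [exp (- c / t)], extended by zero, with a polynomial in [1 / t] in
    front: the polynomial makes the family stable under differentiation. *)
Definition flat (P : {poly R}) (c t : R) : R :=
  if 0 < t then P.[t^-1] * expR (- c * t^-1) else 0.

(** The exponential dominates the term of degree [k + 1] of its series, which exceeds [z ^ k] up to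
    a constant once [z >= 1]; the summand 1 in the constant covers [z < 1]. *)
Lemma monomial_expR_bound (c : R) (k : nat) : 0 < c ->
  exists2 C, 0 <= C & forall z, 0 <= z -> z ^+ k * expR (- c * z) <= C.
Proof.
move=> c0; exists (k.+1`!%:R / c ^+ k.+1 + 1).
  by rewrite addr_ge0// divr_ge0// exprn_ge0// ltW.
move=> z z0; have [z1|z1] := ltP z 1.
  apply: (@le_trans _ _ 1); last by rewrite lerDr divr_ge0// exprn_ge0// ltW.
  rewrite mulr_ile1 ?exprn_ge0 ?expR_ge0 ?exprn_ile1 ?(ltW z1)//.
  by rewrite -expR0 ler_expR mulNr oppr_le0 mulr_ge0// ltW.
apply: (@le_trans _ _ (k.+1`!%:R / c ^+ k.+1)); last by rewrite lerDl.
rewrite mulNr expRN ler_pdivrMr ?expR_gt0// mulrAC ler_pdivlMr ?exprn_gt0//.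
have := @expR_ge1Dxn _ (c * z) k (mulr_ge0 (ltW c0) z0).
move=> /(le_trans _) => h.
have {}h : (c * z) ^+ k.+1 / k.+1`!%:R <= expR (c * z).
  by apply: le_trans (h _ (lexx _)); rewrite lerDr.
rewrite ler_pdivrMr ?ltr0n ?fact_gt0// in h.
rewrite [leRHS]mulrC; apply: le_trans h; rewrite exprMn mulrC.
by rewrite ler_wpM2l ?exprn_ge0 ?(ltW c0)// ler_weXn2l.
Qed.

Lemma poly_expR_bound (P : {poly R}) (c : R) : 0 < c ->
  exists2 C, 0 <= C & forall z, 0 <= z -> `|P.[z]| * expR (- c * z) <= C.
Proof.
move=> c0; elim/poly_ind: P => [|P a _].
  by exists 0 => // z _; rewrite horner0 normr0 mul0r.
move: (P * 'X + a%:P) => {a}P.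
have /choice[C hC] (k : 'I_(size P)) : exists C, 0 <= C /\
    forall z, 0 <= z -> z ^+ k * expR (- c * z) <= C.
  by have [C] := monomial_expR_bound c k c0; exists C.
exists (\sum_(i < size P) `|P`_i| * C i).
  by apply: sumr_ge0 => i _; rewrite mulr_ge0//; have [] := hC i.
move=> z z0; rewrite horner_coef.
apply: (@le_trans _ _ ((\sum_(i < size P) `|P`_i * z ^+ i|) * expR (- c * z))).
  by rewrite ler_wpM2r ?expR_ge0// ler_norm_sum.
rewrite mulr_suml; apply: ler_sum => i _.
rewrite normrM -mulrA ler_wpM2l// (ger0_norm (exprn_ge0 _ z0)).
by have [_] := hC i; exact.
Qed.

(** This is [poly_expR_bound] for [P] times [X ^ 2], at [z = 1 / t]. Quadratic decay is what the
    difference quotient at the origin needs. *)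
Lemma flat_bound (P : {poly R}) (c : R) : 0 < c ->
  exists2 C, 0 <= C & forall t, `|flat P c t| <= C * t ^+ 2.
Proof.
move=> c0; have [C C0 hC] := poly_expR_bound (P * 'X ^+ 2) c c0.
exists C => // t; rewrite /flat; case: ltP => t0; last first.
  by rewrite normr0 mulr_ge0// sqr_ge0.
have tV0 : 0 <= t^-1 by rewrite invr_ge0 ltW.
have := hC _ tV0; rewrite hornerM hornerXn.
rewrite (normrM _ (t^-1 ^+ 2)) (ger0_norm (exprn_ge0 _ tV0)) normrM.
rewrite (ger0_norm (expR_ge0 _)) => h.
rewrite -ler_pdivrMr ?exprn_gt0//; apply: le_trans h.
by rewrite exprVn mulrAC.
Qed.

(** For [t > 0] this is the product rule, the factors [X ^ 2] coming from the derivative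
    [- 1 / t ^ 2] of [1 / t]; at zero [flat_bound] makes the difference quotient at most [C |h|]. *)
Lemma is_derive_flat (P : {poly R}) (c t : R) : 0 < c ->
  is_derive t 1 (flat P c) (flat (- 'X ^+ 2 * P^`() + c *: 'X ^+ 2 * P) c t).
Proof.
move=> c0; have [t0|t0|->] := ltgtP t 0; last first.
- rewrite {2}/flat ltxx.
  have [C C0 hC] := flat_bound P c c0.
  have h : (fun h : R => h^-1 *: (flat P c (h + 0) - flat P c 0)) @ 0^' --> (0 : R).
    apply/cvgrPdist_le => e e0; near=> h.
    rewrite sub0r normrN addr0 {2}/flat ltxx subr0 /GRing.scale/=.
    have h0 : h != 0 by near: h; exact: nbhs_dnbhs_neq.
    rewrite normrM normfV ler_pdivrMl ?normr_gt0//.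
    apply: le_trans (hC h) _; rewrite -real_normK ?num_real// expr2 mulrA mulrC.
    rewrite ler_wpM2l//.
    suff : `|h| <= e / (C + 1).
      rewrite ler_pdivlMr ?ltr_wpDl//; apply: le_trans.
      by rewrite mulrC ler_wpM2l// lerDl.
    near: h; apply: dnbhs0_le; rewrite divr_gt0// ltr_wpDl//.
  have E : (fun h : R => h^-1 *: (flat P c (h + 0) - flat P c 0)) =
      (fun h => h^-1 *: ((flat P c \o shift 0) (h *: 1) - flat P c 0)).
    by apply/funext => k /=; rewrite [_%:A]mulr1.
  rewrite E in h.
  by apply: DeriveDef; [apply/cvg_ex; exists 0|apply/cvg_lim].
- apply: (@near_eq_is_derive R R R (fun s : R => P.[s^-1] * expR (- c * s^-1)) (flat P c) t 1).
    near=> s; rewrite /flat ifT//; near: s; exact: lt_nbhsr.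
  have dV : is_derive t 1 (fun s : R => s^-1) (- t ^- 2).
    apply: is_derive_eq; first by apply: is_deriveV; rewrite gt_eqF.
    by rewrite /GRing.scale/= mulr1.
  have dP : is_derive t 1 (fun s => P.[s^-1]) (P^`().[t^-1] * (- t ^- 2)).
    exact: (@is_derive1_comp _ (horner P) (fun s : R => s^-1)).
  have dl : is_derive t 1 (fun s => - c * s^-1) (- c * (- t ^- 2)).
    exact: is_deriveZ.
  have dE : is_derive t 1 (fun s => expR (- c * s^-1))
      (expR (- c * t^-1) * (- c * (- t ^- 2))).
    exact: (@is_derive1_comp _ expR (fun s : R => - c * s^-1)).
  have dM := is_deriveM dP dE.
  have -> : flat (- 'X ^+ 2 * P^`() + c *: 'X ^+ 2 * P) c t =
      P.[t^-1] *: (expR (- c * t^-1) * (- c * (- t ^- 2))) +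
      expR (- c * t^-1) *: (P^`().[t^-1] * (- t ^- 2)).
    rewrite /flat t0 /GRing.scale/= !(hornerD, hornerM, hornerN, hornerZ, hornerX).
    rewrite (expr2 t) invfM; ring.
  exact: dM.
- apply: (@near_eq_is_derive R R R (cst 0) (flat P c) t 1).
    near=> s; rewrite /flat ifF//; apply/negbTE; rewrite -leNgt ltW//.
    by near: s; exact: lt_nbhsl.
  by rewrite /flat ltNge (ltW t0)/=; exact: is_derive_cst.
Unshelve. all: by end_near. Qed.

Lemma smooth_flat n (P : {poly R}) (c : R) (i : 'I_n) (s a : R) : 0 < c ->
  smooth (fun x : 'rV[R]_n => flat P c (s * x ord0 i + a)).
Proof.
move=> c0.
apply: (smooth_coord_class (fun h => exists P, h = flat P c)); last by exists P.
- by move=> _ [Q ->] t; have [] := is_derive_flat Q c t c0.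
- move=> _ [Q ->]; eexists; apply/funext => t.
  by rewrite derive1E; have [_ ->] := is_derive_flat Q c t c0; reflexivity.
Qed.

(** The rate [1 / (k + 1)] tends to zero, so these smooth functions converge to the indicator of the
    positive half-line while vanishing exactly off it. *)
Definition flat_bump (k : nat) (t : R) : R := flat 1 (k.+1%:R^-1) t.

Lemma flat_bump_gt0 k t : (0 < flat_bump k t) = (0 < t).
Proof.
rewrite /flat_bump /flat; have [t0|t0] := ltP 0 t; last by rewrite ltxx.
by rewrite hornerE mul1r expR_gt0.
Qed.

Lemma flat_bump_ge0 k t : 0 <= flat_bump k t.
Proof.
rewrite /flat_bump /flat; case: ltP => //= t0.
by rewrite hornerE mul1r expR_ge0.
Qed.

Lemma flat_bump_eq0 k t : t <= 0 -> flat_bump k t = 0.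
Proof. by move=> t0; rewrite /flat_bump /flat ltNge t0. Qed.

Lemma flat_bump_le1 k t : flat_bump k t <= 1.
Proof.
rewrite /flat_bump /flat; case: ltP => //= t0.
rewrite hornerE mul1r -expR0 ler_expR mulNr oppr_le0.
by rewrite mulr_ge0// invr_ge0 ?ltW.
Qed.

Lemma flat_bump_cvg t : 0 < t -> flat_bump k t @[k --> \oo] --> (1 : R).
Proof.
move=> t0; rewrite /flat_bump /flat t0.
rewrite (_ : (fun _ => _) = (fun k => expR (- t^-1 * (k.+1%:R^-1)))); last first.
  by apply/funext => k; rewrite hornerE mul1r mulNr mulrC mulNr.
rewrite -[X in _ --> X]expR0 -[X in expR X](mulr0 (- t^-1)).
apply: continuous_cvg; first exact: continuous_expR.
apply: cvgMr; exact: cvg_harmonic.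
Qed.

Lemma smooth_flat_bump n k (i : 'I_n) (s a : R) :
  smooth (fun x : 'rV[R]_n => flat_bump k (s * x ord0 i + a)).
Proof. by apply: smooth_flat; rewrite invr_gt0. Qed.

End flat.

Section test_function.
Context {R : realType} {n : nat}.
Local Notation mu := (lebesgue_rV R n).
Implicit Types (D : set 'rV[R]_n) (u phi : 'rV[R]_n -> R) (a b : 'rV[R]_n).

Definition cbox a b : set 'rV[R]_n :=
  [set x | forall i, a ord0 i <= x ord0 i <= b ord0 i].

Lemma sub_box_cbox a b : box a b `<=` cbox a b.
Proof. by move=> x xab i; have /andP[/ltW-> /ltW->] := xab i. Qed.

Lemma compact_cbox a b : compact (cbox a b).
Proof.
have -> : cbox a b = [set v : 'rV[R]_n | forall i, `[a ord0 i, b ord0 i]%classic (v ord0 i)].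
  by apply/seteqP; split => x xab i; have := xab i; rewrite /= in_itv.
by apply: (@rV_compact _ _ (fun i => `[a ord0 i, b ord0 i]%classic)) => i; exact: segment_compact.
Qed.

Lemma closed_cbox a b : closed (cbox a b).
Proof. by apply: compact_closed => //; exact: compact_cbox. Qed.

Lemma measurable_cbox a b : measurable (cbox a b).
Proof. apply: compact_measurable_rV; exact: compact_cbox. Qed.

Lemma test_function_box D phi a b : smooth phi ->
  [set x | phi x != 0] `<=` box a b -> cbox a b `<=` D -> test_function D phi.
Proof.
move=> sphi phiab abD.
have cl : closure [set x | phi x != 0] `<=` cbox a b.
  rewrite closureE; apply: smallest_sub; first exact: closed_cbox.
  by apply: subset_trans phiab _; exact: sub_box_cbox.
split => //; last exact: subset_trans cl abD.
by apply: subclosed_compact cl; [exact: closed_closure|exact: compact_cbox].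
Qed.

Lemma test_function_support D phi x :
  ~ closure [set x | phi x != 0] x -> phi x = 0.
Proof.
move=> /(contra_not (@subset_closure _ _ _)) /negP/negPn/eqP.
exact.
Qed.

Lemma test_function_measurable D phi : test_function D phi ->
  measurable_fun setT phi.
Proof. by move=> [sphi _ _]; apply: continuous_measurable_rV; exact: smooth_continuous. Qed.

Lemma test_function_bounded D phi : test_function D phi ->
  exists2 M, 0 <= M & forall x, `|phi x| <= M.
Proof.
move=> [sphi cphi _].
have : compact (phi @` closure [set x | phi x != 0]).
  apply: continuous_compact => //; apply: continuous_subspaceT.
  exact: smooth_continuous.
move=> /compact_bounded[M [_ /(_ (`|M| + 1))]].
rewrite ltr_pwDr ?ler_norm// => /(_ isT) hM.
exists (`|M| + 1) => // x.
have [cx|ncx] := pselect (closure [set x | phi x != 0] x).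
  by apply: hM; exists x.
by rewrite (test_function_support D)// normr0.
Qed.

Lemma locally_integrable_integrable D u K : measurable D -> locally_integrable_rV D u ->
  compact K -> K `<=` D -> mu.-integrable K (EFin \o u).
Proof.
move=> mD [mu_ iu] cK KD; apply/integrableP; split; last exact: iu.
by apply/measurable_EFinP; exact: measurable_funS mD KD mu_.
Qed.

Lemma integrable_mul_test D u phi : measurable D ->
  locally_integrable_rV D u -> test_function D phi ->
  mu.-integrable D (EFin \o (fun x => u x * phi x)).
Proof.
move=> mD lu tphi; have [M M0 hM] := test_function_bounded _ _ tphi.
have [sphi cphi phiD] := tphi.
set K := closure _ in cphi phiD.
have iK := locally_integrable_integrable D u K mD lu cphi phiD.
have mK := compact_measurable_rV _ cphi.
apply: (le_integrable mD (g := fun x => (M%:E * ((EFin \o u) \_ K) x)%E)).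
- apply/measurable_EFinP/measurable_funM; first by case: lu.
  apply: measurable_funTS; exact: test_function_measurable tphi.
- move=> x Dx; rewrite patchE; case: ifPn => xK.
    by rewrite /= lee_fin !normrM mulrC ler_wpM2r// (ger0_norm M0).
  have p0 : phi x = 0.
    by apply: (test_function_support D) => xK'; move/negP: xK; apply; rewrite inE.
  rewrite [X in (X <= _)%E](_ : _ = 0%E); first exact: abse_ge0.
  by rewrite /= p0 mulr0 normr0.
apply: integrableZl => //; apply: (@integrableS _ _ _ mu setT D) => //.
exact/(integrable_mkcond _ mK).
Qed.

End test_function.

Section box_bump.
Context {R : realType} {n : nat}.
Implicit Types (D : set 'rV[R]_n) (u phi : 'rV[R]_n -> R) (a b : 'rV[R]_n).

(** A smooth approximation from below of the indicator of an open box. The coordinates appear as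
    [s * x + a] with [s = 1] or [s = -1], the form in which [smooth_flat_bump] is stated. *)
Definition box_bump (k : nat) a b (x : 'rV[R]_n) : R :=
  \prod_(i < n) (flat_bump k (1 * x ord0 i + - a ord0 i) *
                 flat_bump k (- 1 * x ord0 i + b ord0 i)).

Lemma smooth_box_bump k a b : smooth (box_bump k a b).
Proof. by apply: smooth_prod => i; apply: smoothM; exact: smooth_flat_bump. Qed.

Lemma box_bump_ge0 k a b x : 0 <= box_bump k a b x.
Proof. by apply: prodr_ge0 => i _; rewrite mulr_ge0 ?flat_bump_ge0. Qed.

Lemma box_bump_le1 k a b x : box_bump k a b x <= 1.
Proof.
apply: prodr_ile1 => i _; rewrite mulr_ge0 ?flat_bump_ge0//=.
by rewrite mulr_ile1 ?flat_bump_ge0 ?flat_bump_le1.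
Qed.

Lemma box_bump_notin k a b x : ~ box a b x -> box_bump k a b x = 0.
Proof.
move=> /existsNP[i xi]; apply/eqP; rewrite prodf_seq_eq0; apply/hasP.
exists i; first by rewrite mem_index_enum.
rewrite /= mulf_eq0; apply/orP.
have [h1|h1] := ltP (a ord0 i) (x ord0 i); last first.
  by left; rewrite flat_bump_eq0// mul1r subr_le0.
right; rewrite flat_bump_eq0// mulN1r addrC subr_le0 leNgt.
by apply/negP => h2; apply: xi; rewrite h1.
Qed.

Lemma cvg_prodr (I : Type) (r : seq I) (F : I -> nat -> R) (l : I -> R) :
  (forall i, F i k @[k --> \oo] --> l i) ->
  \prod_(i <- r) F i k @[k --> \oo] --> \prod_(i <- r) l i.
Proof.
move=> Fl; elim: r => [|i r IH].
  by under eq_fun do rewrite big_nil; rewrite big_nil; exact: cvg_cst.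
by under eq_fun do rewrite big_cons; rewrite big_cons; exact: cvgM.
Qed.

Lemma box_bump_cvg a b x : box_bump k a b x @[k --> \oo] --> (\1_(box a b) x : R).
Proof.
rewrite indicE; have [xab|nx] := pselect (box a b x); last first.
  rewrite memNset//; under eq_fun do rewrite box_bump_notin//.
  exact: cvg_cst.
rewrite mem_set//= [X in _ --> X](_ : _ = \prod_(i < n) (1 * 1)); last first.
  by rewrite mul1r big1.
apply: cvg_prodr => i.
by apply: cvgM; apply: flat_bump_cvg; have /andP[] := xab i;
  rewrite ?mul1r ?mulN1r ?subr_gt0// addrC subr_gt0.
Qed.

Lemma test_function_box_bump D k a b : cbox a b `<=` D ->
  test_function D (box_bump k a b).
Proof.
apply: test_function_box; first exact: smooth_box_bump.
by move=> x /=; apply: contra_neqP; exact: box_bump_notin.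
Qed.

End box_bump.

(** * The fundamental lemma of the calculus of variations *)

Section fundamental_lemma.
Context {R : realType} {n : nat}.
Local Notation mu := (lebesgue_rV R n).
Implicit Types (D : set 'rV[R]_n) (w phi : 'rV[R]_n -> R) (a b : 'rV[R]_n).

(** The positive and negative parts of [f] are the densities of two measures that agree on boxes,
    hence on all measurable sets; so [f] has zero integral over every measurable set. *)
Lemma ae_eq0_of_box (f : 'rV[R]_n -> \bar R) : mu.-integrable setT f ->
  (forall a b, \int[mu]_(x in box a b) f x = 0)%E -> ae_eq mu setT f (cst 0%E).
Proof.
move=> intf f0; have mf := measurable_int _ intf.
have box_pn a b : (\int[mu]_(x in box a b) f^\+ x =
    \int[mu]_(x in box a b) f^\- x)%E.
  have := f0 a b; rewrite integralE => /eqP.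
  rewrite sube_eq ?add0e; first by move=> /eqP.
    apply: integrable_fin_num; first exact: measurable_box.
    apply: integrable_funepos; first exact: measurable_box.
    by apply: integrableS intf => //; exact: measurable_box.
  rewrite fin_num_adde_defl//.
  apply: integrable_fin_num; first exact: measurable_box.
  apply: integrable_funeneg; first exact: measurable_box.
  by apply: integrableS intf => //; exact: measurable_box.
have mp : measurable_fun setT f^\+%E by exact: measurable_funepos.
have mn : measurable_fun setT f^\-%E by exact: measurable_funeneg.
have nng0 (g : 'rV[R]_n -> \bar R) : (\int[mu]_(x in set0) g x = 0)%E.
  by rewrite integral_set0.
have nge0 (g : 'rV[R]_n -> \bar R) (g0 : forall x, (0 <= g x)%E) A :
  (0 <= \int[mu]_(x in A) g x)%E by exact: integral_ge0.
pose np := isMeasure.Build _ _ _ (fun A => \int[mu]_(x in A) f^\+ x)%E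
  (nng0 _) (nge0 _ (funepos_ge0 f))
  (@semi_sigma_additive_nng_induced _ _ _ mu f^\+%E mp (funepos_ge0 f)).
pose nn := isMeasure.Build _ _ _ (fun A => \int[mu]_(x in A) f^\- x)%E
  (nng0 _) (nge0 _ (funeneg_ge0 f))
  (@semi_sigma_additive_nng_induced _ _ _ mu f^\-%E mn (funeneg_ge0 f)).
pose m1 : {measure set 'rV[R]_n -> \bar R} := HB.pack (fun A => \int[mu]_(x in A) f^\+ x)%E np.
pose m2 : {measure set 'rV[R]_n -> \bar R} := HB.pack (fun A => \int[mu]_(x in A) f^\- x)%E nn.
have pn A : measurable A -> (\int[mu]_(x in A) f^\+ x = \int[mu]_(x in A) f^\- x)%E.
  move=> mA; apply: (rV_measure_unique m1 m2) => // a b /=.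
  apply: integral_fune_lt_pinfty; first exact: measurable_box.
  apply: integrable_funepos; first exact: measurable_box.
  by apply: integrableS intf => //; exact: measurable_box.
apply: integral_ae_eq => // E _ mE.
rewrite integral0 integralE pn// subee//.
apply: integrable_fin_num => //; apply: integrable_funeneg => //.
exact: integrableS intf.
Qed.

(** The functions [box_bump k a b] are admissible test functions and converge boundedly to the
    indicator of the box; dominated convergence with majorant [|w|] on the closed box passes to the
    limit. *)
Lemma integral_box_eq0 D w a b : open D -> locally_integrable_rV D w ->
  (forall phi, test_function D phi -> \int[mu]_(x in D) (w x * phi x) = 0) ->
  cbox a b `<=` D -> (\int[mu]_(x in box a b) (w x)%:E = 0)%E.
Proof.
move=> oD lw w0 abD.
have mD := open_measurable_rV _ oD.
have iw := locally_integrable_integrable _ _ _ mD lw (compact_cbox a b) abD.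
have mc := measurable_cbox a b.
have mb := measurable_box a b.
have bc := sub_box_cbox a b.
have mw : measurable_fun (cbox a b) w by apply/measurable_EFinP; exact: measurable_int iw.
have h k : (\int[mu]_(x in cbox a b) (w x * box_bump k a b x)%:E = 0)%E.
  have tk := test_function_box_bump D k a b abD.
  have := w0 _ tk; rewrite /Rintegral => h0.
  have : (\int[mu]_(x in D) (w x * box_bump k a b x)%:E = 0)%E.
    rewrite -[LHS]fineK ?h0//.
    apply: integrable_fin_num => //; exact: integrable_mul_test.
  move=> <-; rewrite [RHS]integral_mkcond [LHS]integral_mkcond.
  apply: eq_integral => x _; rewrite !patchE.
  case: ifPn => xc; first by rewrite mem_set//; apply: abD; exact: set_mem.
  case: ifPn => // xD; rewrite box_bump_notin ?mulr0//.
  by move=> /bc xcb; move/negP : xc; apply; rewrite inE.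
transitivity (\int[mu]_(x in cbox a b) (w x * \1_(box a b) x)%:E)%E.
  rewrite integral_mkcond [RHS]integral_mkcond; apply: eq_integral => x _.
  rewrite !patchE indicE; case: ifPn => xb.
    by rewrite mem_set ?mulr1//; exact/bc/set_mem.
  by case: ifPn => // _; rewrite mulr0.
have mbb k : measurable_fun (cbox a b) (box_bump k a b).
  apply: measurable_funTS; apply: continuous_measurable_rV.
  by apply: smooth_continuous; exact: smooth_box_bump.
have : (\int[mu]_(x in cbox a b) (w x * box_bump k a b x)%:E @[k --> \oo] -->
    \int[mu]_(x in cbox a b) (w x * \1_(box a b) x)%:E)%E.
  apply: (@dominated_cvg _ _ _ mu _ mc _ _ (fun x => `|w x|%:E)) => //.
  - by move=> k; apply/measurable_EFinP/measurable_funM.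
  - move=> x _; apply: cvg_EFin; first by apply: nearW.
    by apply: cvgMr; exact: box_bump_cvg.
  - exact: integrable_norm.
  - move=> k x _; rewrite /= lee_fin normrM ler_piMr//.
    by rewrite ger0_norm ?box_bump_ge0// box_bump_le1.
under eq_fun do rewrite h.
by move=> /cvg_lim <-//; rewrite lim_cst.
Qed.

Lemma ae_countable_bigcup (I : countType) (A : set I) (F : I -> set 'rV[R]_n)
    (P : 'rV[R]_n -> Prop) :
  (forall i, A i -> {ae mu, forall x, F i x -> P x}) ->
  {ae mu, forall x, (\bigcup_(i in A) F i) x -> P x}.
Proof.
move=> h.
have : {ae mu, forall x, forall k : nat, forall i, unpickle k = Some i -> A i -> F i x -> P x}.
  apply: ae_foralln => k; case E : (unpickle k) => [i|]; last by apply: aeW.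
  have [Ai|nAi] := pselect (A i).
    by apply: filterS (h _ Ai) => x Px j [<-].
  by apply: aeW => x j [<-].
by apply: filterS => x hx [i Ai Fx]; apply: (hx (pickle i) i); rewrite ?pickleK.
Qed.

(** Countably many boxes with closure in [U] cover [U]. On such a box a locally integrable function
    is integrable, which is the point of the reduction. *)
Lemma ae_open_box (U : set 'rV[R]_n) (P : 'rV[R]_n -> Prop) : open U ->
  (forall a b, cbox a b `<=` U -> {ae mu, forall x, box a b x -> P x}) ->
  {ae mu, forall x, U x -> P x}.
Proof.
move=> oU UP; rewrite (open_bigcup_ball _ oU).
apply: ae_countable_bigcup => q /= qU.
set c : 'rV[R]_n := \row_i _ in qU *; set r := _^-1 in qU *.
have r0 : 0 < r by rewrite invr_gt0.
rewrite ball_box//; apply: UP => x xab; apply: qU.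
apply/ball_rV; first by rewrite mulr_gt0.
move=> i; apply: (@le_lt_trans _ _ r); last by rewrite ltr_pMl// ltr1n.
by have := xab i; rewrite !mxE distrC ler_distl.
Qed.

(** Extended by zero from one box, [w] is integrable over the whole space; since the intersection of
    two boxes is a box, its integrals over all boxes vanish. *)
Lemma fundamental_lemma D w : open D -> locally_integrable_rV D w ->
  (forall phi, test_function D phi -> \int[mu]_(x in D) (w x * phi x) = 0) ->
  {ae mu, forall x, D x -> w x = 0}.
Proof.
move=> oD lw w0; apply: ae_open_box => // a b abD.
have mb := measurable_box a b.
have iw : mu.-integrable (box a b) (EFin \o w).
  apply: integrableS (sub_box_cbox a b) _ => //; first exact: measurable_cbox.
  apply: locally_integrable_integrable lw _ abD; last exact: compact_cbox.
  exact: open_measurable_rV.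
have := ae_eq0_of_box ((EFin \o w) \_ (box a b)).
rewrite -(integrable_mkcond _ mb) => /(_ iw) h.
have : ae_eq mu setT ((EFin \o w) \_ (box a b)) (cst 0%E).
  apply: h => a' b'; rewrite -integral_mkcondr.
  rewrite boxI; apply: integral_box_eq0 oD lw w0 _.
  apply: subset_trans abD => x xab i; have := xab i.
  rewrite !mxE ge_max le_min.
  by move=> /andP[/andP[_ ->] /andP[_ ->]].
apply: filterS => x /= /(_ I); rewrite patchE => + xb.
by rewrite mem_set// => -[].
Qed.

End fundamental_lemma.

(** * Weak derivatives along lines *)

Section unit_interval_fubini.
Context {R : realType} {n : nat}.
Local Notation mu := (lebesgue_rV R n).
Local Notation leb1 := (@lebesgue_measure R).
Local Notation I01 := (`[0, 1]%classic : set R).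

(** Restriction to the unit interval by a boolean test keeps the function jointly measurable in
    [(x, t)], and so brings the Fubini theorems on the whole line to bear on [[0, 1]]. *)
Let uncut (f : 'rV[R]_n -> R -> \bar R) x t : \bar R :=
  if (0 <= t <= 1)%R then f x t else 0%E.

Let uncutE f x : uncut f x = (f x) \_ I01.
Proof.
apply/funext => t; rewrite /uncut patchE.
by case: ifPn => t01; [rewrite mem_set//= in_itv|rewrite memNset//= in_itv; exact/negP].
Qed.

Let measurable_uncut (f : 'rV[R]_n -> R -> \bar R) :
  measurable_fun setT (fun z : 'rV[R]_n * measurableTypeR R => f z.1 z.2) ->
  measurable_fun setT (fun z : 'rV[R]_n * measurableTypeR R => uncut f z.1 z.2).
Proof.
move=> mf; apply: measurable_fun_ifT => //.
apply: measurable_and; apply: measurable_fun_ler => //.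
Qed.

Lemma tonelli_rV01 (f : 'rV[R]_n -> R -> \bar R) :
  measurable_fun setT (fun z : 'rV[R]_n * measurableTypeR R => f z.1 z.2) ->
  (forall x y, 0 <= f x y)%E ->
  (\int[mu]_x \int[leb1]_(t in I01) f x t = \int[leb1]_(t in I01) \int[mu]_x f x t)%E.
Proof.
move=> mf f0.
transitivity (\int[mu]_x \int[leb1]_t uncut f x t)%E.
  by apply: eq_integral => x _; rewrite integral_mkcond uncutE.
rewrite tonelli_rV_R; last 2 first.
- exact: measurable_uncut.
- by move=> x t; rewrite /uncut; case: ifP.
rewrite [RHS]integral_mkcond; apply: eq_integral => t _; rewrite patchE.
under eq_integral do rewrite uncutE patchE.
by case: ifPn => // _; rewrite integral0.
Qed.

Lemma measurable_integral01 (f : 'rV[R]_n -> R -> \bar R) :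
  measurable_fun setT (fun z : 'rV[R]_n * measurableTypeR R => f z.1 z.2) ->
  measurable_fun setT (fun x => \int[leb1]_(t in I01) f x t)%E.
Proof.
have ge0 (g : 'rV[R]_n -> R -> \bar R) : (forall x y, 0 <= g x y)%E ->
    measurable_fun setT (fun z : 'rV[R]_n * measurableTypeR R => g z.1 z.2) ->
    measurable_fun setT (fun x => \int[leb1]_(t in I01) g x t)%E.
  move=> g0 mg.
  rewrite (_ : (fun _ => _) = (fun x => \int[leb1]_t uncut g x t)%E).
    apply: measurable_tonelli_rV_R; first exact: measurable_uncut.
    by move=> x t; rewrite /uncut; case: ifP.
  by apply/funext => x; rewrite integral_mkcond uncutE.
move=> mf.
rewrite (_ : (fun _ => _) = (fun x => \int[leb1]_(t in I01) (fun z : 'rV[R]_n * measurableTypeR R => f z.1 z.2)^\+ (x, t) -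
   \int[leb1]_(t in I01) (fun z : 'rV[R]_n * measurableTypeR R => f z.1 z.2)^\- (x, t))%E).
  apply: emeasurable_funB; apply: ge0.
  - by move=> x t; exact: funepos_ge0.
  - rewrite (_ : (fun _ => _) = (fun z : 'rV[R]_n * measurableTypeR R => f z.1 z.2)^\+%E); last by apply/funext => -[].
    exact: measurable_funepos.
  - by move=> x t; exact: funeneg_ge0.
  - rewrite (_ : (fun _ => _) = (fun z : 'rV[R]_n * measurableTypeR R => f z.1 z.2)^\-%E); last by apply/funext => -[].
    exact: measurable_funeneg.
apply/funext => x; rewrite integralE; congr (_ - _)%E.
  by apply: eq_integral => t _; rewrite !funeposE.
by apply: eq_integral => t _; rewrite !funenegE.
Qed.

Lemma fubini_rV01 (f : 'rV[R]_n -> R -> \bar R) :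
  measurable_fun setT (fun z : 'rV[R]_n * measurableTypeR R => f z.1 z.2) ->
  (\int[leb1]_(t in I01) \int[mu]_x `|f x t| < +oo)%E ->
  (\int[mu]_x \int[leb1]_(t in I01) f x t = \int[leb1]_(t in I01) \int[mu]_x f x t)%E.
Proof.
move=> mf foo.
transitivity (\int[mu]_x \int[leb1]_t uncut f x t)%E.
  by apply: eq_integral => x _; rewrite integral_mkcond uncutE.
rewrite fubini_rV_R; last 2 first.
- exact: measurable_uncut.
- apply: le_lt_trans foo; rewrite [leRHS]integral_mkcond.
  rewrite le_eqVlt; apply/orP; left; apply/eqP.
  apply: eq_integral => t _; rewrite patchE /uncut -(_ : t \in I01 = (0 <= t <= 1)).
    by case: ifPn => // _; rewrite integral0_eq// => x _; rewrite abse0.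
  by apply/idP/idP; rewrite inE/= in_itv.
rewrite [RHS]integral_mkcond; apply: eq_integral => t _; rewrite patchE.
under eq_integral do rewrite uncutE patchE.
by case: ifPn => // _; rewrite integral0.
Qed.

Lemma measurable_line (h : 'rV[R]_n) :
  measurable_fun setT (fun z : 'rV[R]_n * measurableTypeR R => z.1 + z.2 *: h).
Proof.
apply: measurable_fun_coordP => i.
rewrite (_ : (fun _ => _) = fun z : 'rV[R]_n * measurableTypeR R =>
    z.1 ord0 i + z.2 * h ord0 i).
  apply: measurable_funD.
    exact: (measurableT_comp (measurable_coord i)).
  by apply: measurable_funM.
by apply/funext => z; rewrite !mxE.
Qed.

End unit_interval_fubini.

Section directional.
Context {R : realType} {n : nat}.
Local Notation leb1 := (@lebesgue_measure R).
Local Notation I01 := (`[0, 1]%classic : set R).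
Implicit Types (D : set 'rV[R]_n) (phi : 'rV[R]_n -> R) (h x : 'rV[R]_n).

(** The derivative along [h] is written through the coordinate partials because [is_weak_gradient]
    tests against those only; [dir_partialE] identifies it with the differential. *)
Definition dir_partial h phi x : R := \sum_(i < n) h ord0 i * partial i phi x.

Lemma dir_partialE h phi x : smooth phi -> dir_partial h phi x = 'd phi x h.
Proof.
move=> sphi; rewrite /dir_partial {2}[h]row_sum_delta linear_sum.
apply: eq_bigr => i _; rewrite linearZ/= /partial deriveE//.
exact: smooth_differentiable.
Qed.

Lemma smooth_dir_partial h phi : smooth phi -> smooth (dir_partial h phi).
Proof.
move=> sphi; rewrite /dir_partial; elim: (index_enum _) => [|i r IH].
  rewrite (_ : (fun _ => _) = cst 0); first exact: smooth_cst.
  by apply/funext => x; rewrite big_nil.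
rewrite (_ : (fun _ => _) = (fun x => h ord0 i * partial i phi x +
    \sum_(j <- r) h ord0 j * partial j phi x)).
  apply: smoothD IH; apply: (smoothM (cst _)); first exact: smooth_cst.
  exact: smooth_partial.
by apply/funext => x; rewrite big_cons.
Qed.

Lemma dir_partial_support h phi x : ~ closure [set x | phi x != 0] x ->
  dir_partial h phi x = 0.
Proof.
move=> nx; rewrite /dir_partial big1// => i _.
suff -> : partial i phi x = 0 by rewrite mulr0.
rewrite /partial -[RHS](@derive_cst _ _ _ (0 : R) x (delta_mx ord0 i)).
apply: near_eq_derive.
have oC : open (~` closure [set x | phi x != 0]).
  by apply: closed_openC; exact: closed_closure.
have := open_nbhs_nbhs (conj oC nx); apply: filterS => y ny.
exact: test_function_support setT phi y ny.
Qed.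

Lemma test_function_dir_partial D h phi : test_function D phi ->
  test_function D (dir_partial h phi).
Proof.
move=> [sphi cphi phiD].
have cl : closure [set x | dir_partial h phi x != 0] `<=`
    closure [set x | phi x != 0].
  rewrite [X in X `<=` _]closureE; apply: smallest_sub; first exact: closed_closure.
  by move=> x; apply: contraPP => /dir_partial_support h0; apply/negP/negPn/eqP.
split; first exact: smooth_dir_partial.
- by apply: subclosed_compact cl; [exact: closed_closure|].
- exact: subset_trans phiD.
Qed.

Lemma partial_dir i phi : partial i phi = dir_partial (delta_mx ord0 i) phi.
Proof.
apply/funext => x; rewrite /dir_partial (bigD1 i)//= mxE !eqxx mul1r big1 ?addr0//.
by move=> j ji; rewrite mxE eqxx (negbTE ji) mul0r.
Qed.

Lemma test_function_partial D phi i :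
  test_function D phi -> test_function D (partial i phi).
Proof. by rewrite partial_dir; exact: test_function_dir_partial. Qed.

Lemma is_derive_line (x k : 'rV[R]_n) (t : R) :
  is_derive t 1 (fun t : R => x + t *: k) k.
Proof.
have E : (fun s : R => s^-1 *: (((fun t : R => x + t *: k) \o shift t) (s *: 1) - (x + t *: k)))
    @ 0^' --> k.
  apply: cvg_near_cst; exists 1 => //= s _ s0.
  have -> : x + (s%:A + t) *: k - (x + t *: k) = s *: k.
    by rewrite [s%:A]mulr1 scalerDl opprD addrACA subrr add0r addrK.
  by rewrite scalerA mulVf ?scale1r.
by apply: DeriveDef; [apply/cvg_ex; exists k|exact/cvg_lim].
Qed.

Lemma is_derive_smooth_line phi (x k : 'rV[R]_n) (t : R) : smooth phi ->
  is_derive t 1 (fun t : R => phi (x + t *: k)) (dir_partial k phi (x + t *: k)).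
Proof.
move=> sphi; have dl := is_derive_line x k t.
have dl' : differentiable (fun t : R => x + t *: k) t.
  by apply/derivable1_diffP; have [] := dl.
have dphi := smooth_differentiable phi (x + t *: k) sphi.
apply: DeriveDef.
  by apply: diff_derivable; exact: (@differentiable_comp _ _ _ _ (fun t : R => x + t *: k) phi).
rewrite deriveE; last exact: (@differentiable_comp _ _ _ _ (fun t : R => x + t *: k) phi).
rewrite (@diff_comp _ _ _ _ (fun t : R => x + t *: k) phi)//=.
have -> : 'd (fun t : R => x + t *: k) t 1 = k by rewrite -deriveE//; have [_] := dl.
by rewrite dir_partialE.
Qed.

Lemma continuous_line phi (x k : 'rV[R]_n) : continuous phi ->
  continuous (fun t : R => phi (x + t *: k)).
Proof.
move=> cphi t; apply: (@continuous_comp _ _ _ (fun t : R => x + t *: k) phi); last exact: cphi.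
apply: differentiable_continuous; apply/derivable1_diffP.
by have [] := is_derive_line x k t.
Qed.

Lemma smooth_FTC phi (x k : 'rV[R]_n) : smooth phi ->
  (\int[leb1]_(t in I01) (dir_partial k phi (x + t *: k))%:E =
  (phi (x + k) - phi x)%:E)%E.
Proof.
move=> sphi.
have cphi := smooth_continuous phi sphi.
rewrite (@continuous_FTC2 _ _ (fun t : R => phi (x + t *: k)) 0 1)//.
- by rewrite scale1r scale0r addr0 EFinB.
- apply: continuous_subspaceT; apply: continuous_line.
  by apply: smooth_continuous; exact: smooth_dir_partial.
- split.
  + by move=> t _; have [] := is_derive_smooth_line phi x k t sphi.
  + by apply: cvg_at_right_filter; exact: continuous_line.
  + by apply: cvg_at_left_filter; exact: continuous_line.
- by move=> t _; rewrite derive1E; have [_ ->] := is_derive_smooth_line phi x k t sphi.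
Qed.

End directional.

Section segments.
Context {R : realType} {n : nat}.
Local Notation I01 := (`[0, 1]%classic : set R).
Implicit Types (D : set 'rV[R]_n) (phi : 'rV[R]_n -> R) (h x : 'rV[R]_n).

(** The set on which the line identity in direction [h] can be asked for. *)
Definition seg D h : set 'rV[R]_n :=
  [set x | forall t : R, 0 <= t <= 1 -> D (x + t *: h)].

Lemma continuous_line2 h : continuous (fun z : 'rV[R]_n * R => z.1 + z.2 *: h).
Proof.
move=> z; apply: cvgD; first exact: cvg_fst.
by apply: cvgZr_tmp; exact: cvg_snd.
Qed.

(** The tube lemma: compactness of [[0, 1]] gives one neighbourhood of [x] that serves every [t]. *)
Lemma open_seg D h : open D -> open (seg D h).
Proof.
move=> oD; rewrite openE => x xD; rewrite /interior.
have -> : seg D h = [set y | I01 `<=` (fun t => D (y + t *: h))].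
  by apply/seteqP; split => y yD t t01; apply: yD; move: t01; rewrite /= in_itv.
apply: ((compact_near_coveringP I01).1 (@segment_compact R 0 1) _ (nbhs x)
  (fun y t => D (y + t *: h))) => t t01.
have Dxt : D (x + t *: h) by apply: xD; move: t01; rewrite /= in_itv.
have : nbhs (x, t) ((fun z : 'rV[R]_n * R => z.1 + z.2 *: h) @^-1` D).
  by apply: continuous_line2; exact: open_nbhs_nbhs.
move=> [[A B] [/= xA tB] AB]; exists (B, A) => //= -[s y] [/= Bs Ay].
exact: (AB (y, s)).
Qed.

(** The region swept by [K] along [h]. For compact [K] it is again compact, so functions that are
    only locally integrable on [D] become integrable on the whole space when cut off to it. *)
Definition segs (K : set 'rV[R]_n) h : set 'rV[R]_n :=
  (fun z : 'rV[R]_n * R => z.1 + z.2 *: h) @` (K `*` I01).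

Lemma compact_segs K h : compact K -> compact (segs K h).
Proof.
move=> cK; apply: continuous_compact; last exact: compact_setX cK (@segment_compact R 0 1).
by apply: continuous_subspaceT; exact: continuous_line2.
Qed.

Lemma segs_sub K D h : K `<=` seg D h -> segs K h `<=` D.
Proof. by move=> KD _ [[x t] [/= Kx] + <-]; rewrite in_itv/= => t01; exact: KD. Qed.

Lemma test_function_translate D h phi t : 0 <= t <= 1 ->
  test_function (seg D h) phi -> test_function D (fun x => phi (x - t *: h)).
Proof.
move=> t01 [sphi cphi phiD]; set K := closure _ in cphi phiD.
have cK := compact_segs K h cphi.
have cl : closure [set x | phi (x - t *: h) != 0] `<=` segs K h.
  rewrite closureE; apply: smallest_sub; first exact: compact_closed.
  move=> x /= phix; exists (x - t *: h, t); last by rewrite /= subrK.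
  by split; [exact: subset_closure|rewrite /= in_itv].
split; first exact: smooth_shift.
- by apply: subclosed_compact cl => //; exact: closed_closure.
- by apply: subset_trans cl _; exact: segs_sub.
Qed.

Lemma dir_partial_shift h phi y x :
  dir_partial h (fun x => phi (x + y)) x = dir_partial h phi (x + y).
Proof. by apply: eq_bigr => i _; rewrite partial_shift. Qed.

End segments.

Section integrals_on_lines.
Context {R : realType} {n : nat}.
Local Notation mu := (lebesgue_rV R n).
Local Notation leb1 := (@lebesgue_measure R).
Local Notation I01 := (`[0, 1]%classic : set R).
Implicit Types (g : 'rV[R]_n -> R) (h x : 'rV[R]_n).

Lemma measurable_comp_line g h : measurable_fun setT g ->
  measurable_fun setT (fun z : 'rV[R]_n * measurableTypeR R => g (z.1 + z.2 *: h)).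
Proof. by move=> mg; exact: measurableT_comp mg (measurable_line h). Qed.

Lemma integral01_cst (c : \bar R) : (\int[leb1]_(t in I01) c = c)%E.
Proof.
rewrite integral_cst//= lebesgue_measure_itv/= lte_fin ltr01 sube0 mule1//.
Qed.

Lemma integral_line_fin g h : mu.-integrable setT (EFin \o g) ->
  (\int[leb1]_(t in I01) \int[mu]_x `|(g (x + t *: h))%:E| < +oo)%E.
Proof.
move=> /integrableP[mg goo].
rewrite [ltLHS](_ : _ = \int[leb1]_(t in I01) (\int[mu]_x `|(g x)%:E|))%E.
  by rewrite integral01_cst.
apply: eq_integral => t _.
rewrite (ge0_integral_shift _ (fun x => `|(g x)%:E|%E))//.
exact: measurableT_comp.
Qed.

(** By Tonelli the integral of [|f x t|] over [t] has finite integral in [x], and is therefore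
    finite at almost every [x]. *)
Lemma ae_integrable01 (f : 'rV[R]_n -> R -> R) :
  measurable_fun setT (fun z : 'rV[R]_n * measurableTypeR R => f z.1 z.2) ->
  (\int[leb1]_(t in I01) \int[mu]_x `|(f x t)%:E| < +oo)%E ->
  {ae mu, forall x, leb1.-integrable I01 (fun t => (f x t)%:E)}.
Proof.
move=> mf.
rewrite -(tonelli_rV01 (fun x t => `|(f x t)%:E|%E)) => //; last first.
  by apply/measurable_EFinP; exact: measurableT_comp.
move=> foo.
have mF : measurable_fun setT (fun x => \int[leb1]_(t in I01) `|(f x t)%:E|)%E.
  apply: (measurable_integral01 (fun x t => `|(f x t)%:E|%E)).
  by apply/measurable_EFinP; exact: measurableT_comp.
have : mu.-integrable setT (fun x => \int[leb1]_(t in I01) `|(f x t)%:E|)%E.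
  apply/integrableP; split => //.
  under eq_integral do rewrite gee0_abs ?integral_ge0//.
  exact: foo.
move=> /integrable_ae => /(_ measurableT); apply: filterS => x /(_ I) xfin.
apply/integrableP; split.
  apply/measurable_EFinP; apply: measurable_funTS.
  exact: (measurableT_comp mf (measurable_pair1 x)).
by rewrite ltey_eq xfin.
Qed.

End integrals_on_lines.

Section weak_line.
Context {R : realType} {n : nat}.
Local Notation mu := (lebesgue_rV R n).
Local Notation leb1 := (@lebesgue_measure R).
Local Notation I01 := (`[0, 1]%classic : set R).
Implicit Types (D K : set 'rV[R]_n) (u v g G phi : 'rV[R]_n -> R) (h x : 'rV[R]_n).

Lemma integrable_mul_bounded (v psi : 'rV[R]_n -> R) M :
  mu.-integrable setT (EFin \o v) -> measurable_fun setT psi ->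
  (forall x, `|psi x| <= M) ->
  mu.-integrable setT (fun x => (v x * psi x)%:E).
Proof.
move=> iv mpsi psiM.
have M0 : 0 <= M by apply: le_trans (psiM 0).
apply: (le_integrable measurableT (g := fun x => (M%:E * (EFin \o v) x)%E)).
- apply/measurable_EFinP/measurable_funM => //.
  by apply/measurable_EFinP; exact: measurable_int iv.
- move=> x _; rewrite /= lee_fin !normrM mulrC ler_wpM2r// (le_trans (psiM x))//.
  exact: ler_norm.
- exact: integrableZl.
Qed.

Lemma integral_line_mul_fin g (psi : 'rV[R]_n -> R -> R) h M :
  mu.-integrable setT (EFin \o g) ->
  measurable_fun setT (fun z : 'rV[R]_n * measurableTypeR R => psi z.1 z.2) ->
  (forall x t, `|psi x t| <= M) ->
  (\int[leb1]_(t in I01) \int[mu]_x `|(g (x + t *: h) * psi x t)%:E| < +oo)%E.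
Proof.
move=> ig mpsi psiM.
have M0 : 0 <= M by apply: le_trans (psiM 0 0).
have mg : measurable_fun setT g by apply/measurable_EFinP; exact: measurable_int ig.
have mgh := measurable_comp_line g h mg.
apply: (@le_lt_trans _ _ (\int[leb1]_(t in I01) (M%:E * \int[mu]_x `|(g (x + t *: h))%:E|))%E).
  rewrite -(tonelli_rV01 (fun x t => `|(g (x + t *: h) * psi x t)%:E|%E))//; last first.
    by apply/measurable_EFinP; apply: measurableT_comp => //; exact: measurable_funM.
  rewrite [leRHS](_ : _ = \int[leb1]_(t in I01) (\int[mu]_x (M%:E * `|(g (x + t *: h))%:E|)))%E; last first.
    apply: eq_integral => t _; rewrite ge0_integralZl//.
    apply: measurableT_comp => //; apply/measurable_EFinP.
    exact: measurableT_comp mg (measurable_shift _).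
  rewrite -(tonelli_rV01 (fun x t => (M%:E * `|(g (x + t *: h))%:E|)%E)); last 2 first.
  - apply: measurable_funeM; apply: measurableT_comp => //.
    exact/measurable_EFinP.
  - by move=> x t; rewrite mule_ge0.
  have m1 : measurable_fun setT (fun z : 'rV[R]_n * measurableTypeR R => `|(g (z.1 + z.2 *: h) * psi z.1 z.2)%:E|%E).
    by apply/measurable_EFinP; apply: measurableT_comp => //; exact: measurable_funM.
  have m2 : measurable_fun setT (fun z : 'rV[R]_n * measurableTypeR R => (M%:E * `|(g (z.1 + z.2 *: h))%:E|)%E).
    by apply: measurable_funeM; apply: measurableT_comp => //; exact/measurable_EFinP.
  apply: ge0_le_integral => //.
  - by move=> x _; apply: integral_ge0.
  - exact: (measurable_integral01 (fun x t => `|(g (x + t *: h) * psi x t)%:E|%E)).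
  - exact: (measurable_integral01 (fun x t => (M%:E * `|(g (x + t *: h))%:E|)%E)).
  move=> x _; apply: ge0_le_integral => //.
  - apply: measurable_funTS.
    exact: (measurableT_comp m1 (measurable_pair1 x)).
  - apply: measurable_funTS.
    exact: (measurableT_comp m2 (measurable_pair1 x)).
  - by move=> t _; rewrite /= lee_fin normrM mulrC ler_wpM2r.
have foo := integral_line_fin g h ig.
rewrite ge0_integralZl//; last 2 first.
- rewrite (_ : (fun _ => _) = cst (\int[mu]_x `|(g x)%:E|)%E)//.
  apply/funext => t; rewrite (ge0_integral_shift _ (fun x => `|(g x)%:E|%E))//.
  by apply: measurableT_comp => //; exact/measurable_EFinP.
- by move=> t _; exact: integral_ge0.
by rewrite lte_mul_pinfty.
Qed.

(* Testing the difference [v (x + h) - v x] against [phi] moves the difference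
   onto [phi], where it is the integral of the directional derivative. *)
Lemma integral_diff_test v g phi h :
  mu.-integrable setT (EFin \o v) -> mu.-integrable setT (EFin \o g) ->
  test_function setT phi ->
  (forall t, (0 <= t <= 1)%R ->
    \int[mu]_x (v x * dir_partial h phi (x - t *: h)%R)%:E =
    - \int[mu]_x (g x * phi (x - t *: h)%R)%:E)%E ->
  (\int[mu]_x ((v (x + h)%R - v x) * phi x)%:E =
   \int[mu]_x \int[leb1]_(t in I01) (g (x + t *: h) * phi x)%:E)%E.
Proof.
move=> iv ig tphi weak.
have [M M0 hM] := test_function_bounded _ _ tphi.
have [N N0 hN] := test_function_bounded _ _ (test_function_dir_partial setT h phi tphi).
have mphi := test_function_measurable _ _ tphi.
have mdphi := test_function_measurable _ _ (test_function_dir_partial setT h phi tphi).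
have [sphi _ _] := tphi.
have mv : measurable_fun setT v by apply/measurable_EFinP; exact: measurable_int iv.
have mg : measurable_fun setT g by apply/measurable_EFinP; exact: measurable_int ig.
have ivh := integrable_shift h _ iv.
have ivphi := integrable_mul_bounded v phi M iv mphi hM.
have ivhphi := integrable_mul_bounded (fun x => v (x + h)) phi M ivh mphi hM.
have mphih : measurable_fun setT (fun x => phi (x - h)).
  exact: measurableT_comp mphi (measurable_shift _).
have ivphih := integrable_mul_bounded v (fun x => phi (x - h)) M iv mphih (fun x => hM (x - h)).
transitivity (\int[mu]_x (v x * (phi (x - h) - phi x))%:E)%E.
  transitivity (\int[mu]_x (v (x + h) * phi x)%:E - \int[mu]_x (v x * phi x)%:E)%E.
    by rewrite -integralB//; apply: eq_integral => x _; rewrite mulrBl.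
  rewrite -[X in (X - _ = _)%E](integral_shift (- h)).
    rewrite -integralB//.
      by apply: eq_integral => x _; rewrite subrK mulrBr.
    by apply: eq_integrable ivphih => // x _; rewrite subrK.
  exact: measurable_int ivhphi.
(* Once the translation has moved from [v] to [phi], the difference [phi (x - h) - phi x] is the
   integral of the derivative along [- h]. Fubini then leaves, for each [t], a test of [v] against a
   translate of [dir_partial h phi]. *)
transitivity (\int[mu]_x \int[leb1]_(t in I01) (v x * dir_partial (- h) phi (x + t *: - h))%:E)%E.
  apply: eq_integral => x _.
  rewrite EFinM -smooth_FTC// -integralZl//.
  apply: measurable_bounded_integrable => //.
  - by rewrite /= lebesgue_measure_itv/= lte_fin ltr01 sube0 ltry.
  - apply: measurable_funTS; apply: continuous_measurable_fun.
    by apply: continuous_line; apply: smooth_continuous; exact: smooth_dir_partial.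
  - have [N' N'0 hN'] := test_function_bounded _ _ (test_function_dir_partial setT (- h) phi tphi).
    exists N'; split; first exact: ger0_real.
    by move=> z /ltW N'z t _; exact: le_trans (hN' _) N'z.
have dN x t : dir_partial (- h) phi (x + t *: - h) = - dir_partial h phi (x - t *: h).
  rewrite scalerN /dir_partial -sumrN; apply: eq_bigr => i _.
  by rewrite mxE mulNr.
have mline (psi : 'rV[R]_n -> R) : measurable_fun setT psi ->
    measurable_fun setT (fun z : 'rV[R]_n * measurableTypeR R => psi (z.1 - z.2 *: h)).
  move=> mpsi; rewrite (_ : (fun _ => _) = fun z : 'rV[R]_n * measurableTypeR R => psi (z.1 + z.2 *: - h)).
    exact: measurable_comp_line.
  by apply/funext => z; rewrite scalerN.
rewrite fubini_rV01; last 2 first.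
- apply/measurable_EFinP; apply: measurable_funM; first exact: measurableT_comp mv measurable_fst.
  rewrite (_ : (fun _ => _) = fun z : 'rV[R]_n * measurableTypeR R => - dir_partial h phi (z.1 - z.2 *: h)).
    by apply: measurableT_comp => //; exact: mline.
  by apply/funext => z; rewrite dN.
- rewrite [ltLHS](_ : _ = \int[leb1]_(t in I01) \int[mu]_x `|(v (x + t *: 0) * dir_partial h phi (x - t *: h)%R)%:E|)%E.
    apply: (integral_line_mul_fin v (fun x t => dir_partial h phi (x - t *: h)) 0 N) => //.
    exact: mline.
  apply: eq_integral => t _; apply: eq_integral => x _.
  by rewrite dN scaler0 addr0 mulrN EFinN abseN.
rewrite fubini_rV01; last 2 first.
- apply/measurable_EFinP; apply: measurable_funM; first exact: measurable_comp_line.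
  exact: measurableT_comp mphi measurable_fst.
- apply: (integral_line_mul_fin g (fun x t => phi x) h M) => //.
  exact: measurableT_comp mphi measurable_fst.
apply: eq_integral => t; rewrite inE/= in_itv/= => t01.
transitivity (\int[mu]_x (g x * phi (x - t *: h)%R)%:E)%E.
  have id : mu.-integrable setT (fun x => (v x * dir_partial h phi (x - t *: h))%:E).
    apply: (integrable_mul_bounded v (fun x => dir_partial h phi (x - t *: h)) N iv) => //.
    exact: measurableT_comp mdphi (measurable_shift _).
  rewrite -[RHS]oppeK -weak// -integralN.
    by apply: eq_integral => x _; rewrite dN mulrN EFinN.
  exact: integrable_add_def id.
rewrite -(integral_shift (t *: h)).
  by apply: eq_integral => x _; rewrite addrK.
apply/measurable_EFinP; apply: measurable_funM => //.
exact: measurableT_comp mphi (measurable_shift _).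
Qed.

End weak_line.

Section weak_derivative_on_lines.
Context {R : realType} {n : nat}.
Local Notation mu := (lebesgue_rV R n).
Local Notation leb1 := (@lebesgue_measure R).
Local Notation I01 := (`[0, 1]%classic : set R).
Implicit Types (D K : set 'rV[R]_n) (u v g G phi : 'rV[R]_n -> R) (h x : 'rV[R]_n).

Lemma integrable_restrict_compact D u K : measurable D ->
  locally_integrable_rV D u -> compact K -> K `<=` D ->
  mu.-integrable setT (EFin \o (u \_ K)).
Proof.
move=> mD lu cK KD.
have iK := locally_integrable_integrable D u K mD lu cK KD.
rewrite (_ : EFin \o _ = (EFin \o u) \_ K).
  by apply/(integrable_mkcond _ (compact_measurable_rV _ cK)).
by apply/funext => x; rewrite /= !patchE; case: ifPn.
Qed.

Lemma integrable_line_norm g h : mu.-integrable setT (EFin \o g) ->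
  mu.-integrable setT (fun x => \int[leb1]_(t in I01) `|(g (x + t *: h))%:E|)%E.
Proof.
move=> ig; have mg : measurable_fun setT g by apply/measurable_EFinP; exact: measurable_int ig.
have mgh := measurable_comp_line g h mg.
have mgh' : measurable_fun setT (fun z : 'rV[R]_n * measurableTypeR R => `|(g (z.1 + z.2 *: h))%:E|%E).
  by apply/measurable_EFinP; exact: measurableT_comp.
apply/integrableP; split.
  exact: (measurable_integral01 (fun x t => `|(g (x + t *: h))%:E|%E)).
under eq_integral do rewrite gee0_abs ?integral_ge0//.
rewrite (tonelli_rV01 (fun x t => `|(g (x + t *: h))%:E|%E))//.
exact: integral_line_fin.
Qed.

(** [Rintegral] returns 0 where the inner integral is infinite. As this only decreases absolute
    values, the bound by the integral of [|g|] along the segment holds at every [x]. *)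
Lemma integrable_line_Rintegral g h : mu.-integrable setT (EFin \o g) ->
  mu.-integrable setT (fun x => (\int[leb1]_(t in I01) g (x + t *: h))%:E).
Proof.
move=> ig; have mg : measurable_fun setT g by apply/measurable_EFinP; exact: measurable_int ig.
have mgh := measurable_comp_line g h mg.
have mgh' : measurable_fun setT (fun z : 'rV[R]_n * measurableTypeR R => (g (z.1 + z.2 *: h))%:E).
  exact/measurable_EFinP.
apply: (le_integrable measurableT _ _ (integrable_line_norm g h ig)).
  apply/measurable_EFinP; rewrite /Rintegral.
  apply: (measurableT_comp (fine_measurable measurableT)).
  exact: (measurable_integral01 (fun x t => (g (x + t *: h))%:E)).
move=> x _; rewrite [leRHS]gee0_abs ?integral_ge0//.
apply: (@le_trans _ _ `|\int[leb1]_(t in I01) (g (x + t *: h))%:E|%E).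
  have fine_le (a : \bar R) : (`|(fine a)%:E| <= `|a|)%E.
    by case: a => [r| |]//=; rewrite normr0 leey.
  exact: fine_le.
apply: le_abse_integral => //; apply: measurable_funTS.
exact: (measurableT_comp mgh' (measurable_pair1 x)).
Qed.

Lemma ae_line_integrable D G h : open D -> locally_integrable_rV D G ->
  {ae mu, forall x, seg D h x ->
    leb1.-integrable I01 (fun t => (G (x + t *: h))%:E)}.
Proof.
move=> oD lG; apply: ae_open_box; first exact: open_seg.
move=> a b abU; set K := cbox a b in abU.
have cK' : compact (segs K h) by apply: compact_segs; exact: compact_cbox.
have K'D := segs_sub K D h abU.
have mD := open_measurable_rV _ oD.
have ig := integrable_restrict_compact D G _ mD lG cK' K'D.
have mg : measurable_fun setT (G \_ (segs K h)) by apply/measurable_EFinP; exact: measurable_int ig.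
have := ae_integrable01 (fun x t => (G \_ (segs K h)) (x + t *: h))
  (measurable_comp_line _ h mg) (integral_line_fin _ h ig).
apply: filterS => x ix xab; apply: eq_integrable ix => // t; rewrite inE => t01.
rewrite patchE mem_set//; exists (x, t) => //; split => //=.
exact: sub_box_cbox.
Qed.

Section diff_quotient.
Variables (D : set 'rV[R]_n) (u G : 'rV[R]_n -> R) (h : 'rV[R]_n).
Hypotheses (oD : open D) (lu : locally_integrable_rV D u)
  (lG : locally_integrable_rV D G).
Hypothesis weak : forall phi, test_function D phi ->
  \int[mu]_(x in D) (u x * dir_partial h phi x) = - \int[mu]_(x in D) (G x * phi x).

(** Formed with extensions by zero off [D], this is measurable on the whole space; over a compact
    subset of [seg D h] the extensions may be exchanged for cut-offs to the swept set, which are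
    integrable. *)
Let w x := (u \_ D) (x + h) - (u \_ D) x -
  \int[leb1]_(t in I01) (G \_ D) (x + t *: h).

Let mD : measurable D. Proof. exact: open_measurable_rV. Qed.

Let wE K x : compact K -> K `<=` seg D h -> K x ->
  w x = (u \_ (segs K h)) (x + h) - (u \_ (segs K h)) x -
    \int[leb1]_(t in I01) (G \_ (segs K h)) (x + t *: h).
Proof.
move=> cK KU Kx; rewrite /w.
have e (f : 'rV[R]_n -> R) t : 0 <= t <= 1 ->
    (f \_ D) (x + t *: h) = (f \_ (segs K h)) (x + t *: h).
  move=> t01; have H : segs K h (x + t *: h).
    by exists (x, t) => //; split => //=; rewrite in_itv.
  by rewrite !patchE !mem_set//; apply: segs_sub KU _ H.
have e1 (f : 'rV[R]_n -> R) : (f \_ D) (x + h) = (f \_ (segs K h)) (x + h).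
  by have := e f 1; rewrite scale1r; apply; rewrite ler01 lexx.
have e0 (f : 'rV[R]_n -> R) : (f \_ D) x = (f \_ (segs K h)) x.
  by have := e f 0; rewrite scale0r addr0; apply; rewrite ler01 lexx.
rewrite e1 e0; congr (_ - _); rewrite /Rintegral; congr fine; apply: eq_integral => t.
by rewrite inE/= in_itv/= => t01; rewrite e.
Qed.

Let iW K : compact K -> K `<=` seg D h ->
  mu.-integrable setT (fun x => ((u \_ (segs K h)) (x + h) - (u \_ (segs K h)) x -
    \int[leb1]_(t in I01) (G \_ (segs K h)) (x + t *: h))%:E).
Proof.
move=> cK KU; have cK' := compact_segs K h cK; have K'D := segs_sub K D h KU.
have iv := integrable_restrict_compact D u _ mD lu cK' K'D.
have ig := integrable_restrict_compact D G _ mD lG cK' K'D.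
have ivh := integrable_shift h _ iv.
have iC := integrable_line_Rintegral _ h ig.
exact: (integrableB measurableT (integrableB measurableT ivh iv) iC).
Qed.

Let lw : locally_integrable_rV (seg D h) w.
Proof.
split.
  apply: measurable_funTS; apply: measurable_funB.
    have mu' : measurable_fun setT (u \_ D).
      by apply/(measurable_restrictT _ mD); case: lu.
    by apply: measurable_funB => //; exact: measurableT_comp mu' (measurable_shift _).
  have mG : measurable_fun setT (G \_ D).
    by apply/(measurable_restrictT _ mD); case: lG.
  rewrite /Rintegral.
  apply: (measurableT_comp (fine_measurable measurableT)).
  apply: (measurable_integral01 (fun x t => ((G \_ D) (x + t *: h))%:E)).
  by apply/measurable_EFinP; exact: measurable_comp_line.
move=> K KU cK.
have mK := compact_measurable_rV _ cK.
have := integrableS measurableT mK (@subsetT _ _) (iW K cK KU).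
move=> /integrableP[_]; apply: le_lt_trans; rewrite le_eqVlt; apply/orP; left.
apply/eqP; apply: eq_integral => x; rewrite inE => Kx.
by rewrite (wE K).
Qed.

(* The fundamental lemma applied to the difference of the two sides. *)
Lemma weak_line : {ae mu, forall x, seg D h x ->
  u (x + h) - u x = \int[leb1]_(t in I01) G (x + t *: h)}.
Proof.
have : {ae mu, forall x, seg D h x -> w x = 0}.
  apply: fundamental_lemma lw _; first exact: open_seg.
  move=> phi tphi; have [sphi cphi phiU] := tphi.
  set K := closure _ in cphi phiU.
  have cK' := compact_segs K h cphi; have K'D := segs_sub K D h phiU.
  have iv := integrable_restrict_compact D u _ mD lu cK' K'D.
  have ig := integrable_restrict_compact D G _ mD lG cK' K'D.
  have tphiT : test_function setT phi by split.
  have notK x : ~ K x -> phi x = 0 by exact: (test_function_support setT).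
  have [M M0 hM] := test_function_bounded _ _ tphi.
  have mphi := test_function_measurable _ _ tphi.
  set v := u \_ (segs K h) in iv; set g := G \_ (segs K h) in ig.
  have mg : measurable_fun setT g by apply/measurable_EFinP; exact: measurable_int ig.
  have ivh := integrable_shift h _ iv.
  have iC := integrable_line_Rintegral _ h ig.
  have restr (f psi : 'rV[R]_n -> R) (t : R) : 0 <= t <= 1 -> (forall x, ~ K x -> psi x = 0) ->
      (\int[mu]_x ((f \_ (segs K h)) x * psi (x - t *: h)%R)%:E =
       \int[mu]_(x in D) (f x * psi (x - t *: h)%R)%:E)%E.
    move=> t01 psi0; rewrite [RHS]integral_mkcond; apply: eq_integral => x _.
    rewrite !patchE; case: ifPn => xK; last first.
      rewrite psi0 ?mulr0; first by case: ifPn.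
      move=> Kx; move/negP : xK; apply; rewrite inE; exists (x - t *: h, t).
        by split => //=; rewrite in_itv.
      by rewrite /= subrK.
    by rewrite mem_set//; apply: K'D; exact: set_mem xK.
  have key : (\int[mu]_x ((v (x + h)%R - v x) * phi x)%:E =
     \int[mu]_x \int[leb1]_(t in I01) (g (x + t *: h)%R * phi x)%:E)%E.
    apply: integral_diff_test => // t t01.
    have tt := test_function_translate D h phi t t01 tphi.
    rewrite restr//; last first.
      by move=> x; exact: dir_partial_support.
    rewrite restr//.
    have := weak _ tt; rewrite /Rintegral.
    have i1 := integrable_mul_test D G _ mD lG tt.
    have i2 := integrable_mul_test D u _ mD lu (test_function_dir_partial D h _ tt).
    move=> eq_fine.
    rewrite -[X in (- X)%E]fineK; last exact: integrable_fin_num i1.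
    rewrite -EFinN -eq_fine fineK; last exact: integrable_fin_num i2.
    by apply: eq_integral => x _; rewrite dir_partial_shift.
  rewrite /Rintegral.
  suff -> : (\int[mu]_(x in seg D h) (w x * phi x)%:E = 0)%E by [].
  pose C x := \int[leb1]_(t in I01) g (x + t *: h).
  transitivity (\int[mu]_x ((v (x + h)%R - v x - C x) * phi x)%:E)%E.
    rewrite integral_mkcond; apply: eq_integral => x _; rewrite patchE.
    have [Kx|nKx] := pselect (K x); last by rewrite notK// !mulr0; case: ifPn.
    by rewrite mem_set ?(wE K)//; exact: phiU.
  have ivd : mu.-integrable setT (EFin \o (fun x => v (x + h) - v x)).
    exact: (integrableB measurableT ivh iv).
  transitivity (\int[mu]_x ((v (x + h)%R - v x) * phi x)%:E - \int[mu]_x (C x * phi x)%:E)%E.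
    rewrite -integralB//.
    - by apply: eq_integral => x _; rewrite mulrBl.
    - exact: integrable_mul_bounded ivd mphi hM.
    - exact: integrable_mul_bounded iC mphi hM.
  have iCphi := integrable_mul_bounded _ phi M iC mphi hM.
  (* [C x * phi x] and the inner integral in [key] coincide wherever [g] is integrable along the
     segment from [x], that is, almost everywhere. *)
  rewrite key (_ : \int[mu]_x \int[leb1]_(t in I01) _ = \int[mu]_x (C x * phi x)%:E)%E.
    by rewrite subee//; exact: integrable_fin_num iCphi.
  apply: ae_eq_integral => //.
  - apply: (measurable_integral01 (fun x t => (g (x + t *: h) * phi x)%:E)).
    apply/measurable_EFinP; apply: measurable_funM; first exact: measurable_comp_line.
    exact: measurableT_comp mphi measurable_fst.
  - exact: measurable_int iCphi.
  have := ae_integrable01 (fun x t => g (x + t *: h)) (measurable_comp_line _ h mg) (integral_line_fin _ h ig).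
  apply: filterS => x ix _; rewrite /C /Rintegral EFinM fineK; last exact: integrable_fin_num ix.
  by rewrite muleC -integralZl//; apply: eq_integral => t _; rewrite mulrC EFinM.
apply: filterS => x /= wx Ux; have := wx Ux.
have Dxt t : 0 <= t <= 1 -> x + t *: h \in D by move=> t01; rewrite inE; exact: Ux.
have Dx : x \in D by have := Dxt 0; rewrite scale0r addr0; apply; rewrite lexx ler01.
have Dxh : x + h \in D by have := Dxt 1; rewrite scale1r; apply; rewrite lexx ler01.
rewrite /w !patchE Dx Dxh => /subr0_eq ->.
rewrite /Rintegral; congr fine; apply: eq_integral => t.
by rewrite inE/= in_itv/= => t01; rewrite patchE Dxt.
Qed.

End diff_quotient.

End weak_derivative_on_lines.

(** * Poincare and Sobolev inequalities on cubes *)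

Section real_power_inequalities.
Context {R : realType}.
Implicit Types a b r s t x y : R.

Lemma powR_add_le r x y : 0 <= r -> 0 <= x -> 0 <= y ->
  (x + y) `^ r <= 2 `^ r * (x `^ r + y `^ r).
Proof.
move=> r0; wlog xy : x y / x <= y => [h x0 y0|x0 y0].
  have [xy|/ltW yx] := leP x y; first exact: h.
  by rewrite addrC [X in _ * X]addrC; exact: h.
apply: (@le_trans _ _ ((2 * y) `^ r)).
  by rewrite ge0_ler_powR ?nnegrE ?addr_ge0 ?mulr_ge0// mulr_natl mulr2n lerD2r.
by rewrite powRM// ler_wpM2l ?powR_ge0// lerDr powR_ge0.
Qed.

(** Either [y <= e x] or [x < y / e], and the dominant term absorbs the other. Unlike in
    [powR_add_le], the factor in front of [x] may be as close to 1 as desired; without this the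
    dyadic iteration would lose its contraction. *)
Lemma powR_add_le_eps r e x y : 0 < e -> 0 <= r -> 0 <= x -> 0 <= y ->
  (x + y) `^ r <= (1 + e) `^ r * x `^ r + (1 + e^-1) `^ r * y `^ r.
Proof.
move=> e0 r0 x0 y0; have [yx|xy] := leP y (e * x).
  apply: (@le_trans _ _ ((1 + e) `^ r * x `^ r)); last first.
    by rewrite lerDl mulr_ge0 ?powR_ge0.
  have e1 : 0 <= 1 + e by rewrite addr_ge0// ltW.
  rewrite -powRM// ge0_ler_powR ?nnegrE ?addr_ge0 ?mulr_ge0//.
  by rewrite mulrDl mul1r lerD2l.
apply: (@le_trans _ _ ((1 + e^-1) `^ r * y `^ r)); last first.
  by rewrite lerDr mulr_ge0 ?powR_ge0.
have e1 : 0 <= 1 + e^-1 by rewrite addr_ge0// invr_ge0 ltW.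
rewrite -powRM// ge0_ler_powR ?nnegrE ?addr_ge0 ?mulr_ge0//.
by rewrite mulrDl mul1r addrC lerD2l mulrC ler_pdivlMr// mulrC ltW.
Qed.

(** Below the threshold [s] the power [t ^ a] is at most [s ^ a]; above it, [t ^ (a - b)] is at most
    [s ^ (a - b)]. With [s] free, this plays the role of Hoelder's inequality. *)
Lemma powR_interp a b s t : 0 <= a -> a <= b -> 0 < s -> 0 <= t ->
  t `^ a <= s `^ (a - b) * t `^ b + s `^ a.
Proof.
move=> a0 ab s0 t0; have [ts|st] := leP t s.
  apply: (@le_trans _ _ (s `^ a)); last by rewrite lerDr mulr_ge0 ?powR_ge0.
  by rewrite ge0_ler_powR ?nnegrE// ltW.
apply: (@le_trans _ _ (s `^ (a - b) * t `^ b)); last by rewrite lerDl powR_ge0.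
have tp : 0 < t by apply: lt_trans st.
rewrite -(opprB b a) powRN mulrC ler_pdivlMr ?powR_gt0//.
have -> : t `^ b = t `^ (b - a) * t `^ a by rewrite -powRD ?subrK// (gt_eqF tp) implybT.
rewrite mulrC ler_wpM2r ?powR_ge0//.
by rewrite ge0_ler_powR ?nnegrE ?subr_ge0// ltW.
Qed.

(* The infimum over [s] of the right-hand side is attained, up to a constant,
   at [s = x `^ b^-1]. *)
Lemma le_powR_of_interp a b m x A : 0 < a -> a <= b -> 0 <= m -> 0 <= x ->
  (forall s, 0 < s -> A <= s `^ (a - b) * x + s `^ a * m) ->
  A <= (1 + m) * x `^ (a / b).
Proof.
move=> a0 ab m0; have b0 : 0 < b by exact: lt_le_trans ab.
rewrite le_eqVlt => /orP[/eqP <-|x0] h; last first.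
  have := h (x `^ b^-1) (powR_gt0 _ x0).
  rewrite -!powRrM (mulrC a b^-1).
  rewrite -[X in _ * X + _](powRr1 (ltW x0)) -powRD; last by rewrite (gt_eqF x0) implybT.
  rewrite (_ : b^-1 * (a - b) + 1 = b^-1 * a); last first.
    by rewrite mulrBr mulVf ?gt_eqF// subrK.
  by rewrite mulrDl mul1r (mulrC m).
rewrite powR0 ?mulr0; last by rewrite gt_eqF// divr_gt0.
apply/ler_addgt0Pl => e e0; rewrite addr0.
have m1 : 0 < m + 1 by rewrite ltr_wpDl.
have s0 : 0 < (e / (m + 1)) `^ a^-1 by rewrite powR_gt0// divr_gt0.
apply: le_trans (h _ s0) _; rewrite mulr0 add0r -powRrM mulVf ?gt_eqF//.
rewrite powRr1; last by rewrite divr_ge0 ?ltW.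
by rewrite mulrAC ler_pdivrMr// ler_wpM2l ?(ltW e0)// lerDl.
Qed.

Lemma powR_superadd s x y : 1 <= s -> 0 <= x -> 0 <= y ->
  x `^ s + y `^ s <= (x + y) `^ s.
Proof.
move=> s1 x0 y0; have s0 : 0 < s by apply: lt_le_trans s1.
have [xy0|xy] := eqVneq (x + y) 0.
  move/eqP : xy0; rewrite paddr_eq0// => /andP[/eqP-> /eqP->].
  by rewrite addr0 powR0 ?addr0// gt_eqF.
have xyp : 0 < x + y by rewrite lt_def xy addr_ge0.
have h z : 0 <= z -> z <= x + y -> z `^ s <= z * (x + y) `^ (s - 1).
  move=> z0 zxy; rewrite -mulr_powRB1// ler_wpM2l// ge0_ler_powR ?nnegrE ?subr_ge0//.
  exact: ltW.
apply: le_trans (lerD (h x x0 _) (h y y0 _)) _; rewrite ?lerDl ?lerDr//.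
by rewrite -mulrDl mulr_powRB1// ltW.
Qed.

Lemma powR_superadd_sum (I : Type) (l : seq I) (F : I -> R) s : 1 <= s ->
  (forall i, 0 <= F i) ->
  \sum_(i <- l) F i `^ s <= (\sum_(i <- l) F i) `^ s.
Proof.
move=> s1 F0; elim: l => [|i l IH].
  by rewrite !big_nil powR0// gt_eqF// (lt_le_trans _ s1).
rewrite !big_cons; apply: le_trans (powR_superadd s _ _ s1 (F0 i) (sumr_ge0 _ _)) => //.
by rewrite lerD2l.
Qed.

End real_power_inequalities.

(** * Integrals of powers *)

Section power_integrals.
Context {d} {T : measurableType d} {R : realType} (nu : {measure set T -> \bar R}).
Implicit Types (E : set T) (w : T -> R) (a b r s : R).

Definition pint r E w : \bar R := (\int[nu]_(x in E) (`|w x| `^ r)%:E)%E.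

Lemma pint_ge0 r E w : (0 <= pint r E w)%E.
Proof. by apply: integral_ge0 => x _; rewrite lee_fin powR_ge0. Qed.

Lemma measurable_powR_norm r E w : measurable_fun E w ->
  measurable_fun E (fun x => (`|w x| `^ r)%:E).
Proof.
move=> mw; apply/measurable_EFinP.
by apply: (measurableT_comp (measurable_powR r)); exact: measurableT_comp.
Qed.

Lemma pint_interp a b s E w : measurable E -> measurable_fun E w ->
  0 <= a -> a <= b -> 0 < s ->
  (pint a E w <= (s `^ (a - b))%:E * pint b E w + (s `^ a)%:E * nu E)%E.
Proof.
move=> mE mw a0 ab s0.
apply: (@le_trans _ _ (\int[nu]_(x in E) ((s `^ (a - b))%:E * (`|w x| `^ b)%:E + (s `^ a)%:E)))%E.
  apply: ge0_le_integral => //.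
  - exact: measurable_powR_norm.
  - apply: emeasurable_funD => //; apply: measurable_funeM.
    exact: measurable_powR_norm.
  - by move=> x _; rewrite lee_fin powR_interp.
rewrite ge0_integralD//.
- rewrite ge0_integralZl ?lee_fin ?powR_ge0//; last exact: measurable_powR_norm.
  by rewrite integral_cst.
- by move=> x _; rewrite mule_ge0 ?lee_fin ?powR_ge0.
- by apply: measurable_funeM; exact: measurable_powR_norm.
- by move=> x _; rewrite lee_fin powR_ge0.
Qed.

(** Hoelder's inequality up to a constant: [pint_interp] holds for every threshold [s], and
    [le_powR_of_interp] picks the best one. *)
Lemma pint_le_exponent a b E w m x : measurable E -> measurable_fun E w ->
  0 < a -> a <= b -> nu E = m%:E -> pint b E w = x%:E ->
  (pint a E w <= ((1 + m) * x `^ (a / b))%:E)%E.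
Proof.
move=> mE mw a0 ab nuE px.
have x0 : 0 <= x by rewrite -lee_fin -px pint_ge0.
have m0 : 0 <= m by rewrite -lee_fin -nuE measure_ge0.
have h s (s0 : 0 < s) := pint_interp a b s E w mE mw (ltW a0) ab s0.
have fin : pint a E w \is a fin_num.
  rewrite ge0_fin_numE ?pint_ge0//; apply: le_lt_trans (h 1 ltr01) _.
  by rewrite px nuE -!EFinM -EFinD ltry.
rewrite -(fineK fin) lee_fin; apply: le_powR_of_interp => // s s0.
by rewrite -lee_fin fineK// EFinD !EFinM -px -nuE; exact: h.
Qed.

Lemma pint_add r E (v w : T -> R) : measurable E -> measurable_fun E v ->
  measurable_fun E w -> 0 <= r ->
  (pint r E (v \+ w)%R <= (2 `^ r)%:E * (pint r E v + pint r E w))%E.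
Proof.
move=> mE mv mw r0; rewrite /pint -ge0_integralD//.
all: try exact: measurable_powR_norm.
rewrite -ge0_integralZl//; last 2 first.
- by apply: emeasurable_funD; exact: measurable_powR_norm.
- by move=> x _; rewrite -EFinD lee_fin addr_ge0 ?powR_ge0.
apply: ge0_le_integral => //.
- by apply: measurable_powR_norm; exact: measurable_funD.
- by apply: measurable_funeM; apply: emeasurable_funD; exact: measurable_powR_norm.
- move=> x _; rewrite -EFinD -EFinM lee_fin.
  apply: le_trans (powR_add_le r _ _ r0 (normr_ge0 _) (normr_ge0 _)).
  by rewrite ge0_ler_powR ?nnegrE ?addr_ge0// ler_normD.
Qed.

Lemma pint_cst r E (c : R) : measurable E ->
  pint r E (cst c) = ((`|c| `^ r)%:E * nu E)%E.
Proof. by move=> mE; rewrite /pint -integral_cst. Qed.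

Lemma pint_subset r E F w : measurable E -> measurable F -> E `<=` F ->
  measurable_fun F w -> (pint r E w <= pint r F w)%E.
Proof.
move=> mE mF EF mw; apply: ge0_subset_integral => //.
- exact: measurable_powR_norm.
Qed.

Lemma pint_le r E (v w : T -> R) : measurable E -> measurable_fun E v ->
  measurable_fun E w -> 0 <= r -> (forall x, E x -> `|v x| <= `|w x|) ->
  (pint r E v <= pint r E w)%E.
Proof.
move=> mE mv mw r0 vw; apply: ge0_le_integral => //.
- exact: measurable_powR_norm.
- exact: measurable_powR_norm.
- by move=> x Ex; rewrite lee_fin ge0_ler_powR ?nnegrE ?vw.
Qed.

(** If every point exceeded twice the average, the integral would be at least twice itself, hence
    zero, and a function positive at each point of [E] would vanish almost everywhere. Thanks to the
    factor 2, weak inequalities under the integral suffice. *)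
Lemma le_average (f : T -> \bar R) E m : measurable E -> nu E = m%:E -> 0 < m ->
  measurable_fun E f -> (forall x, E x -> 0 <= f x)%E ->
  exists2 x, E x & (f x * m%:E <= 2%:E * \int[nu]_(x in E) f x)%E.
Proof.
move=> mE nuE m0 mf f0; apply/not_exists2P => h.
have {}h x : E x -> (2%:E * \int[nu]_(x in E) f x < f x * m%:E)%E.
  by move=> Ex; have [//|/negP] := h x; rewrite -ltNge.
have ge0I : (0 <= \int[nu]_(x in E) f x)%E by exact: integral_ge0.
have [x0 Ex0] : E !=set0.
  by apply/set0P/eqP => E0; move: nuE m0; rewrite E0 measure0 => -[<-]; rewrite ltxx.
have Ifin : (\int[nu]_(x in E) f x)%E \is a fin_num.
  rewrite ge0_fin_numE// ltNge leye_eq; apply/negP => /eqP I_oo.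
  by have := h x0 Ex0; rewrite I_oo gt0_muley ?lte_fin// ltNge leey.
pose c := 2 * fine (\int[nu]_(x in E) f x)%E / m.
have cf x : E x -> (c%:E <= f x)%E.
  move=> Ex; have := h x Ex; rewrite -(fineK Ifin) -EFinM => /ltW.
  rewrite -lee_pdivrMr// -EFinM.
have c0 : 0 <= c by rewrite /c divr_ge0// ?mulr_ge0 ?fine_ge0// ltW.
have : (\int[nu]_(x in E) (cst c%:E) x <= \int[nu]_(x in E) f x)%E.
  apply: ge0_le_integral => //.
rewrite integral_cst// nuE -EFinM /c divfK ?gt_eqF// -[leRHS](fineK Ifin) lee_fin => II.
have I0 : (\int[nu]_(x in E) f x = 0)%E.
  rewrite -(fineK Ifin); congr (_%:E); apply/eqP; rewrite eq_le fine_ge0// andbT.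
  by move: II; rewrite mulr_natl mulr2n gerDl.
have : (\int[nu]_(x in E) `|f x| = 0)%E.
  by rewrite -I0; apply: eq_integral => x; rewrite inE => Ex; rewrite gee0_abs// f0.
move=> /(ae_eq_integral_abs _ mE mf) [N [mN N0 EN]].
have : E `<=` N.
  move=> x Ex; apply: EN => /= /(_ Ex) fx0.
  by have := h x Ex; rewrite I0 fx0 mule0 mul0e ltxx.
move=> subEN; have : (nu E <= nu N)%E by apply: le_measure; rewrite ?inE.
by rewrite N0 nuE lee_fin leNgt m0.
Qed.

End power_integrals.

Section weak_gradient_lines.
Context {R : realType} {n : nat}.
Local Notation mu := (lebesgue_rV R n).
Local Notation leb1 := (@lebesgue_measure R).
Local Notation I01 := (`[0, 1]%classic : set R).
Implicit Types (D Q : set 'rV[R]_n) (u : 'rV[R]_n -> R) (g : 'rV[R]_n -> 'rV[R]_n)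
  (h x : 'rV[R]_n).

Lemma euclidean_norm_ge0 x : 0 <= euclidean_norm x.
Proof. exact: sqrtr_ge0. Qed.

Lemma coord_le_euclidean_norm x i : `|x ord0 i| <= euclidean_norm x.
Proof.
rewrite -sqrtr_sqr /euclidean_norm ler_wsqrtr// (bigD1 i)//= lerDl.
by apply: sumr_ge0 => j _; exact: sqr_ge0.
Qed.

Lemma euclidean_norm_le_sum x : euclidean_norm x <= \sum_(i < n) `|x ord0 i|.
Proof.
have S0 : 0 <= \sum_(i < n) `|x ord0 i| by exact: sumr_ge0.
rewrite -[leRHS]ger0_norm// -sqrtr_sqr ler_wsqrtr//.
elim: (index_enum _) => [|i r IH]; first by rewrite !big_nil expr0n.
rewrite !big_cons sqrrD -addrA real_normK ?num_real// lerD2l.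
apply: le_trans IH _; rewrite lerDr mulrn_wge0// mulr_ge0// sumr_ge0//.
Qed.

Lemma measurable_euclidean_norm D g :
  (forall i, measurable_fun D (fun x => g x ord0 i)) ->
  measurable_fun D (fun x => euclidean_norm (g x)).
Proof.
move=> mg; rewrite /euclidean_norm.
apply: (measurableT_comp (continuous_measurable_fun (@sqrt_continuous R))).
by apply: measurable_sum => i; exact: measurable_funX.
Qed.

Definition dir_grad h g x : R := \sum_(i < n) h ord0 i * g x ord0 i.

Lemma dir_grad_le h g x l : (forall i, `|h ord0 i| <= l) ->
  `|dir_grad h g x| <= n%:R * l * euclidean_norm (g x).
Proof.
move=> hl; apply: le_trans (ler_norm_sum _ _ _) _.
rewrite -mulrA mulr_natl -[X in _ *+ X]card_ord -sumr_const; apply: ler_sum => i _.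
by rewrite normrM ler_pM ?coord_le_euclidean_norm.
Qed.

Lemma is_weak_gradient_locint D u g i : is_weak_gradient D u g ->
  locally_integrable_rV D (fun x => g x ord0 i).
Proof. by move=> /(_ i)[]. Qed.

Lemma locally_integrable_dir_grad D u g h : measurable D ->
  is_weak_gradient D u g -> locally_integrable_rV D (dir_grad h g).
Proof.
move=> mD wg; split.
  apply: measurable_sum => i; apply: measurable_funM => //.
  by have [[]] := wg i.
move=> K KD cK.
have ig i : mu.-integrable K (EFin \o (fun x => g x ord0 i)).
  by apply: (locally_integrable_integrable D) => //; have [] := wg i.
have mK := compact_measurable_rV _ cK.
have /integrableP[_] : mu.-integrable K (fun x => \sum_(i < n) ((h ord0 i)%:E * (g x ord0 i)%:E)%E)%E.
  by apply: integrable_sum => // i _; exact: (integrableZl mK _ (ig i)).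
by under eq_integral do rewrite sumEFin.
Qed.

Lemma weak_gradient_dir D u g h phi : measurable D ->
  locally_integrable_rV D u -> is_weak_gradient D u g -> test_function D phi ->
  \int[mu]_(x in D) (u x * dir_partial h phi x) =
  - \int[mu]_(x in D) (dir_grad h g x * phi x).
Proof.
move=> mD lu wg tphi.
have i1 i := integrable_mul_test D u _ mD lu (test_function_partial D phi i tphi).
have i2 i := integrable_mul_test D _ _ mD (is_weak_gradient_locint D u g i wg) tphi.
have e i : (\int[mu]_(x in D) (u x * partial i phi x)%:E =
    - \int[mu]_(x in D) (g x ord0 i * phi x)%:E)%E.
  have [_ /(_ _ tphi)] := wg i; rewrite /Rintegral => eq_fine.
  rewrite -[LHS]fineK; last exact: integrable_fin_num (i1 i).
  by rewrite eq_fine EFinN fineK//; exact: integrable_fin_num (i2 i).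
rewrite /Rintegral -fineN; congr fine.
transitivity (\sum_(i < n) ((h ord0 i)%:E * \int[mu]_(x in D) (u x * partial i phi x)%:E))%E.
  transitivity (\int[mu]_(x in D) \sum_(i < n) ((h ord0 i)%:E * (u x * partial i phi x)%:E))%E.
    apply: eq_integral => x _; rewrite sumEFin; congr (_%:E).
    by rewrite /dir_partial mulr_sumr; apply: eq_bigr => i _; rewrite mulrCA.
  rewrite integral_sum//; last by move=> i; exact: (integrableZl mD _ (i1 i)).
  by apply: eq_bigr => i _; rewrite (integralZl mD (i1 i)).
transitivity (- \sum_(i < n) ((h ord0 i)%:E * \int[mu]_(x in D) (g x ord0 i * phi x)%:E))%E.
  rewrite -sumeN; last by move=> i j _ _; rewrite fin_num_adde_defl// fin_numM//; exact: integrable_fin_num (i2 _).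
  by apply: eq_bigr => i _; rewrite e muleN.
congr (- _)%E.
transitivity (\int[mu]_(x in D) \sum_(i < n) ((h ord0 i)%:E * (g x ord0 i * phi x)%:E))%E.
  rewrite integral_sum//; last by move=> i; exact: (integrableZl mD _ (i2 i)).
  by apply: eq_bigr => i _; rewrite (integralZl mD (i2 i)).
apply: eq_integral => x _; rewrite sumEFin; congr (_%:E).
by rewrite /dir_grad mulr_suml; apply: eq_bigr => i _; rewrite mulrA.
Qed.

Lemma weak_gradient_line D u g h : open D ->
  locally_integrable_rV D u -> is_weak_gradient D u g ->
  {ae mu, forall x, seg D h x ->
    leb1.-integrable I01 (fun t => (dir_grad h g (x + t *: h))%:E) /\
    u (x + h) - u x = \int[leb1]_(t in I01) dir_grad h g (x + t *: h)}.
Proof.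
move=> oD lu wg; have mD := open_measurable_rV _ oD.
have lG := locally_integrable_dir_grad D u g h mD wg.
have h1 := ae_line_integrable D _ h oD lG.
have h2 := weak_line D u _ h oD lu lG (fun phi => weak_gradient_dir D u g h phi mD lu wg).
apply: filterS2 h1 h2 => x h1 h2 Dx; split; [exact: h1|exact: h2].
Qed.

End weak_gradient_lines.

Section poincare.
Context {R : realType} {n : nat}.
Local Notation mu := (lebesgue_rV R n).
Local Notation leb1 := (@lebesgue_measure R).
Local Notation I01 := (`[0, 1]%classic : set R).
Implicit Types (D Q : set 'rV[R]_n) (u : 'rV[R]_n -> R) (g : 'rV[R]_n -> 'rV[R]_n)
  (h x a : 'rV[R]_n).

(** Half-open, so that the [2 ^ n] half-size cubes of the dyadic step partition it exactly. *)
Definition cube a (l : R) : set 'rV[R]_n :=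
  [set x | forall i, a ord0 i <= x ord0 i < a ord0 i + l].

Lemma cubeE a l : cube a l = [set x | forall i, `[a ord0 i, a ord0 i + l[%classic (x ord0 i)].
Proof. by apply/seteqP; split => x xa i; have := xa i; rewrite /= in_itv. Qed.

Lemma measurable_cube a l : measurable (cube a l).
Proof.
have -> : cube a l = \big[setI/setT]_(i < n)
    ((fun v : 'rV[R]_n => v ord0 i) @^-1` `[a ord0 i, a ord0 i + l[%classic).
  rewrite -bigcap_seq; apply/seteqP; split => [v /= Av i _|v /= Av i].
    by rewrite /= in_itv/=.
  by have := Av i (mem_index_enum _); rewrite /= in_itv.
apply: bigsetI_measurable => i _.
by rewrite -[X in measurable X]setTI; exact: measurable_coord.
Qed.

Lemma lebesgue_cube a l : 0 < l -> mu (cube a l) = (l ^+ n)%:E.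
Proof.
move=> l0; rewrite cubeE (@lebesgue_rV_box R n (fun i => `[a ord0 i, a ord0 i + l[%classic)).
  rewrite (eq_bigr (fun=> l%:E)); last first.
    by move=> i _; rewrite lebesgue_measure_itv/= lte_fin ltrDl l0 -EFinB addrC addKr.
  by rewrite prodEFin prodr_const card_ord.
by move=> i; exact: measurable_itv.
Qed.

Lemma segment_in_cube a l h x : cube a l x -> cube a l (x + h) ->
  seg (cube a l) h x.
Proof.
move=> xa xha t /andP[t0 t1] i; have /andP[h1 h2] := xa i.
have /andP := xha i; rewrite !mxE => -[h3 h4].
have [hi|hi] := leP 0 (h ord0 i).
  have : t * h ord0 i <= h ord0 i by rewrite ler_piMl.
  have : 0 <= t * h ord0 i by rewrite mulr_ge0.
  by move=> *; apply/andP; split; lra.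
have : h ord0 i <= t * h ord0 i by rewrite ler_niMl// ltW.
have : t * h ord0 i <= 0 by rewrite mulr_ge0_le0// ltW.
by move=> *; apply/andP; split; lra.
Qed.

(* Jensen's inequality, with the lossy constant of [pint_le_exponent]. *)
Lemma Rintegral01_powR (f : R -> R) r : 1 <= r ->
  leb1.-integrable I01 (EFin \o f) ->
  (((`|\int[leb1]_(t in I01) f t|) `^ r)%:E <= (2 `^ r)%:E * \int[leb1]_(t in I01) (`|f t| `^ r)%:E)%E.
Proof.
move=> r1 intf; have r0 : 0 < r by apply: lt_le_trans r1.
have mf : measurable_fun I01 f by apply/measurable_EFinP; exact: measurable_int intf.
have [Ioo|Ifin] := eqVneq (pint leb1 r I01 f) +oo%E.
  by rewrite -/(pint _ _ _ _) Ioo gt0_muley ?lte_fin ?powR_gt0// leey.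
have If : pint leb1 r I01 f \is a fin_num by rewrite ge0_fin_numE ?pint_ge0// ltey.
have m1 : leb1 I01 = 1%:E by rewrite /= lebesgue_measure_itv/= lte_fin ltr01 sube0.
have := pint_le_exponent leb1 1 r I01 f 1 (fine (pint leb1 r I01 f)) _ mf ltr01 r1 m1.
rewrite fineK// => /(_ _ erefl) h.
have fle : (`|\int[leb1]_(t in I01) f t|%:E <= pint leb1 1 I01 f)%E.
  rewrite /Rintegral.
  have -> : pint leb1 1 I01 f = (\int[leb1]_(t in I01) `|(f t)%:E|)%E.
    by apply: eq_integral => t _; rewrite /= powRr1.
  have fine_le (b : \bar R) : (`|fine b|%:E <= `|b|)%E.
    by case: b => [b||] /=; rewrite ?normr0 ?leey.
  apply: le_trans (fine_le _) _; apply: le_abse_integral => //.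
  exact/measurable_EFinP.
have {}h := le_trans fle (h _).
rewrite -/(pint _ _ _ _) -(fineK If) -EFinM lee_fin.
have {h} := h (measurable_itv _); rewrite lee_fin div1r => h.
apply: le_trans (ge0_ler_powR (ltW r0) _ _ h) _; rewrite ?nnegrE//.
  by rewrite mulr_ge0// powR_ge0.
by rewrite powRM ?powR_ge0// -powRrM mulVf ?gt_eqF// powRr1// fine_ge0// pint_ge0.
Qed.

Lemma line_diff_powR (N : 'rV[R]_n -> R) (d : R -> R) h x r c : 1 <= r -> 0 <= c ->
  measurable_fun setT N ->
  leb1.-integrable I01 (EFin \o d) ->
  (forall t, 0 <= t <= 1 -> `|d t| <= c * `|N (x + t *: h)|) ->
  (((`|\int[leb1]_(t in I01) d t|) `^ r)%:E <=
   \int[leb1]_(t in I01) ((2 * c) `^ r * `|N (x + t *: h)| `^ r)%:E)%E.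
Proof.
move=> r1 c0 mN id dN; have r0 : 0 <= r by apply: le_trans r1.
have md : measurable_fun I01 d by apply/measurable_EFinP; exact: measurable_int id.
apply: le_trans (Rintegral01_powR _ _ r1 id) _.
rewrite -ge0_integralZl; last 4 first.
- exact: measurable_itv.
- exact: measurable_powR_norm.
- by move=> t _; rewrite lee_fin powR_ge0.
- by rewrite lee_fin powR_ge0.
apply: ge0_le_integral; first exact: measurable_itv.
- by move=> t _; rewrite mule_ge0 ?lee_fin ?powR_ge0.
- by apply: measurable_funeM; exact: measurable_powR_norm.
- apply/measurable_EFinP; apply: measurable_funM; first exact: measurable_cst.
  apply: (measurableT_comp (measurable_powR r)); apply: measurableT_comp => //.
  apply: measurable_funTS.
  apply: measurableT_comp mN _; apply: measurable_fun_coordP => i.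
  rewrite (_ : (fun _ => _) = fun t => x ord0 i + t * h ord0 i).
    by apply: measurable_funD => //; exact: measurable_funM.
  by apply/funext => t; rewrite !mxE.
move=> t; rewrite /= in_itv/= => t01; rewrite -EFinM lee_fin.
rewrite powRM// -mulrA ler_wpM2l ?powR_ge0// -powRM//.
by rewrite ge0_ler_powR ?nnegrE ?mulr_ge0//; exact: dN.
Qed.

Lemma integral_line_powR (N : 'rV[R]_n -> R) h r c : 0 <= c -> measurable_fun setT N ->
  (\int[mu]_x \int[leb1]_(t in I01) (c * `|N (x + t *: h)| `^ r)%:E =
   c%:E * pint mu r setT N)%E.
Proof.
move=> c0 mN; rewrite (tonelli_rV01 (fun x t => (c * `|N (x + t *: h)| `^ r)%:E)); last 2 first.
- apply/measurable_EFinP; apply: measurable_funM; first exact: measurable_cst.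
  apply: (measurableT_comp (measurable_powR r)); apply: measurableT_comp => //.
  exact: measurable_comp_line.
- by move=> x t; rewrite lee_fin mulr_ge0 ?powR_ge0.
rewrite (eq_integral (fun=> c%:E * pint mu r setT N)%E); first by rewrite integral01_cst.
move=> t _; rewrite (ge0_integral_shift _ (fun y => (c * `|N y| `^ r)%:E)); last 2 first.
- apply/measurable_EFinP; apply: measurable_funM; first exact: measurable_cst.
  by apply: (measurableT_comp (measurable_powR r)); exact: measurableT_comp.
- by move=> y; rewrite lee_fin mulr_ge0 ?powR_ge0.
rewrite /pint -ge0_integralZl; last 4 first.
- exact: measurableT.
- exact: measurable_powR_norm.
- by move=> y _; rewrite lee_fin powR_ge0.
- by rewrite lee_fin.
by apply: eq_integral => y _; rewrite EFinM.
Qed.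

Lemma pint_restrict r Q (w : 'rV[R]_n -> R) : r != 0 ->
  pint mu r setT (w \_ Q) = pint mu r Q w.
Proof.
move=> r0; rewrite /pint [RHS]integral_mkcond; apply: eq_integral => y _; rewrite !patchE.
by case: ifPn => // _; rewrite normr0 powR0.
Qed.

(** Cubes are convex, so the segment from [x] to [x + h] stays inside; the line identity, Jensen's
    inequality and Tonelli give the bound. In the constant, 2 comes from [Rintegral01_powR] and
    [n l] from [dir_grad_le]. *)
Lemma pint_diff_le D u g a l r h : open D -> locally_integrable_rV D u ->
  is_weak_gradient D u g -> cube a l `<=` D -> 1 <= r -> 0 < l ->
  (forall i, `|h ord0 i| <= l) ->
  (\int[mu]_(x in cube a l `&` (fun x => x + h)%R @^-1` cube a l)
     (`|u (x + h) - u x| `^ r)%:E <=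
   ((2 * (n%:R * l)) `^ r)%:E *
     pint mu r (cube a l) (fun x => euclidean_norm (g x)))%E.
Proof.
move=> oD lu wg QD r1 l0 hl.
have r0 : 0 < r by exact: lt_le_trans r1.
have mD := open_measurable_rV _ oD.
have mQ : measurable (cube a l) by exact: measurable_cube.
have mQh : measurable ((fun x => x + h) @^-1` cube a l).
  by rewrite -[X in measurable X]setTI; exact: measurable_shift.
have mE := measurableI _ _ mQ mQh.
set N := (fun x => euclidean_norm (g x)) \_ (cube a l).
have mN : measurable_fun setT N.
  apply/(measurable_restrictT _ mQ); apply: measurable_euclidean_norm => i.
  by apply: measurable_funS mD QD _; have [[]] := wg i.
have mu' : measurable_fun setT (u \_ D).
  by apply/(measurable_restrictT _ mD); case: lu.
have NE x : cube a l x -> N x = euclidean_norm (g x) by move=> Qx; rewrite /N patchE mem_set.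
rewrite -(pint_restrict r _ _ (lt0r_neq0 r0)) -/N.
move: N mN NE => N mN NE.
rewrite -(integral_line_powR N h r) ?powR_ge0//.
have mF : measurable_fun setT (fun z : 'rV[R]_n * measurableTypeR R =>
    ((2 * (n%:R * l)) `^ r * `|N (z.1 + z.2 *: h)| `^ r)%:E).
  apply/measurable_EFinP; apply: measurable_funM; first exact: measurable_cst.
  apply: (measurableT_comp (measurable_powR r)); apply: measurableT_comp => //.
  exact: measurable_comp_line.
have F0 x t : (0 <= ((2 * (n%:R * l)) `^ r * `|N (x + t *: h)| `^ r)%:E)%E.
  by rewrite lee_fin mulr_ge0 ?powR_ge0.
have mI : measurable_fun setT (fun x => \int[leb1]_(t in I01) ((2 * (n%:R * l)) `^ r * `|N (x + t *: h)| `^ r)%:E)%E.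
  exact: (measurable_integral01 (fun x t => ((2 * (n%:R * l)) `^ r * `|N (x + t *: h)| `^ r)%:E)).
apply: (@le_trans _ _ (\int[mu]_(x in cube a l `&` (fun x => x + h)%R @^-1` cube a l)
  \int[leb1]_(t in I01) ((2 * (n%:R * l)) `^ r * `|N (x + t *: h)| `^ r)%:E)%E); last first.
  apply: ge0_subset_integral; [exact: mE|exact: measurableT|exact: mI| |by []].
  by move=> x _; exact: integral_ge0.
apply: ae_ge0_le_integral; first exact: mE.
- by move=> x _; rewrite lee_fin powR_ge0.
- apply: (@eq_measurable_fun _ _ _ _ _ (fun x => (`|(u \_ D) (x + h) - (u \_ D) x| `^ r)%:E)).
    move=> x; rewrite inE => -[Qx Qxh]; rewrite !patchE !mem_set//; exact: QD.
  apply: measurable_funTS; apply: measurable_powR_norm; apply: measurable_funB => //.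
  exact: measurableT_comp mu' (measurable_shift _).
- by move=> x _; exact: integral_ge0.
- exact: measurable_funTS.
have := weak_gradient_line D u g h oD lu wg.
apply: filterS => x hx [Qx Qxh]; move: hx.
have sQ := segment_in_cube a l h x Qx Qxh.
move=> /(_ (fun t t01 => QD _ (sQ t t01))) [iG ->].
apply: line_diff_powR => //; first by rewrite mulr_ge0// ltW.
move=> t t01; rewrite NE; last exact: sQ.
by rewrite [X in _ * X]ger0_norm ?euclidean_norm_ge0//; exact: dir_grad_le.
Qed.

(* Averaging [pint_diff_le] over [h] bounds the double integral of
   [`|u y - u x| `^ r] over [Q x Q]; a point [x] below average gives [c = u x]. *)
Lemma poincare_cube D u g a l r : open D -> locally_integrable_rV D u ->
  is_weak_gradient D u g -> cube a l `<=` D -> 1 <= r -> 0 < l ->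
  exists c, (pint mu r (cube a l) (fun x => u x - c)%R <=
    (2 * 2 ^+ n * (2 * (n%:R * l)) `^ r)%:E *
      pint mu r (cube a l) (fun x => euclidean_norm (g x)))%E.
Proof.
move=> oD lu wg QD r1 l0; set Q := cube a l.
have r0 : 0 < r by exact: lt_le_trans r1.
have mD := open_measurable_rV _ oD.
have mQ : measurable Q by exact: measurable_cube.
have mu' : measurable_fun setT (u \_ D).
  by apply/(measurable_restrictT _ mD); case: lu.
set M := (((2 * (n%:R * l)) `^ r)%:E * pint mu r Q (fun x => euclidean_norm (g x)))%E.
have M0 : (0 <= M)%E by rewrite mule_ge0 ?pint_ge0// lee_fin powR_ge0.
(* The indicators extend the integrand by zero, so that the substitution [y = h + x] and Tonelli can
   be carried out over the whole space. *)
pose k x y := (`|(u \_ D) y - (u \_ D) x| `^ r * \1_Q x * \1_Q y)%:E.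
have k0 x y : (0 <= k x y)%E by rewrite lee_fin !mulr_ge0 ?powR_ge0.
have mk : measurable_fun setT (fun z : 'rV[R]_n * 'rV[R]_n => k z.1 z.2).
  apply/measurable_EFinP; apply: measurable_funM; last first.
    by apply: (measurableT_comp (f := (\1_Q : _ -> R))) => //; exact: measurable_indic.
  apply: measurable_funM; last first.
    by apply: (measurableT_comp (f := (\1_Q : _ -> R))) => //; exact: measurable_indic.
  apply: (measurableT_comp (measurable_powR r)); apply: measurableT_comp => //.
  by apply: measurable_funB; exact: measurableT_comp mu' _.
pose F x := (\int[mu]_y k x y)%E.
have FE x : Q x -> F x = pint mu r Q (fun y => u y - u x).
  move=> Qx; rewrite /F /pint [RHS]integral_mkcond; apply: eq_integral => y _.
  rewrite /k !patchE !indicE (mem_set Qx) (mem_set (QD _ Qx)) mulr1.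
  have [yQ|yQ] := boolP (y \in Q); last by rewrite /= mulr0.
  by rewrite mem_set ?mulr1//; apply: QD; exact: set_mem.
have mF : measurable_fun setT F by exact: measurable_tonelli_rV.
have F0 x : (0 <= F x)%E by exact: integral_ge0.
have FM : (\int[mu]_(x in Q) F x <= M * ((2 * l) ^+ n)%:E)%E.
  apply: (@le_trans _ _ (\int[mu]_x F x)%E); first exact: ge0_subset_integral.
  have -> : (\int[mu]_x F x = \int[mu]_x \int[mu]_h k x (h + x)%R)%E.
    apply: eq_integral => x _.
    rewrite /F (ge0_integral_shift x (k x))//.
    exact: (measurableT_comp mk (measurable_pair1 x)).
  have mk' : measurable_fun setT (fun z : 'rV[R]_n * 'rV[R]_n => k z.1 (z.2 + z.1)%R).
    have : measurable_fun setT (fun z : 'rV[R]_n * 'rV[R]_n => (z.1, z.2 + z.1)).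
      apply: measurable_fun_pair => //; apply: measurable_fun_coordP => i.
      rewrite (_ : (fun _ => _) = fun z : 'rV[R]_n * 'rV[R]_n => z.2 ord0 i + z.1 ord0 i).
        by apply: measurable_funD; exact: (measurableT_comp (measurable_coord i)).
      by apply/funext => z; rewrite mxE.
    exact: (measurableT_comp mk).
  rewrite (tonelli_rV (fun x h => k x (h + x)%R))//.
  (* Two points of the cube differ by an [h] in this box. Its measure, [2 ^ n] times that of the
     cube, is the source of [2 ^ n] in the constant; the leading 2 comes from [le_average]. *)
  pose B : set 'rV[R]_n := box (const_mx (- l)) (const_mx l).
  have mB : measurable B by exact: measurable_box.
  have muB : mu B = ((2 * l) ^+ n)%:E.
    rewrite lebesgue_box (eq_bigr (fun=> 2 * l)) ?prodr_const ?card_ord// => i _.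
    by rewrite !mxE opprK max_r -?mulr2n ?mulr_natl// mulrn_wge0// ltW.
  rewrite -muB -integral_cst// [leRHS]integral_mkcond.
  apply: ge0_le_integral => //.
  - by move=> h _; exact: integral_ge0.
  - apply: (measurable_tonelli_rV (fun h x => k x (h + x)%R)) => //.
    have : measurable_fun setT (fun z : 'rV[R]_n * 'rV[R]_n => (z.2, z.1 + z.2)).
      apply: measurable_fun_pair => //; apply: measurable_fun_coordP => i.
      rewrite (_ : (fun _ => _) = fun z : 'rV[R]_n * 'rV[R]_n => z.1 ord0 i + z.2 ord0 i).
        by apply: measurable_funD; exact: (measurableT_comp (measurable_coord i)).
      by apply/funext => z; rewrite mxE.
    exact: (measurableT_comp mk).
  - by apply/(measurable_restrictT _ mB); exact: measurable_cst.
  move=> h _; rewrite patchE; case: ifPn => hB.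
    have hl i : `|h ord0 i| <= l.
      by have /(_ i) := set_mem hB; rewrite !mxE ler_norml => /andP[/ltW -> /ltW ->].
    apply: le_trans (pint_diff_le D u g a l r h oD lu wg QD r1 l0 hl).
    rewrite le_eqVlt; apply/orP; left; apply/eqP.
    rewrite [RHS]integral_mkcond; apply: eq_integral => x _.
    rewrite [RHS]patchE classical_sets.in_setI /k !indicE; have [xQ|xQ] := boolP (x \in Q); last first.
      by rewrite /= mulr0 mul0r.
    have -> : (x \in (fun x => x + h) @^-1` Q) = (h + x \in Q).
      by apply/idP/idP; rewrite !inE /= addrC.
    have [hxQ|hxQ] := boolP (h + x \in Q); last by rewrite /= mulr0.
    rewrite /= !mulr1 !patchE !mem_set ?(addrC h)//; apply: QD; first exact: set_mem.
    by rewrite addrC; exact: set_mem.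
  rewrite integral0_eq// => x _; rewrite /k !indicE.
  have [xQ|xQ] := boolP (x \in Q); last by rewrite /= mulr0 mul0r.
  have [hxQ|hxQ] := boolP (h + x \in Q); last by rewrite /= mulr0.
  exfalso; move/negP: hB; apply; apply: mem_set => i; rewrite !mxE.
  have /(_ i)/andP[h1 h2] := set_mem xQ; have /(_ i)/andP := set_mem hxQ.
  by rewrite !mxE => -[h3 h4]; apply/andP; split; lra.
have [x Qx] := le_average mu F Q _ mQ (lebesgue_cube a l l0) (exprn_gt0 n l0) (measurable_funTS mF) (fun x _ => F0 x).
move=> hx; exists (u x); rewrite -FE//.
have ln0 : 0 < l ^+ n by exact: exprn_gt0.
have {}hx : (F x * (l ^+ n)%:E <= 2%:E * (M * ((2 * l) ^+ n)%:E))%E.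
  by apply: le_trans hx _; apply: lee_pmul => //; exact: integral_ge0.
rewrite -(@lee_pmul2r _ (l ^+ n)%:E)//; apply: le_trans hx _.
rewrite [X in (_ <= X * _)%E](_ : _ = (2 * 2 ^+ n)%:E * M)%E; last by rewrite /M muleA -EFinM.
by rewrite exprMn !EFinM; generalize M => M'; rewrite -!muleA (muleCA M').
Qed.

End poincare.

Section subcubes.
Context {R : realType} {n : nat}.
Local Notation mu := (lebesgue_rV R n).
Implicit Types (a : 'rV[R]_n) (l : R) (b : {ffun 'I_n -> bool}).

Definition subcorner a l b : 'rV[R]_n := \row_i (a ord0 i + (l / 2) * (b i)%:R).

Definition subcube a l b : set 'rV[R]_n := cube (subcorner a l b) (l / 2).

Lemma measurable_subcube a l b : measurable (subcube a l b).
Proof. exact: measurable_cube. Qed.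

Lemma subcube_sub a l b : 0 < l -> subcube a l b `<=` cube a l.
Proof.
move=> l0 x xb i; have /andP := xb i; rewrite mxE => -[].
by case: (b i) => /= h1 h2; apply/andP; split; lra.
Qed.

Lemma bigcup_subcube a l : 0 < l ->
  cube a l = \big[setU/set0]_(b <- index_enum {ffun 'I_n -> bool}) subcube a l b.
Proof.
move=> l0; rewrite -bigcup_seq; apply/seteqP; split => [x xa|x [b _]]; last exact: subcube_sub.
exists [ffun i => a ord0 i + l / 2 <= x ord0 i]; first by rewrite /= mem_index_enum.
move=> i; rewrite mxE ffunE; have /andP[h1 h2] := xa i.
by have [h|h] := leP (a ord0 i + l / 2) (x ord0 i); rewrite ?h ?(lt_geF h) /=; apply/andP; split; lra.
Qed.

Lemma trivIset_subcube a l : 0 < l ->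
  trivIset [set` index_enum {ffun 'I_n -> bool}] (subcube a l).
Proof.
move=> l0 b b' _ _ [x [xb xb']]; apply/ffunP => i.
have := xb i; have := xb' i; rewrite !mxE.
by case: (b i); case: (b' i) => //= /andP[h1 h2] /andP[h3 h4]; exfalso; lra.
Qed.

Lemma ge0_integral_subcube a l (f : 'rV[R]_n -> \bar R) : 0 < l ->
  measurable_fun (cube a l) f -> (forall x, cube a l x -> 0 <= f x)%E ->
  (\int[mu]_(x in cube a l) f x = \sum_b \int[mu]_(x in subcube a l b) f x)%E.
Proof.
move=> l0 mf f0; rewrite (bigcup_subcube a l l0) in mf f0 *.
rewrite ge0_integral_bigsetU//.
- by move=> b; exact: measurable_subcube.
- exact: index_enum_uniq.
- exact: trivIset_subcube.
Qed.

End subcubes.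

Section fatou_bound.
Context {d} {T : measurableType d} {R : realType} (nu : {measure set T -> \bar R}).

Lemma fatou_bound (E : set T) (f : nat -> T -> \bar R) g M : measurable E ->
  (forall k, measurable_fun E (f k)) -> (forall k x, E x -> 0 <= f k x)%E ->
  (forall x, E x -> f k x @[k --> \oo] --> g x) ->
  (forall k, \int[nu]_(x in E) f k x <= M)%E -> (\int[nu]_(x in E) g x <= M)%E.
Proof.
move=> mE mf f0 fg fM.
rewrite (eq_integral (fun x => limn_einf (f ^~ x))); last first.
  by move=> x; rewrite inE => Ex; have [] := cvg_limn_einf_sup (fg x Ex).
apply: le_trans (fatou nu mE mf f0) _.
rewrite limn_einf_lim; apply: lime_le; first exact: is_cvg_einfs.
by apply: nearW => k; apply: le_trans (fM k); apply: ereal_inf_lbound; exists k => /=.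
Qed.

End fatou_bound.

Section sobolev_numeric.
Context {R : realType}.

Lemma powR_inv2 (s : R) : 2^-1 `^ s = 2 `^ (- s).
Proof. by rewrite -(powR_inv1 (ler0n R 2)) -powRrM mulN1r. Qed.

(** The hypothesis is raised to the power [r / q], which turns [l ^ q] into [l ^ r]. The volume
    [(l / 2) ^ n] is left over with exponent [1 - r / q], and the two together give the exponent
    [r + n - n r / q] of [l]. *)
Lemma mean_diff_powR (n : nat) (q r d l G P : R) : 0 < q -> q <= r -> 0 <= d ->
  0 < l -> 0 <= G -> 0 <= P ->
  d `^ q * (l / 2) ^+ n <= 2 `^ q * (2 * (P * l `^ q) * G) ->
  d `^ r * (l / 2) ^+ n <=
    ((2 `^ q * 2 * P) `^ (r / q) * 2 `^ (n%:R * (r / q - 1))) *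
    (l `^ (r + n%:R - n%:R * (r / q)) * G `^ (r / q)).
Proof.
move=> q0 qr d0 l0 G0 P0 h.
have s0 : 0 <= r / q by rewrite divr_ge0// ?(ltW q0)// (le_trans _ qr)// ltW.
have L0 : 0 < l / 2 by rewrite divr_gt0.
have Ln0 : 0 < (l / 2) ^+ n by rewrite exprn_gt0.
have dE : d `^ r = (d `^ q) `^ (r / q) by rewrite -powRrM mulrC divfK// gt_eqF.
have h1 : (d `^ q * (l / 2) ^+ n) `^ (r / q) <= (2 `^ q * (2 * (P * l `^ q) * G)) `^ (r / q).
  by rewrite ge0_ler_powR ?nnegrE// ?mulr_ge0 ?powR_ge0// ltW.
have LE : (l / 2) ^+ n = ((l / 2) ^+ n) `^ (r / q) * ((l / 2) ^+ n) `^ (1 - r / q).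
  rewrite -powRD; first by rewrite addrC subrK powRr1// ltW.
  by apply/implyP => _; rewrite gt_eqF.
rewrite LE mulrA dE -powRM ?powR_ge0// ?(ltW Ln0)//.
apply: (@le_trans _ _ ((2 `^ q * (2 * (P * l `^ q) * G)) `^ (r / q) * ((l / 2) ^+ n) `^ (1 - r / q))).
  by rewrite ler_wpM2r ?powR_ge0.
have -> : 2 `^ q * (2 * (P * l `^ q) * G) = (2 `^ q * 2 * P) * l `^ q * G by ring.
rewrite (powRM (r / q)) ?mulr_ge0 ?powR_ge0// (powRM (r / q)) ?mulr_ge0 ?powR_ge0//.
rewrite -(powRrM l) (mulrCA q) divff ?gt_eqF// mulr1.
rewrite -(powR_mulrn _ (ltW L0)) [(l / 2) `^ _]powRM ?(ltW l0)//.
rewrite [(_ * 2^-1 `^ _) `^ _]powRM ?powR_ge0// -!powRrM.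
have -> : 2^-1 `^ (n%:R * (1 - r / q)) = 2 `^ (n%:R * (r / q - 1)) :> R.
  by rewrite powR_inv2 -mulrN opprB.
have -> : r + n%:R - n%:R * (r / q) = r + n%:R * (1 - r / q) by ring.
rewrite [l `^ (r + _)]powRD; last by apply/implyP => _; rewrite gt_eqF.
rewrite le_eqVlt; apply/orP; left; apply/eqP; ring.
Qed.

Lemma powR2_gt1 (s : R) : 0 < s -> 1 < 2 `^ s.
Proof.
move=> s0; have E : 1 `^ s = 1 :> R by rewrite powR1.
by rewrite -[ltLHS]E; apply: gt0_ltr_powR; rewrite ?nnegrE// ltr1n.
Qed.

Lemma norm_min_le (x y K : R) : 0 <= K ->
  `|Num.min `|x + y| K| <= `|Num.min `|x| K| + `|y|.
Proof.
move=> K0; have m0 (z : R) : 0 <= Num.min `|z| K by rewrite le_min normr_ge0.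
rewrite !(ger0_norm (m0 _)) addr_minl le_min; apply/andP; split.
  by rewrite ge_min ler_normD.
by rewrite ge_min lerDl normr_ge0 orbT.
Qed.

Lemma le_of_le_add_geometric (x a b t : R) : 0 <= t -> t < 1 ->
  (forall m, x <= a + b * t ^+ m) -> x <= a.
Proof.
move=> t0 t1 h.
have cv : (fun m => a + geometric b t m) @ \oo --> a + 0.
  by apply: cvgD; [exact: cvg_cst|apply: cvg_geometric; rewrite ger0_norm].
rewrite -[a]addr0 -(cvg_lim _ cv)//; apply: limr_ge; first by apply/cvg_ex; exists (a + 0).
by apply: nearW => m; exact: h.
Qed.

End sobolev_numeric.

(** * Dyadic iteration for the Sobolev inequality on a cube *)

Section sobolev_cube.
Context {R : realType} {n : nat}.
Local Notation mu := (lebesgue_rV R n).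
Implicit Types (a : 'rV[R]_n) (l K : R).
Context (v N : 'rV[R]_n -> R) (Q0 : set 'rV[R]_n) (q r P : R)
  (c : 'rV[R]_n -> R -> R).
Context (q1 : 1 <= q) (qr : q < r) (gam0 : 0 < r + n%:R - n%:R * (r / q)) (P0 : 0 <= P).
Context (mQ0 : measurable Q0) (mv : measurable_fun Q0 v) (mN : measurable_fun Q0 N).
Context (Nfin : (pint mu q Q0 N < +oo)%E).
Context (poincare_c : forall a l, 0 < l -> cube a l `<=` Q0 ->
  (pint mu q (cube a l) (fun x => v x - c a l)%R <= (P * l `^ q)%:E * pint mu q (cube a l) N)%E).

(** The power of the side length that scaling dictates in the Sobolev inequality on a cube. It is
    positive exactly when [r] lies below the Sobolev conjugate of [q]. *)
Let gam := r + n%:R - n%:R * (r / q).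
Let G a l := fine (pint mu q (cube a l) N).
Let D := (2 `^ q * 2 * P) `^ (r / q) * 2 `^ (n%:R * (r / q - 1)).
Let m := Num.min gam q.
(** Halving the cube gains the factor [2 ^ (- gam)] or [2 ^ (- q)], in either case at most
    [2 ^ (- m)]. This [e] makes [(1 + e) ^ r] equal to [2 ^ (m / 2)], which spends half of the gain
    and leaves the contraction factor [th]. *)
Let e := 2 `^ (m / (2 * r)) - 1.
Let th := 2 `^ (- (m / 2)) : R.
Let B := (2 ^ n)%:R * ((1 + e^-1) `^ r * D).
(** The fixed point of [A = A * th + B], where [B] is the cost of moving the constants of all
    [2 ^ n] subcubes in one generation. *)
Let A := B / (1 - th).

Let q0 : 0 < q. Proof. exact: lt_le_trans q1. Qed.
Let r0 : 0 < r. Proof. exact: lt_trans qr. Qed.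
Let m0 : 0 < m. Proof. by rewrite /m lt_min gam0. Qed.
Let e0 : 0 < e.
Proof. by rewrite subr_gt0 powR2_gt1// divr_gt0// mulr_gt0. Qed.
Let th1 : th < 1.
Proof. by rewrite /th powRN invf_lt1 ?powR_gt0// powR2_gt1// divr_gt0. Qed.
Let B0 : 0 <= B. Proof. by rewrite !mulr_ge0 ?powR_ge0. Qed.
Let A0 : 0 <= A. Proof. by rewrite divr_ge0// subr_ge0 ltW. Qed.

Let eth s : m <= s -> (1 + e) `^ r * 2^-1 `^ s <= th.
Proof.
move=> ms; rewrite /e (addrC 1) subrK -powRrM powR_inv2 -powRD; last first.
  by apply/implyP => _; rewrite gt_eqF.
rewrite ler_powR ?ler1n//.
have -> : m / (2 * r) * r = m / 2 by field; rewrite gt_eqF.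
by move: ms => ?; lra.
Qed.

Let Gfin a l : cube a l `<=` Q0 -> pint mu q (cube a l) N = (G a l)%:E.
Proof.
move=> QQ; rewrite fineK// ge0_fin_numE ?pint_ge0//; apply: le_lt_trans Nfin.
by apply: pint_subset => //; exact: measurable_cube.
Qed.

Let G0 a l : 0 <= G a l. Proof. by rewrite fine_ge0// pint_ge0. Qed.

Let G_subcube a l b : 0 < l -> cube a l `<=` Q0 ->
  (pint mu q (subcube a l b) N <= (G a l)%:E)%E.
Proof.
move=> l0 QQ; rewrite -Gfin//; apply: pint_subset => //; try exact: measurable_cube.
  exact: (subcube_sub a l b l0).
by apply: measurable_funS mQ0 QQ _.
Qed.

Let mtr a l K (k : R) : cube a l `<=` Q0 ->
  measurable_fun (cube a l) (fun x => Num.min `|v x - k| K).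
Proof.
move=> QQ; apply: measurable_minr; last exact: measurable_cst.
by apply: measurableT_comp => //; apply: measurable_funB => //; exact: measurable_funS mQ0 QQ _.
Qed.

(** On the half-size cube [v] is close in [L^q] to the constant of that cube and, by restriction, to
    that of the parent; so the two constants are close, and [mean_diff_powR] passes to the power
    [r]. *)
Lemma subcube_mean_diff a l (b : {ffun 'I_n -> bool}) : 0 < l -> cube a l `<=` Q0 ->
  `|c (subcorner a l b) (l / 2) - c a l| `^ r * (l / 2) ^+ n
  <= D * (l `^ gam * G a l `^ (r / q)).
Proof.
move=> l0 QQ; set a' := subcorner _ _ _; set k := c a' _.
have L0 : 0 < l / 2 by rewrite divr_gt0.
have sQ : cube a' (l / 2) `<=` cube a l by exact: (subcube_sub a l b l0).
have QQ' := subset_trans sQ QQ.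
have mQ' := measurable_cube a' (l / 2).
have mv' t : measurable_fun (cube a' (l / 2)) (fun x => v x - t).
  by apply: measurable_funB => //; exact: measurable_funS mQ0 QQ' _.
have mv'' t : measurable_fun (cube a l) (fun x => v x - t).
  by apply: measurable_funB => //; exact: measurable_funS mQ0 QQ _.
apply: mean_diff_powR => //; first exact: ltW.
rewrite -lee_fin EFinM -(lebesgue_cube a')// -(pint_cst mu q _ (k - c a l) mQ').
have -> : cst (k - c a l) = (fun x => v x - c a l) \+ (fun x => - (v x - k)).
  by apply/funext => x /=; ring.
apply: le_trans (pint_add _ _ _ _ _ mQ' (mv' _) _ (ltW q0)) _.
  exact: measurable_funN (mv' _).
rewrite EFinM lee_wpmul2l ?lee_fin ?powR_ge0//.
have -> : 2 * (P * l `^ q) * G a l = P * l `^ q * G a l + P * l `^ q * G a l by ring.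
rewrite EFinD; apply: leeD.
  apply: le_trans (pint_subset _ _ _ _ _ mQ' (measurable_cube a l) sQ (mv'' _)) _.
  by rewrite EFinM -Gfin//; exact: poincare_c.
have -> : pint mu q (cube a' (l / 2)) (fun x => - (v x - k)) =
    pint mu q (cube a' (l / 2)) (fun x => v x - k).
  by apply: eq_integral => x _; rewrite normrN.
apply: le_trans (poincare_c a' (l / 2) L0 QQ') _.
rewrite (EFinM (P * _)); apply: lee_pmul => //.
- by rewrite lee_fin mulr_ge0 ?powR_ge0.
- exact: pint_ge0.
- rewrite lee_fin ler_wpM2l// ge0_ler_powR ?nnegrE ?(ltW q0) ?(ltW L0) ?(ltW l0)//.
  by rewrite ler_pdivrMr// ler_peMr// ?ler1n// ltW.
- exact: (G_subcube a l b l0 QQ).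
Qed.

(* Induction on dyadic generations: in passing to the [2 ^ n] half-size cubes
   the constants [c] move by [subcube_mean_diff] only, while both remaining terms
   shrink by the factor [th < 1] because [gam > 0].  The truncation at [K] makes
   the initial bound finite, and disappears from the limit [k --> \oo]. *)
Lemma truncated_sobolev k a l K : 0 < K -> 0 < l -> cube a l `<=` Q0 ->
  (pint mu r (cube a l) (fun x => Num.min `|v x - c a l|%R K) <=
   (A * (l `^ gam * G a l `^ (r / q)) +
    K `^ (r - q) * P * (l `^ q * G a l) * th ^+ k)%:E)%E.
Proof.
move=> K0; elim: k a l => [|k IH] a l l0 QQ.
  have mQ := measurable_cube a l.
  have mv' : measurable_fun (cube a l) (fun x => v x - c a l).
    by apply: measurable_funB => //; exact: measurable_funS mQ0 QQ _.
  (* The truncation gives [min t K ^ r <= K ^ (r - q) * t ^ q], so the Poincare inequality in [L^q]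
     bounds generation zero. *)
  apply: (@le_trans _ _ ((K `^ (r - q))%:E * pint mu q (cube a l) (fun x => v x - c a l)%R)%E).
    rewrite /pint -ge0_integralZl ?lee_fin ?powR_ge0//; last exact: measurable_powR_norm.
    apply: ge0_le_integral => //.
    - by apply: measurable_powR_norm; exact: mtr.
    - by apply: measurable_funeM; exact: measurable_powR_norm.
    move=> x _; rewrite -EFinM lee_fin.
    set t := `|v x - c a l|; have t0 : 0 <= t by exact: normr_ge0.
    have mt : 0 <= Num.min t K by rewrite le_min t0 ltW.
    rewrite (ger0_norm mt).
    have [->|mt0] := eqVneq (Num.min t K) 0.
      by rewrite powR0 ?gt_eqF// mulr_ge0 ?powR_ge0.
    have -> : Num.min t K `^ r = Num.min t K `^ (r - q) * Num.min t K `^ q.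
      by rewrite -powRD ?subrK// mt0 implybT.
    apply: ler_pM; rewrite ?powR_ge0// ge0_ler_powR ?nnegrE ?subr_ge0 ?(ltW q0) ?(ltW qr) ?(ltW K0)//.
      by rewrite ge_min lexx orbT.
    by rewrite ge_min lexx.
  rewrite expr0 mulr1.
  have := poincare_c a l l0 QQ; rewrite Gfin// -EFinM => h.
  apply: (@le_trans _ _ ((K `^ (r - q))%:E * (P * l `^ q * G a l)%:E)%E).
    by rewrite lee_wpmul2l// lee_fin powR_ge0.
  have -> : ((K `^ (r - q))%:E * (P * l `^ q * G a l)%:E)%E = (K `^ (r - q) * P * (l `^ q * G a l))%:E :> \bar R.
    by rewrite -EFinM; congr (_%:E); ring.
  by rewrite lee_fin lerDr; apply: mulr_ge0 => //; apply: mulr_ge0; exact: powR_ge0.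
have mQ := measurable_cube a l.
have L0 : 0 < l / 2 by rewrite divr_gt0.
pose a' (b : {ffun 'I_n -> bool}) := subcorner a l b.
have mQ' b : measurable (subcube a l b) by exact: measurable_subcube.
have QQ' b : subcube a l b `<=` Q0 by exact: subset_trans (subcube_sub a l b l0) QQ.
pose X b := (1 + e) `^ r * (A * ((l / 2) `^ gam * G (a' b) (l / 2) `^ (r / q)) +
    K `^ (r - q) * P * ((l / 2) `^ q * G (a' b) (l / 2)) * th ^+ k) +
    (1 + e^-1) `^ r * (D * (l `^ gam * G a l `^ (r / q))).
apply: (@le_trans _ _ (\sum_(b : {ffun 'I_n -> bool}) (X b)%:E)%E).
  rewrite [leLHS]ge0_integral_subcube//; last first.
    by apply: measurable_powR_norm; exact: mtr.
  apply: lee_sum => b _; set cb := c (a' b) (l / 2).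
  have mtb k' : measurable_fun (subcube a l b) (fun x => Num.min `|v x - k'|%R K) by apply: mtr; exact: QQ'.
  apply: (@le_trans _ _ (((1 + e) `^ r)%:E * pint mu r (subcube a l b) (fun x => Num.min `|v x - cb|%R K)
     + ((1 + e^-1) `^ r * `|cb - c a l| `^ r)%:E * mu (subcube a l b))%E).
    rewrite -[X in (_ <= _ + X)%E](integral_cst mu (mQ' b)) /pint -ge0_integralZl ?lee_fin ?powR_ge0//; last first.
      by apply: measurable_powR_norm.
    rewrite -ge0_integralD//; last 3 first.
    - by move=> x _; rewrite mule_ge0 ?lee_fin ?powR_ge0.
    - by apply: measurable_funeM; exact: measurable_powR_norm.
    - by move=> x _; rewrite lee_fin mulr_ge0 ?powR_ge0.
    apply: ge0_le_integral => //.
    - by apply: measurable_powR_norm.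
    - by apply: emeasurable_funD => //; apply: measurable_funeM; exact: measurable_powR_norm.
    move=> x _; rewrite -EFinM -EFinD lee_fin.
    apply: le_trans (powR_add_le_eps r e _ _ e0 (ltW r0) (normr_ge0 _) (normr_ge0 _)).
    rewrite ge0_ler_powR ?nnegrE ?addr_ge0 ?(ltW r0)//.
    have -> : v x - c a l = (v x - cb) + (cb - c a l) by rewrite addrA subrK.
    by apply: norm_min_le; exact: ltW.
  rewrite /X EFinD; apply: leeD.
    by rewrite (EFinM (_ `^ r)) lee_wpmul2l ?lee_fin ?powR_ge0//; exact: (IH _ _ L0 (QQ' b)).
  rewrite [mu _]lebesgue_cube// -EFinM lee_fin -mulrA ler_wpM2l ?powR_ge0//.
  exact: subcube_mean_diff.
rewrite sumEFin lee_fin /X big_split/= sumr_const card_ffun card_bool card_ord.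
rewrite -mulr_sumr big_split/= -!mulr_sumr -mulr_suml -mulr_sumr -mulr_sumr.
have SG : \sum_b G (a' b) (l / 2) = G a l.
  apply: EFin_inj; rewrite -Gfin// -sumEFin /pint ge0_integral_subcube//.
    by apply: eq_bigr => b _; rewrite -Gfin//; exact: QQ'.
  by apply: measurable_powR_norm; exact: measurable_funS mQ0 QQ _.
(* The integral of [|N| ^ q] is additive over the subcubes, and since [r / q >= 1] a sum of powers
   is at most the power of the sum. *)
have SGs : \sum_b G (a' b) (l / 2) `^ (r / q) <= G a l `^ (r / q).
  rewrite -SG; apply: powR_superadd_sum => //.
  by rewrite ler_pdivlMr// mul1r ltW.
have S0 : 0 <= \sum_b G (a' b) (l / 2) `^ (r / q) by apply: sumr_ge0 => *; exact: powR_ge0.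
rewrite SG powRM ?(ltW l0)// [(l / 2) `^ q]powRM ?(ltW l0)//.
have h1 := eth gam ltac:(by rewrite /m ge_min lexx).
have h2 := eth q ltac:(by rewrite /m ge_min lexx orbT).
have AE : A = A * th + B by rewrite /A; field; rewrite subr_eq0 gt_eqF.
have K1 : 0 <= K `^ (r - q) * P * (l `^ q * G a l) * th ^+ k.
  by rewrite mulr_ge0 ?exprn_ge0 ?powR_ge0// mulr_ge0 ?(mulr_ge0 (powR_ge0 _ _))// mulr_ge0 ?powR_ge0.
have A1 : 0 <= A * l `^ gam by rewrite mulr_ge0 ?powR_ge0.
have -> : (1 + e^-1) `^ r * (D * (l `^ gam * G a l `^ (r / q))) *+ 2 ^ n =
    B * (l `^ gam * G a l `^ (r / q)) by rewrite /B -mulr_natl !mulrA.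
rewrite {2}AE.
rewrite mulrDl addrAC lerD2r exprS.
set x := (1 + e) `^ r in h1 h2 *; set y := 2^-1 `^ gam in h1 *; set y' := 2^-1 `^ q in h2 *.
have -> : x * (A * (l `^ gam * y * \sum_b G (a' b) (l / 2) `^ (r / q)) +
    K `^ (r - q) * P * (l `^ q * y' * G a l) * th ^+ k) =
  x * y * (A * l `^ gam * \sum_b G (a' b) (l / 2) `^ (r / q)) +
  x * y' * (K `^ (r - q) * P * (l `^ q * G a l) * th ^+ k) by ring.
have th0 : 0 <= th by exact: powR_ge0.
have xy0 : 0 <= x * y by rewrite mulr_ge0 ?powR_ge0.
apply: (@le_trans _ _ (th * (A * l `^ gam * G a l `^ (r / q)) +
    th * (K `^ (r - q) * P * (l `^ q * G a l) * th ^+ k))).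
  apply: lerD; last exact: ler_wpM2r.
  by apply: ler_pM => //; [exact: mulr_ge0|exact: ler_wpM2l].
rewrite le_eqVlt; apply/orP; left; apply/eqP; ring.
Qed.

(** For fixed [K] the last term of [truncated_sobolev] vanishes as the number of generations grows,
    although its factor depends on [K]; only then does [K] tend to infinity, by Fatou's lemma. *)
Lemma sobolev_cube a l : 0 < l -> cube a l `<=` Q0 ->
  (pint mu r (cube a l) (fun x => v x - c a l)%R <=
   (A * (l `^ gam * G a l `^ (r / q)))%:E)%E.
Proof.
move=> l0 QQ; have mQ := measurable_cube a l.
have mv' : measurable_fun (cube a l) (fun x => v x - c a l).
  by apply: measurable_funB => //; exact: measurable_funS mQ0 QQ _.
pose f k x := (`|Num.min `|v x - c a l|%R k.+1%:R| `^ r)%:E : \bar R.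
have fb k : (\int[mu]_(x in cube a l) f k x <= (A * (l `^ gam * G a l `^ (r / q)))%:E)%E.
  have K0 : 0 < k.+1%:R :> R by [].
  have fin : pint mu r (cube a l) (fun x => Num.min `|v x - c a l|%R k.+1%:R) \is a fin_num.
    rewrite ge0_fin_numE; last exact: pint_ge0.
    by apply: le_lt_trans (truncated_sobolev 0 a l _ K0 l0 QQ) _; exact: ltry.
  rewrite -[leLHS]/(pint mu r (cube a l) (fun x => Num.min `|v x - c a l|%R k.+1%:R)).
  rewrite -(fineK fin) lee_fin; apply: (le_of_le_add_geometric _ _ _ th (powR_ge0 _ _) th1) => i.
  rewrite -lee_fin fineK//; exact: truncated_sobolev.
apply: (fatou_bound mu _ f) => //.
- by move=> k; apply: measurable_powR_norm; exact: mtr.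
- by move=> k x _; rewrite lee_fin powR_ge0.
move=> x _; apply: cvg_near_cst.
near=> k; rewrite /f min_l ?normr_id//.
near: k; exists (Num.truncn `|v x - c a l|) => // k /= hk.
by apply: (le_trans (ltW (truncnS_gt _))); rewrite ler_nat.
Unshelve. all: by end_near.
Qed.

End sobolev_cube.

(** The constant is fixed before [D], [u] and [a]: it depends on [n], [q], [r] and [l] alone, so
    that it serves the extensions of all functions at once. *)
Lemma sobolev_poincare_cube (R : realType) (n : nat) (q r l : R) : 1 <= q -> q < r ->
  0 < r + n%:R - n%:R * (r / q) -> 0 < l ->
  exists2 C, 0 <= C & forall (D : set 'rV[R]_n) u g a, open D ->
    locally_integrable_rV D u -> is_weak_gradient D u g -> cube a l `<=` D ->
    (pint (lebesgue_rV R n) q (cube a l) (fun x => euclidean_norm (g x)) < +oo)%E ->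
    exists c, (pint (lebesgue_rV R n) r (cube a l) (fun x => u x - c)%R <=
      (C * fine (pint (lebesgue_rV R n) q (cube a l) (fun x => euclidean_norm (g x))) `^ (r / q))%:E)%E.
Proof.
move=> q1 qr gam0 l0; have q0 : 0 < q by exact: lt_le_trans q1.
pose P : R := 2 * 2 ^+ n * (2 * n%:R) `^ q.
have P0 : 0 <= P by rewrite !mulr_ge0 ?powR_ge0 ?exprn_ge0.
have [C C0 hC] : exists2 C, 0 <= C & forall (v N : 'rV[R]_n -> R) (Q0 : set 'rV[R]_n) c a,
    measurable Q0 -> measurable_fun Q0 v -> measurable_fun Q0 N ->
    (pint (lebesgue_rV R n) q Q0 N < +oo)%E ->
    (forall a l, 0 < l -> cube a l `<=` Q0 ->
      (pint (lebesgue_rV R n) q (cube a l) (fun x => v x - c a l)%R <=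
       (P * l `^ q)%:E * pint (lebesgue_rV R n) q (cube a l) N)%E) ->
    cube a l `<=` Q0 ->
    (pint (lebesgue_rV R n) r (cube a l) (fun x => v x - c a l)%R <=
     (C * fine (pint (lebesgue_rV R n) q (cube a l) N) `^ (r / q))%:E)%E.
  eexists; last first.
    move=> v N Q0 c a mQ0 mv mN Nfin hc QQ.
    have := sobolev_cube v N Q0 q r P c q1 qr gam0 P0 mQ0 mv mN Nfin hc a l l0 QQ.
    rewrite mulrA; exact.
  rewrite mulr_ge0 ?powR_ge0// divr_ge0//; last first.
    rewrite subr_ge0 ltW// powRN invf_lt1 ?powR_gt0// powR2_gt1// divr_gt0//.
    by rewrite lt_min gam0.
  by rewrite !mulr_ge0 ?powR_ge0.
exists C => // D u g a oD lu wg QD Nfin.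
have mQ := measurable_cube a l.
(* [poincare_cube] yields a constant for each cube separately; choice over corner and side turns
   these into one function [c]. *)
have [c hc] : exists c, forall a' l', 0 < l' -> cube a' l' `<=` cube a l ->
    (pint (lebesgue_rV R n) q (cube a' l') (fun x => u x - c a' l')%R <=
     (P * l' `^ q)%:E * pint (lebesgue_rV R n) q (cube a' l') (fun x => euclidean_norm (g x)))%E.
  have h (al : 'rV[R]_n * R) : exists c, 0 < al.2 -> cube al.1 al.2 `<=` cube a l ->
    (pint (lebesgue_rV R n) q (cube al.1 al.2) (fun x => u x - c)%R <=
     (P * al.2 `^ q)%:E * pint (lebesgue_rV R n) q (cube al.1 al.2) (fun x => euclidean_norm (g x)))%E.
    have [[l0' QQ]|h] := pselect (0 < al.2 /\ cube al.1 al.2 `<=` cube a l); last first.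
      by exists 0 => l0' QQ; exfalso; exact: h.
    have [c hc] := poincare_cube D u g al.1 al.2 q oD lu wg (subset_trans QQ QD) q1 l0'.
    exists c => _ _; apply: le_trans hc _; rewrite mulrA powRM ?mulr_ge0// ?(ltW l0')//.
    by rewrite mulrA.
  have [c hc] := choice h; exists (fun a' l' => c (a', l')) => a' l'; exact: (hc (a', l')).
exists (c a l); apply: (hC u (fun x => euclidean_norm (g x)) (cube a l) c a) => //.
- by case: lu => mu' _; apply: measurable_funS QD mu'; exact: open_measurable_rV.
- apply: measurable_euclidean_norm => i; have [[mg _] _] := wg i.
  by apply: measurable_funS QD mg; exact: open_measurable_rV.
Qed.

Lemma pint_setU_le d (T : measurableType d) (R : realType) (nu : {measure set T -> \bar R})
    (r : R) (A B : set T) (w : T -> R) : measurable A -> measurable B ->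
  measurable_fun (A `|` B) w -> (pint nu r (A `|` B) w <= pint nu r A w + pint nu r B w)%E.
Proof.
move=> mA mB mw; have ABE : A `|` B = A `|` (B `\` A).
  apply/seteqP; split => x; last by case => [|[]]; [left|right].
  by have [Ax|nAx] := pselect (A x); [left|move=> [//|Bx]; right].
have mw' := measurable_powR_norm r _ w mw.
rewrite {1}/pint {1}ABE ge0_integral_setU//; last 3 first.
- exact: measurableD.
- by rewrite -ABE.
- by rewrite disj_set2E setDE setICA setICr setI0.
rewrite leeD2l//; apply: ge0_subset_integral => //; first exact: measurableD.
by apply: measurable_funS mw'; [exact: measurableU|move=> x; right].
Qed.

(** * Poincare inequalities on large subsets of a domain *)

Section poincare_sets.
Context {R : realType} {n : nat}.
Local Notation mu := (lebesgue_rV R n).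
Context (Om : set 'rV[R]_n) (p : R).
Context (oOm : open Om) (finOm : (mu Om < +oo)%E) (p1 : 1 <= p).
Implicit Types (A B : set 'rV[R]_n) (x a : 'rV[R]_n) (e l : R).

(** The gradient is integrated over all of [Om], not just over [A], so that unions of such sets need
    no geometry: only the measure of an overlap matters. *)
Definition poincare_set A := [/\ measurable A, A `<=` Om &
  exists2 C, 0 < C & forall u g, locally_integrable_rV Om u -> is_weak_gradient Om u g ->
    exists c, (pint mu p A (fun x => u x - c)%R <=
               C%:E * pint mu p Om (fun x => euclidean_norm (g x)))%E].

Let mOm : measurable Om. Proof. exact: open_measurable_rV. Qed.

Let p0 : 0 < p. Proof. exact: lt_le_trans p1. Qed.

Let mu_sub A : measurable A -> A `<=` Om -> mu A \is a fin_num.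
Proof.
move=> mA AOm; rewrite ge0_fin_numE ?measure_ge0//; apply: le_lt_trans finOm.
by apply: le_measure; rewrite ?inE.
Qed.

Lemma poincare_set_cube a l : 0 < l -> cube a l `<=` Om -> poincare_set (cube a l).
Proof.
move=> l0 QOm; have mQ := measurable_cube a l; split => //.
exists (2 * 2 ^+ n * (2 * (n%:R * l)) `^ p + 1).
  by rewrite ltr_wpDl// !mulr_ge0 ?exprn_ge0 ?powR_ge0.
move=> u g lu wg; have [c hc] := poincare_cube Om u g a l p oOm lu wg QOm p1 l0.
exists c; apply: le_trans hc _; apply: lee_pmul => //; rewrite ?pint_ge0//.
- by rewrite lee_fin !mulr_ge0 ?exprn_ge0 ?powR_ge0.
- by rewrite lee_fin lerDl.
apply: pint_subset => //; apply: measurable_euclidean_norm => i.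
by have [[]] := wg i.
Qed.

(** On the overlap [u] is close to both constants [cA] and [cB], which bounds [|cB - cA|] by the
    gradient; on [B] the constant [cB] can then be replaced by [cA]. *)
Lemma poincare_setU A B : poincare_set A -> poincare_set B ->
  (0 < mu (A `&` B))%E -> poincare_set (A `|` B).
Proof.
move=> [mA AOm [CA CA0 hA]] [mB BOm [CB CB0 hB]] AB0.
have mAB := measurableI _ _ mA mB.
have ABOm : A `&` B `<=` Om by move=> x [/AOm].
split; [exact: measurableU|by move=> x [/AOm|/BOm]|].
set m := fine (mu (A `&` B)); set M := fine (mu B).
have mE : mu (A `&` B) = m%:E by rewrite fineK// mu_sub.
have ME : mu B = M%:E by rewrite fineK// mu_sub.
have m0 : 0 < m by rewrite -lte_fin -mE.
have M0 : 0 <= M by rewrite -lee_fin -ME measure_ge0.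
pose C := CA + 2 `^ p * (CB + 2 `^ p * (CA + CB) / m * M).
have C0 : 0 < C.
  rewrite ltr_wpDr// mulr_ge0 ?powR_ge0// addr_ge0 ?(ltW CB0)// mulr_ge0// divr_ge0 ?(ltW m0)//.
  by rewrite mulr_ge0 ?powR_ge0// addr_ge0// ltW.
exists C => // u g lu wg; have [cA hcA] := hA u g lu wg; have [cB hcB] := hB u g lu wg.
exists cA; set I := pint mu p Om _ in hcA hcB *.
have I0 : (0 <= I)%E by exact: pint_ge0.
have mv t E : E `<=` Om -> measurable_fun E (fun x => u x - t).
  by move=> EOm; apply: measurable_funB => //; case: lu => + _; exact: measurable_funS.
have [Ioo|Ifin] := eqVneq I +oo%E; first by rewrite Ioo gt0_muley ?lte_fin ?leey.
have {}Ifin : I \is a fin_num by rewrite ge0_fin_numE ?ltey.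
rewrite -(fineK Ifin) in hcA hcB *; set J := fine I in hcA hcB *.
have J0 : 0 <= J by exact: fine_ge0.
have hd : `|cB - cA| `^ p <= 2 `^ p * (CA + CB) / m * J.
  rewrite mulrAC ler_pdivlMr// -lee_fin EFinM -mE -(pint_cst mu p _ (cB - cA) mAB).
  have -> : cst (cB - cA) = (fun x => u x - cA) \+ (fun x => - (u x - cB)).
    by apply/funext => x /=; ring.
  apply: le_trans (pint_add _ _ _ _ _ mAB (mv _ _ ABOm) _ (ltW p0)) _.
    exact: measurable_funN (mv _ _ ABOm).
  rewrite -mulrA EFinM lee_wpmul2l ?lee_fin ?powR_ge0// mulrDl EFinD; apply: leeD.
    by apply: le_trans (pint_subset _ _ _ _ _ mAB mA (@subIsetl _ _ _) (mv _ _ AOm)) _.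
  have -> : pint mu p (A `&` B) (fun x => - (u x - cB)) =
      pint mu p (A `&` B) (fun x => u x - cB).
    by apply: eq_integral => x _; rewrite normrN.
  by apply: le_trans (pint_subset _ _ _ _ _ mAB mB (@subIsetr _ _ _) (mv _ _ BOm)) _.
apply: (@le_trans _ _ (pint mu p A (fun x => u x - cA)%R + pint mu p B (fun x => u x - cA)%R)%E).
  by apply: pint_setU_le => //; apply: mv; move=> x [/AOm|/BOm].
rewrite -EFinM /C mulrDl EFinD; apply: leeD; first by rewrite EFinM.
have -> : (fun x => u x - cA) = (fun x => u x - cB) \+ cst (cB - cA).
  by apply/funext => x /=; ring.
apply: le_trans (pint_add _ _ _ _ _ mB (mv _ _ BOm) _ (ltW p0)) _ => //.
have -> : 2 `^ p * (CB + 2 `^ p * (CA + CB) / m * M) * J =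
    2 `^ p * (CB * J + 2 `^ p * (CA + CB) / m * M * J) by ring.
rewrite (EFinM (2 `^ p)) lee_wpmul2l ?lee_fin ?powR_ge0// EFinD; apply: leeD.
  by rewrite EFinM.
by rewrite pint_cst// ME -EFinM lee_fin mulrAC ler_wpM2r.
Qed.

Lemma cube_center_ball x e : 0 < e -> ball x e `<=` cube (x - const_mx e) (2 * e).
Proof.
move=> e0 y /(ball_rV _ _ _ e0) h i; have := h i; rewrite !mxE ltr_norml => /andP[h1 h2].
by apply/andP; split; lra.
Qed.

Lemma cube_center_sub x e : 0 < e -> cube (x - const_mx e) (2 * e) `<=` ball x (2 * e).
Proof.
move=> e0 y h; apply/ball_rV => [|i]; first by rewrite mulr_gt0.
have := h i; rewrite !mxE ltr_norml => /andP[h1 h2].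
by apply/andP; split; lra.
Qed.

(* The points with such a neighbourhood form a nonempty relatively clopen subset
   of [Om]: two overlapping sets with a Poincare inequality have one jointly. *)
Lemma poincare_set_nbhs x0 l0 : connected Om -> 0 < l0 -> cube x0 l0 `<=` Om ->
  forall x, Om x -> exists A, [/\ poincare_set A, cube x0 l0 `<=` A & nbhs x A].
Proof.
move=> cOm l00 Q0Om.
pose W := [set x : 'rV[R]_n | exists A, [/\ poincare_set A, cube x0 l0 `<=` A & nbhs x A]].
have WOm : W `<=` Om by move=> x [A [[_ AOm _] _ /nbhs_singleton]]; exact: AOm.
have Q0gt0 : (0 < mu (cube x0 l0))%E by rewrite lebesgue_cube// lte_fin exprn_gt0.
have oW : open W.
  rewrite openE => x [A [pA Q0A /nbhs_interior Ax]].
  by apply: filterS Ax => y Ay; exists A.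
(* Relative closedness: a cube around [x] inside [Om] contains a point [y] of [W], and near [y] it
   overlaps the set attached to [y] in positive measure, so the two can be glued. *)
have step x : Om x -> closure W x -> W x.
  move=> Omx clx; have /nbhs_ballP[e' /= e'0 he'] : nbhs x Om by exact: open_nbhs_nbhs.
  pose e := e' / 2; have e0 : 0 < e by rewrite divr_gt0.
  have QOm : cube (x - const_mx e) (2 * e) `<=` Om.
    apply: subset_trans (cube_center_sub x e e0) _.
    by rewrite /e mulrC divfK.
  have [y [[A [pA Q0A Ay]] yx]] := clx _ (nbhsx_ballx x e e0).
  have pQ := poincare_set_cube _ _ (mulr_gt0 (ltr0Sn R 1) e0) QOm.
  exists (A `|` cube (x - const_mx e) (2 * e)); split.
  - apply: poincare_setU => //.
    have : nbhs y (A `&` ball x e).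
      by apply: filterI => //; apply: open_nbhs_nbhs; split => //; exact: ball_open.
    move=> /nbhs_ballP[d' /= d'0 hd']; pose d := d' / 2.
    have d0 : 0 < d by rewrite divr_gt0.
    have cd0 : (0 < mu (cube (y - const_mx d) (2 * d)))%E.
      by rewrite lebesgue_cube ?lte_fin ?exprn_gt0 ?mulr_gt0.
    apply: lt_le_trans cd0 _; apply: le_measure; rewrite ?inE.
    + exact: measurable_cube.
    + apply: measurableI; first by case: pA.
      exact: measurable_cube.
    apply: subset_trans (cube_center_sub y d d0) _.
    rewrite /d mulrC divfK//; apply: subset_trans hd' _.
    by apply: setIS; exact: cube_center_ball.
  - by move=> z /Q0A; left.
  - apply: filterS (nbhsx_ballx x e e0) => z /(cube_center_ball x e e0); by right.
suff WE : W = Om by move=> x; rewrite -{1}WE.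
pose y0 := x0 + const_mx (l0 / 2).
apply: cOm.
- exists y0; exists (cube x0 l0); split => //; first exact: poincare_set_cube.
  have -> : x0 = y0 - const_mx (l0 / 2) by rewrite addrK.
  have {2}-> : l0 = 2 * (l0 / 2) by field.
  have h : 0 < l0 / 2 by rewrite divr_gt0.
  by apply: filterS (nbhsx_ballx y0 _ h); exact: cube_center_ball.
- by exists W => //; apply/seteqP; split => [x Wx|x []//]; split => //; exact: WOm.
- exists (closure W); first exact: closed_closure.
  by apply/seteqP; split => [x Wx|x [Omx /step]]; [split; [exact: WOm|exact: subset_closure]|exact].
Qed.

(** Each ball of a countable cover of [Om] lies in a set with a Poincare inequality that also
    contains the fixed cube [Q0]. Sharing [Q0], finitely many of these may be united, and continuity
    from above of the finite measure makes what they leave out small. *)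
Lemma poincare_set_exhaust (eta : R) : domain Om -> 0 < eta ->
  exists2 A, poincare_set A & (mu (Om `\` A) <= eta%:E)%E.
Proof.
move=> [[x0 Omx0] _ cOm] eta0.
have /nbhs_ballP[e /= e0 he] : nbhs x0 Om by exact: open_nbhs_nbhs.
have e20 : 0 < e / 2 by rewrite divr_gt0.
set Q0 := cube (x0 - const_mx (e / 2)) (2 * (e / 2)).
have Q0Om : Q0 `<=` Om.
  apply: subset_trans (cube_center_sub x0 _ e20) _; by rewrite mulrC divfK.
have Q0gt0 : (0 < mu Q0)%E by rewrite lebesgue_cube ?lte_fin ?exprn_gt0 ?mulr_gt0.
have ex := poincare_set_nbhs _ _ cOm (mulr_gt0 (ltr0Sn R 1) e20) Q0Om.
have pU A B : poincare_set A -> poincare_set B -> Q0 `<=` A -> Q0 `<=` B -> poincare_set (A `|` B).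
  move=> pA pB QA QB; apply: poincare_setU => //; apply: lt_le_trans Q0gt0 _.
  apply: le_measure; rewrite ?inE.
  - exact: measurable_cube.
  - by apply: measurableI; [case: pA|case: pB].
  - by rewrite subsetI.
have cover (j : {ffun 'I_n -> rat} * nat) : exists A, [/\ poincare_set A, Q0 `<=` A &
    ball (\row_i ratr (j.1 i) : 'rV[R]_n) (2 * j.2.+1%:R^-1 : R) `<=` Om ->
    ball (\row_i ratr (j.1 i) : 'rV[R]_n) (j.2.+1%:R^-1 : R) `<=` A].
  set c : 'rV[R]_n := \row_i _; set d : R := j.2.+1%:R^-1.
  have d0 : 0 < d by rewrite invr_gt0.
  have [cOm'|] := pselect (ball c (2 * d) `<=` Om); last first.
    by exists Q0; split => //; apply: poincare_set_cube => //; rewrite mulr_gt0.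
  have d20 : 0 < 2 * d by rewrite mulr_gt0.
  have [A [pA Q0A nA]] := ex c (cOm' _ (ballxx _ d20)).
  have QOm := subset_trans (cube_center_sub c d d0) cOm'.
  have pQ := poincare_set_cube _ _ d20 QOm.
  exists (A `|` cube (c - const_mx d) (2 * d)); split.
  - apply: poincare_setU => //.
    have : nbhs c (A `&` ball c d) by apply: filterI => //; exact: nbhsx_ballx.
    move=> /nbhs_ballP[t' /= t'0 ht']; pose t := t' / 2.
    have t0 : 0 < t by rewrite divr_gt0.
    have ct0 : (0 < mu (cube (c - const_mx t) (2 * t)))%E.
      by rewrite lebesgue_cube ?lte_fin ?exprn_gt0 ?mulr_gt0.
    apply: lt_le_trans ct0 _; apply: le_measure; rewrite ?inE.
    + exact: measurable_cube.
    + by apply: measurableI; [case: pA|exact: measurable_cube].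
    apply: subset_trans (cube_center_sub c t t0) _.
    rewrite /t mulrC divfK//; apply: subset_trans ht' _.
    by apply: setIS; exact: cube_center_ball.
  - by move=> z /Q0A; left.
  - by move=> _ z /(cube_center_ball c d d0); right.
have [A hA] := choice cover.
pose F i := if unpickle i is Some j then A j else Q0.
have pF i : poincare_set (F i) /\ Q0 `<=` F i.
  rewrite /F; case: unpickle => [j|]; first by have [] := hA j.
  by split => //; apply: poincare_set_cube => //; rewrite mulr_gt0.
pose S := fix S m := if m is k.+1 then S k `|` F m else F 0%N.
have pS m : poincare_set (S m) /\ Q0 `<=` S m.
  elim: m => [|m [IH1 IH2]] /=; first exact: pF.
  have [h1 h2] := pF m.+1; split; first exact: pU.
  by move=> z /IH2; left.
have mS m : measurable (S m) by have [[]] := pS m.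
have FS m : F m `<=` S m by case: m => [//|m z Fz]; right.
have SS m : S m `<=` S m.+1 by move=> z; left.
have cv : mu \o (fun m => Om `\` S m) @ \oo --> mu (\bigcap_m (Om `\` S m)).
  apply: nonincreasing_cvg_mu.
  - by apply: le_lt_trans finOm; apply: le_measure; rewrite ?inE//; exact: measurableD.
  - by move=> m; exact: measurableD.
  - by apply: bigcap_measurable => // m _; exact: measurableD.
  - by apply/nonincreasing_seqP => m; apply/subsetPset; apply: setDS; exact: SS.
have E0 : \bigcap_m (Om `\` S m) = set0.
  apply/seteqP; split => // z hz; have [Omz _] := hz 0%N I.
  move: Omz; rewrite (open_bigcup_ball Om oOm) => -[j /= hj zj].
  have [_ _ /(_ hj)/(_ _ zj) Az] := hA j.
  have [_] := hz (pickle j) I; apply; apply: FS; by rewrite /F pickleK.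
rewrite E0 measure0 in cv.
have : \forall m \near \oo, ((mu \o (fun m => Om `\` S m)) m < eta%:E)%E.
  apply: (cv (fun y => (y < eta%:E)%E)); apply: open_ereal_lt'.
  by rewrite lte_fin.
move=> [m _ /(_ m (leqnn m))/= hm]; exists (S m); first by case: (pS m).
exact: ltW.
Qed.

End poincare_sets.

(** * Chain rule and product rule for weak gradients *)

Section calculus.
Context {R : realType}.
Local Notation leb1 := (@lebesgue_measure R).
Local Notation I01 := (`[0, 1]%classic : set R).

Lemma mean_value_slope (f f' : R -> R) : (forall x : R, is_derive x (1 : R) f (f' x)) ->
  forall a b, exists2 xi, `|xi - a| <= `|b - a| & f b - f a = f' xi * (b - a).
Proof.
move=> df a b.
have cf : continuous f.
  move=> x; apply: differentiable_continuous; apply/derivable1_diffP.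
  by have [] := df x.
have wf y z : {within `[y, z], continuous f} by exact: continuous_subspaceT.
have [ab|ba] := leP a b.
  have [xi] := MVT_segment ab (fun x _ => df x) (wf a b).
  rewrite in_itv/= => /andP[h1 h2] E; exists xi => //.
  by rewrite !ger0_norm ?subr_ge0// lerB.
have [xi] := MVT_segment (ltW ba) (fun x _ => df x) (wf b a).
rewrite in_itv/= => /andP[h1 h2] E; exists xi.
  by rewrite !ler0_norm ?subr_le0// ?lerN2 ?lerB// ltW.
by rewrite -opprB E -mulrN opprB.
Qed.

(** The part of [|y|] above height [N]. An integrable function is bounded by [N] plus its excess,
    whose integral is small for large [N]; the chain rule treats the two parts differently. *)
Definition excess (N y : R) : R := Num.max (`|y| - N) 0.

Lemma excess_ge0 N y : 0 <= excess N y.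
Proof. by rewrite le_max lexx orbT. Qed.

Lemma norm_le_excess N y : `|y| <= N + excess N y.
Proof. by rewrite -lerBlDl le_max lexx. Qed.

Lemma excess_le N y : 0 <= N -> excess N y <= `|y|.
Proof. by move=> N0; rewrite ge_max lerBlDr lerDl N0 normr_ge0. Qed.

Lemma measurable_excess d (T : measurableType d) D N (w : T -> R) :
  measurable_fun D w -> measurable_fun D (fun x => excess N (w x)).
Proof.
move=> mw; apply: measurable_maxr; last exact: measurable_cst.
by apply: measurable_funB; [exact: measurableT_comp|exact: measurable_cst].
Qed.

Lemma excess_cvg0 d (T : measurableType d) (nu : {measure set T -> \bar R}) (w : T -> R) :
  nu.-integrable setT (EFin \o w) ->
  (\int[nu]_x (excess k%:R (w x))%:E @[k --> \oo] --> 0)%E.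
Proof.
move=> iw; have mw : measurable_fun setT w by apply/measurable_EFinP; exact: measurable_int iw.
have := @dominated_convergence _ _ _ nu setT measurableT
  (fun k x => (excess k%:R (w x))%:E) (cst 0%E) (fun x => `|(w x)%:E|%E).
case.
- by move=> k; apply/measurable_EFinP; exact: measurable_excess.
- by [].
- apply: aeW => x _; apply: cvg_near_cst; near=> k.
  rewrite /excess max_r// subr_le0; near: k.
  exists (Num.truncn `|w x|).+1 => // k /= hk.
  by apply: (le_trans (ltW (truncnS_gt _))); rewrite ler_nat.
- exact: integrable_abse.
- apply: aeW => x k _; rewrite /= lee_fin ger0_norm ?excess_ge0//; exact: excess_le.
by move=> _ _; rewrite integral0.
Unshelve. all: by end_near.
Qed.

(** By the mean value theorem both terms on the left are integrals of [al] against slopes of [f], at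
    [xi] and at [c t]. These slopes differ by at most 2, and by at most [L] times a distance: the
    second bound is used on the part of [al] up to height [N], the first on the excess. *)
Lemma chain_rule_segment (f f' : R -> R) (L s N a b : R) (al c : R -> R) :
  (forall x : R, is_derive x (1 : R) f (f' x)) -> (forall x, `|f' x| <= 1) ->
  (forall x y, `|f' x - f' y| <= L * `|x - y|) -> measurable_fun setT f' ->
  0 <= L -> 0 <= s -> 0 <= N ->
  leb1.-integrable I01 (EFin \o al) ->
  measurable_fun I01 c ->
  b - a = s * \int[leb1]_(t in I01) al t ->
  (`|f b - f a - s * \int[leb1]_(t in I01) (f' (c t) * al t)|%:E <=
   s%:E * \int[leb1]_(t in I01)
     (N * L * (`|b - a| + `|c t - a|) + 2 * excess N (al t))%:E)%E.
Proof.
move=> df f'1 f'L mf' L0 s0 N0 ial mc ba.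
have mal : measurable_fun I01 al.
  by apply/measurable_EFinP; exact: measurable_int ial.
have mI : @measurable _ (measurableTypeR R) I01 by exact: measurable_itv.
have mf'c : measurable_fun I01 (fun t => f' (c t)).
  exact: measurableT_comp.
have [xi xia fxi] := mean_value_slope f f' df a b.
have i1 : leb1.-integrable I01 (fun t => (f' (c t) * al t)%:E).
  apply: (@le_integrable _ _ _ leb1 I01 _ _ (EFin \o al)) => //.
    by apply/measurable_EFinP; exact: measurable_funM.
  move=> t _; by rewrite /= lee_fin normrM ler_piMl.
have i2 : leb1.-integrable I01 (fun t => (f' xi * al t)%:E).
  exact: (integrableZl mI _ ial).
have -> : f b - f a - s * \int[leb1]_(t in I01) (f' (c t) * al t) =
    s * \int[leb1]_(t in I01) (f' xi * al t - f' (c t) * al t).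
  by rewrite fxi ba RintegralB// RintegralZl//; ring.
rewrite normrM ger0_norm// EFinM lee_wpmul2l//.
have i3 := integrableB mI i2 i1.
rewrite (EFin_normr_Rintegral mI i3).
apply: le_trans (le_abse_integral _ _ _) _ => //.
  by apply/measurable_EFinP; apply: measurable_funB; exact: measurable_funM.
apply: ge0_le_integral => //.
- apply/measurable_EFinP; apply: measurableT_comp => //.
  by apply: measurable_funB; exact: measurable_funM.
- apply/measurable_EFinP; apply: measurable_funD.
    apply: measurable_funM => //; apply: measurable_funD => //.
    by apply: measurableT_comp => //; exact: measurable_funB.
  by apply: measurable_funM => //; exact: measurable_excess.
move=> t _; rewrite lee_fin -mulrBl normrM.
have E0 := excess_ge0 N (al t).
have d2 : `|f' xi - f' (c t)| <= 2.
  by apply: le_trans (ler_normB _ _) _; rewrite -[2]/(1 + 1) lerD.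
have dL : `|f' xi - f' (c t)| <= L * (`|b - a| + `|c t - a|).
  apply: le_trans (f'L _ _) _; rewrite ler_wpM2l//.
  have -> : xi - c t = (xi - a) - (c t - a) by ring.
  by apply: le_trans (ler_normB _ _) _; rewrite lerD2r.
apply: (@le_trans _ _ (`|f' xi - f' (c t)| * (N + excess N (al t)))).
  by rewrite ler_wpM2l// norm_le_excess.
rewrite mulrDr; apply: lerD; last by rewrite ler_wpM2r.
by rewrite mulrC -mulrA ler_wpM2l.
Qed.

End calculus.

Section smooth_lipschitz.
Context {R : realType} {n : nat}.
Local Notation leb1 := (@lebesgue_measure R).
Local Notation I01 := (`[0, 1]%classic : set R).
Implicit Types (phi : 'rV[R]_n -> R) (h x : 'rV[R]_n).

Lemma dir_partialZ s h phi x : dir_partial (s *: h) phi x = s * dir_partial h phi x.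
Proof. by rewrite /dir_partial mulr_sumr; apply: eq_bigr => i _; rewrite mxE mulrA. Qed.

Lemma smooth_increment phi x h s : smooth phi ->
  phi (x + s *: h) - phi x = s * \int[leb1]_(t in I01) dir_partial h phi (x + t *: (s *: h)).
Proof.
move=> sphi; have := smooth_FTC phi x (s *: h) sphi.
have ci : leb1.-integrable I01 (EFin \o (fun t => dir_partial h phi (x + t *: (s *: h)))).
  apply: continuous_compact_integrable; first exact: segment_compact.
  apply: continuous_subspaceT; apply: continuous_line.
  by apply: smooth_continuous; exact: smooth_dir_partial.
rewrite -RintegralZl// /Rintegral => /(congr1 fine) /= <-.
by congr fine; apply: eq_integral => t _; rewrite dir_partialZ.
Qed.

Lemma Rintegral01_le (w : R -> R) M : measurable_fun I01 w ->
  (forall t, 0 <= t <= 1 -> `|w t| <= M) -> `|\int[leb1]_(t in I01) w t| <= M.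
Proof.
move=> mw wM; have mI : measurable I01 by exact: measurable_itv.
have m1 : leb1 I01 = 1%:E by rewrite /= lebesgue_measure_itv/= lte_fin ltr01 sube0.
have iw : leb1.-integrable I01 (EFin \o w).
  apply: measurable_bounded_integrable => //; first by rewrite /= lebesgue_measure_itv/= lte_fin ltr01 sube0 ltry.
  exists M; split; first exact: num_real.
  by move=> z Mz t; rewrite /= in_itv/= => t01; apply: le_trans (wM t t01) (ltW Mz).
rewrite -lee_fin EFin_normr_Rintegral//.
apply: le_trans (le_abse_integral _ _ _) _ => //; first exact/measurable_EFinP.
apply: (@le_trans _ _ (\int[leb1]_(t in I01) M%:E)%E); last by rewrite integral01_cst.
apply: ge0_le_integral => //.
by apply/measurable_EFinP; exact: measurableT_comp.
Qed.

Lemma smooth_lipschitz phi h M x s : smooth phi ->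
  (forall y, `|dir_partial h phi y| <= M) -> `|phi (x + s *: h) - phi x| <= `|s| * M.
Proof.
move=> sphi hM; rewrite smooth_increment// normrM ler_wpM2l//.
apply: Rintegral01_le => [|t _]; last exact: hM.
apply: measurable_funTS; apply: continuous_measurable_fun.
by apply: continuous_line; apply: smooth_continuous; exact: smooth_dir_partial.
Qed.

Lemma smooth_taylor1 phi h M x s : smooth phi ->
  (forall y, `|dir_partial h (dir_partial h phi) y| <= M) ->
  `|phi (x + s *: h) - phi x - s * dir_partial h phi x| <= s ^+ 2 * M.
Proof.
move=> sphi hM; have sd := smooth_dir_partial h phi sphi.
have M0 : 0 <= M by apply: le_trans (hM 0).
have mI : measurable I01 by exact: measurable_itv.
have ci : leb1.-integrable I01 (EFin \o (fun t => dir_partial h phi (x + t *: (s *: h)))).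
  apply: continuous_compact_integrable; first exact: segment_compact.
  by apply: continuous_subspaceT; apply: continuous_line; exact: smooth_continuous.
have c1 : \int[leb1]_(t in I01) dir_partial h phi x = dir_partial h phi x.
  rewrite Rintegral_cst//.
  by rewrite [X in _ * fine X](_ : _ = 1%:E) ?mulr1//= lebesgue_measure_itv/= lte_fin ltr01 sube0.
have ic : leb1.-integrable I01 (EFin \o (fun=> dir_partial h phi x)).
  by apply: continuous_compact_integrable; [exact: segment_compact|apply: continuous_subspaceT; exact: cst_continuous].
rewrite smooth_increment// -c1 -mulrBr -RintegralB// normrM -(real_normK (num_real s)) expr2 -mulrA ler_wpM2l//.
apply: Rintegral01_le => [|t /andP[t0 t1]].
  apply: measurable_funTS; apply: continuous_measurable_fun.
  move=> t; apply: cvgB; last exact: cvg_cst.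
  by apply: continuous_line; exact: smooth_continuous.
rewrite scalerA; apply: le_trans (smooth_lipschitz _ h M x (t * s) sd hM) _.
by rewrite normrM ler_wpM2r// ler_piMl// ger0_norm.
Qed.

End smooth_lipschitz.

Section chain_rule.
Context {R : realType} {n : nat}.
Local Notation mu := (lebesgue_rV R n).
Local Notation leb1 := (@lebesgue_measure R).
Local Notation I01 := (`[0, 1]%classic : set R).
Implicit Types (phi w : 'rV[R]_n -> R) (h k x : 'rV[R]_n).

Lemma ge0_integral_line (w : 'rV[R]_n -> \bar R) k : measurable_fun setT w ->
  (forall x, 0 <= w x)%E ->
  (\int[mu]_x \int[leb1]_(t in I01) w (x + t *: k)%R = \int[mu]_x w x)%E.
Proof.
move=> mw w0; rewrite (tonelli_rV01 (fun x t => w (x + t *: k))) => //; last first.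
  exact: measurableT_comp mw (measurable_line k).
rewrite (eq_integral (fun=> \int[mu]_x w x)%E); first by rewrite integral01_cst.
by move=> t _; rewrite (ge0_integral_shift _ w).
Qed.

Lemma Rintegral_line w k : mu.-integrable setT (EFin \o w) ->
  \int[mu]_x \int[leb1]_(t in I01) w (x + t *: k) = \int[mu]_x w x.
Proof.
move=> iw; have mw : measurable_fun setT w by apply/measurable_EFinP; exact: measurable_int iw.
transitivity (fine (\int[mu]_x \int[leb1]_(t in I01) (w (x + t *: k))%:E)%E); last first.
  rewrite (fubini_rV01 (fun x t => (w (x + t *: k))%:E)); last 2 first.
  - by apply/measurable_EFinP; exact: measurable_comp_line.
  - exact: integral_line_fin.
  rewrite (eq_integral (fun=> \int[mu]_x (w x)%:E)%E); first by rewrite integral01_cst.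
  move=> t _; rewrite -[RHS](integral_shift (t *: k) (EFin \o w))//.
  exact/measurable_EFinP.
rewrite /Rintegral; congr fine; apply: ae_eq_integral => //.
- apply/measurable_EFinP; apply: (measurableT_comp (fine_measurable measurableT)).
  apply: (measurable_integral01 (fun x t => (w (x + t *: k))%:E)).
  by apply/measurable_EFinP; exact: measurable_comp_line.
- apply: (measurable_integral01 (fun x t => (w (x + t *: k))%:E)).
  by apply/measurable_EFinP; exact: measurable_comp_line.
have := ae_integrable01 (fun x t => w (x + t *: k)) (measurable_comp_line _ k mw) (integral_line_fin _ k iw).
by apply: filterS => x ix _; rewrite fineK//; exact: integrable_fin_num ix.
Qed.

(** Translating by [t k] moves the average from [w] to [phi]: the difference is the integral of
    [w (x + t k) * (phi x - phi (x + t k))], and [phi] varies by at most [m] along the segment. *)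
Lemma line_average_test w phi k m : mu.-integrable setT (EFin \o w) ->
  measurable_fun setT phi -> (exists M, forall x, `|phi x| <= M) ->
  (forall x t, 0 <= t <= 1 -> `|phi (x + t *: k) - phi x| <= m) ->
  `|\int[mu]_x ((\int[leb1]_(t in I01) w (x + t *: k)) * phi x) - \int[mu]_x (w x * phi x)|
  <= m * \int[mu]_x `|w x|.
Proof.
move=> iw mphi [M hM] hm.
have mw : measurable_fun setT w by apply/measurable_EFinP; exact: measurable_int iw.
have iwp := integrable_mul_bounded w phi M iw mphi hM.
have mwp : measurable_fun setT (fun x => w x * phi x) by exact: measurable_funM.
have iC := integrable_line_Rintegral w k iw.
have iCp := integrable_mul_bounded _ phi M iC mphi hM.
have iD := integrable_line_Rintegral (fun x => w x * phi x) k iwp.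
rewrite -(Rintegral_line (fun x => w x * phi x) k)// -RintegralB//.
have iB := integrableB measurableT iCp iD.
have iN := integrable_abse iw.
rewrite -RintegralZl//.
rewrite -lee_fin EFin_normr_Rintegral//.
have m0 : 0 <= m by apply: le_trans (hm 0 0 _); rewrite ?lexx ?ler01.
have -> : (\int[mu]_x (m * `|w x|))%:E = (\int[mu]_x (m%:E * `|(w x)%:E|))%E.
  rewrite /Rintegral fineK//; apply: integrable_fin_num => //.
  exact: (integrableZl measurableT m iN).
apply: le_trans (le_abse_integral _ _ _) _ => //; first exact: measurable_int iB.
rewrite ge0_integralZl//; last by apply/measurable_EFinP; exact: measurableT_comp.
rewrite -(ge0_integral_line (fun x => `|(w x)%:E|%E) k)//; last first.
  by apply/measurable_EFinP; exact: measurableT_comp.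
have mI : measurable_fun setT (fun x => \int[leb1]_(t in I01) `|(w (x + t *: k))%:E|)%E.
  apply: (measurable_integral01 (fun x t => `|(w (x + t *: k))%:E|%E)).
  apply/measurable_EFinP; apply: measurableT_comp => //; exact: measurable_comp_line.
rewrite -ge0_integralZl//; last by move=> x _; exact: integral_ge0.
apply: ae_ge0_le_integral => //.
- by apply: measurableT_comp => //; exact: measurable_int iB.
- by move=> x _; rewrite mule_ge0 ?integral_ge0.
- exact: measurable_funeM.
have h1 := ae_integrable01 (fun x t => w (x + t *: k)) (measurable_comp_line _ k mw) (integral_line_fin _ k iw).
have h2 := ae_integrable01 (fun x t => w (x + t *: k) * phi (x + t *: k)) (measurable_comp_line _ k mwp) (integral_line_fin _ k iwp).
apply: filterS2 h1 h2 => x h1 h2 _.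
have mI01 : @measurable _ (measurableTypeR R) I01 by exact: measurable_itv.
have h3 := integrableZl mI01 (phi x) h1.
have -> : (\int[leb1]_(t in I01) w (x + t *: k)) * phi x = \int[leb1]_(t in I01) (phi x * w (x + t *: k)).
  by rewrite RintegralZl// mulrC.
rewrite -RintegralB//.
have h4 := integrableB mI01 h3 h2.
rewrite abse_EFin (EFin_normr_Rintegral mI01 h4).
apply: le_trans (le_abse_integral _ _ _) _ => //; first exact: measurable_int h4.
rewrite -ge0_integralZl//; last first.
  by apply: measurableT_comp => //; exact: measurable_int h1.
apply: ge0_le_integral => //.
- by apply: measurableT_comp => //; exact: measurable_int h4.
- by apply: measurable_funeM; apply: measurableT_comp => //; exact: measurable_int h1.
move=> t; rewrite /= in_itv/= => t01; rewrite lee_fin mulrC -mulrBr normrM mulrC ler_wpM2r//.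
by rewrite distrC; exact: hm.
Qed.

Context (f f' : R -> R) (L : R).
Context (df : forall x : R, is_derive x (1 : R) f (f' x)) (f'1 : forall y, `|f' y| <= 1)
  (f'L : forall y z, `|f' y - f' z| <= L * `|y - z|) (L0 : 0 <= L) (f0 : f 0 = 0).

Let mf' : measurable_fun setT f'.
Proof.
apply: continuous_measurable_fun => x; apply/cvgrPdist_le => e e0.
have L1 : 0 < L + 1 by rewrite ltr_wpDl.
exists (e / (L + 1)) => [|y /= /ltW]; first exact: divr_gt0.
rewrite ler_pdivlMr// mulrC => xy; apply: le_trans (f'L _ _) (le_trans _ xy).
by rewrite ler_wpM2r// lerDl.
Qed.

Let mf : measurable_fun setT f.
Proof.
apply: continuous_measurable_fun => x; apply: differentiable_continuous; apply/derivable1_diffP.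
by have [] := df x.
Qed.

Lemma chain_fun_le a : `|f a| <= `|a|.
Proof.
have [xi _] := mean_value_slope f f' df 0 a; rewrite f0 !subr0 => ->.
by rewrite normrM ler_piMl.
Qed.

Context (K : set 'rV[R]_n) (h : 'rV[R]_n) (v ga : 'rV[R]_n -> R).
Context (mK : measurable K) (iv : mu.-integrable setT (EFin \o v))
  (ig : mu.-integrable setT (EFin \o ga)).
(** The line identity is assumed only on [K], later the support of a test function, but for every
    step [s h] with [s] in [[0, 1]], because the difference quotients let [s] tend to zero. *)
Context (line : forall s, 0 <= s <= 1 -> {ae mu, forall x, K x ->
  v (x + s *: h) - v x = s * \int[leb1]_(t in I01) ga (x + t *: (s *: h))}).

Let mv : measurable_fun setT v.
Proof. by apply/measurable_EFinP; exact: measurable_int iv. Qed.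
Let mg : measurable_fun setT ga.
Proof. by apply/measurable_EFinP; exact: measurable_int ig. Qed.
Let mI01 : @measurable _ (measurableTypeR R) I01. Proof. exact: measurable_itv. Qed.

Let norm_g := (\int[mu]_x `|ga x|%:E)%E.

Lemma integral_increment_le s : 0 <= s <= 1 ->
  (\int[mu]_(x in K) `|v (x + s *: h) - v x|%:E <= s%:E * norm_g)%E.
Proof.
move=> s01; have s0 : 0 <= s by case/andP: s01.
have mag : measurable_fun setT (fun x => `|ga x|%:E : \bar R).
  by apply/measurable_EFinP; exact: measurableT_comp.
have mI : measurable_fun setT (fun x => \int[leb1]_(t in I01) `|ga (x + t *: (s *: h))|%:E)%E.
  apply: (measurable_integral01 (fun x t => `|ga (x + t *: (s *: h))|%:E%E)).
  apply/measurable_EFinP; apply: measurableT_comp => //; exact: measurable_comp_line.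
rewrite /norm_g -(ge0_integral_line (fun x => `|ga x|%:E) (s *: h))//.
rewrite -ge0_integralZl ?lee_fin//; last by move=> x _; exact: integral_ge0.
apply: (@le_trans _ _ (\int[mu]_(x in K) (s%:E * \int[leb1]_(t in I01) `|ga (x + t *: (s *: h))|%:E))%E); last first.
  apply: ge0_subset_integral => //; first exact: measurable_funeM.
  by move=> x _; rewrite mule_ge0 ?lee_fin ?integral_ge0.
apply: ae_ge0_le_integral => //.
- apply: measurable_funTS; apply/measurable_EFinP; apply: measurableT_comp => //.
  by apply: measurable_funB => //; exact: measurableT_comp mv (measurable_shift _).
- by move=> x _; rewrite mule_ge0 ?lee_fin ?integral_ge0.
- by apply: measurable_funTS; exact: measurable_funeM.
have h1 := ae_integrable01 (fun x t => ga (x + t *: (s *: h))) (measurable_comp_line _ (s *: h) mg) (integral_line_fin _ (s *: h) ig).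
apply: filterS2 h1 (line s s01) => x h1 h2 Kx; rewrite h2// normrM ger0_norm// EFinM lee_wpmul2l ?lee_fin//.
rewrite (EFin_normr_Rintegral mI01 h1).
by apply: le_abse_integral => //; exact: measurable_int h1.
Qed.

Let Ga x := f' (v x) * ga x.

Let iGa : mu.-integrable setT (EFin \o Ga).
Proof.
rewrite /Ga (_ : EFin \o _ = fun x => (ga x * (f' \o v) x)%:E); last first.
  by apply/funext => x /=; rewrite mulrC.
apply: (integrable_mul_bounded ga (f' \o v) 1 ig); first exact: measurableT_comp.
by move=> x; exact: f'1.
Qed.

Let iF : mu.-integrable setT (EFin \o (f \o v)).
Proof.
apply: (le_integrable measurableT _ _ iv).
  by apply/measurable_EFinP; exact: measurableT_comp.
by move=> x _; rewrite /= lee_fin; exact: chain_fun_le.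
Qed.

(** Increments of [v] over the step [s h] are of order [s] in [L^1], so [chain_rule_segment]
    integrates to [s] times a quantity that vanishes when first [s] tends to 0 and then [N] to
    infinity. *)
Lemma integral_chain_defect_le s N : 0 <= s <= 1 -> 0 <= N ->
  (\int[mu]_(x in K) `|f (v (x + s *: h)) - f (v x) -
      s * \int[leb1]_(t in I01) Ga (x + t *: (s *: h))|%:E <=
   s%:E * ((N * L)%:E * ((2 * s)%:E * norm_g) + 2%:E * \int[mu]_x (excess N (ga x))%:E))%E.
Proof.
move=> s01 N0; have s0 : 0 <= s by case/andP: s01.
have NL0 : 0 <= N * L by exact: mulr_ge0.
have ng0 : (0 <= norm_g)%E by exact: integral_ge0.
pose j x t := N * L * (`|v (x + s *: h) - v x| + `|v (x + t *: (s *: h)) - v x|) +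
  2 * excess N (ga (x + t *: (s *: h))).
have j0 x t : 0 <= j x t by rewrite addr_ge0 ?mulr_ge0 ?addr_ge0 ?excess_ge0.
have mvh k : measurable_fun setT (fun x => v (x + k)).
  exact: measurableT_comp mv (measurable_shift _).
have mj : measurable_fun setT (fun z : 'rV[R]_n * measurableTypeR R => j z.1 z.2).
  apply: measurable_funD; last first.
    by apply: measurable_funM => //; apply: measurable_excess; exact: measurable_comp_line.
  apply: measurable_funM => //; apply: measurable_funD; apply: measurableT_comp => //.
    apply: measurable_funB; first exact: (measurableT_comp (mvh _) measurable_fst).
    exact: (measurableT_comp mv measurable_fst).
  apply: measurable_funB; first exact: measurable_comp_line.
  exact: (measurableT_comp mv measurable_fst).
have mJ : measurable_fun setT (fun x => \int[leb1]_(t in I01) (j x t)%:E)%E.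
  by apply: (measurable_integral01 (fun x t => (j x t)%:E)); exact/measurable_EFinP.
apply: (@le_trans _ _ (\int[mu]_(x in K) (s%:E * \int[leb1]_(t in I01) (j x t)%:E))%E).
  apply: ae_ge0_le_integral => //.
  - apply: measurable_funTS; apply/measurable_EFinP; apply: measurableT_comp => //.
    apply: measurable_funB.
      apply: measurable_funB; first exact: (measurableT_comp mf (mvh _)).
      exact: measurableT_comp.
    apply: measurable_funM => //; apply/measurable_EFinP.
    exact: measurable_int (integrable_line_Rintegral Ga (s *: h) iGa).
  - by move=> x _; rewrite mule_ge0 ?lee_fin ?integral_ge0// => t _; rewrite lee_fin.
  - by apply: measurable_funTS; exact: measurable_funeM.
  have h1 := ae_integrable01 (fun x t => ga (x + t *: (s *: h))) (measurable_comp_line _ (s *: h) mg) (integral_line_fin _ (s *: h) ig).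
  apply: filterS2 h1 (line s s01) => x h1 h2 Kx.
  apply: (chain_rule_segment f f' L s N (v x) (v (x + s *: h))
    (fun t => ga (x + t *: (s *: h))) (fun t => v (x + t *: (s *: h)))) => //; last exact: h2.
  apply: measurable_funTS; apply: measurableT_comp mv _.
  apply: measurable_fun_coordP => i.
  rewrite (_ : (fun _ => _) = fun t => x ord0 i + t * (s *: h) ord0 i).
    by apply: measurable_funD => //; exact: measurable_funM.
  by apply/funext => t; rewrite !mxE.
rewrite ge0_integralZl//; last 2 first.
- exact: measurable_funTS.
- by move=> x _; apply: integral_ge0 => t _; rewrite lee_fin.
rewrite lee_wpmul2l ?lee_fin//.
have -> : (\int[mu]_(x in K) \int[leb1]_(t in I01) (j x t)%:E =
    \int[mu]_x \int[leb1]_(t in I01) (\1_K x * j x t)%:E)%E.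
  rewrite integral_mkcond; apply: eq_integral => x _; rewrite patchE indicE.
  case: ifPn => _; first by apply: eq_integral => t _; rewrite mul1r.
  by rewrite integral0_eq// => t _; rewrite mul0r.
rewrite (tonelli_rV01 (fun x t => (\1_K x * j x t)%:E)); last 2 first.
- apply/measurable_EFinP; apply: measurable_funM => //.
  exact: (measurableT_comp (measurable_indic mK) measurable_fst).
- by move=> x t; rewrite lee_fin mulr_ge0.
rewrite -[leRHS]integral01_cst; apply: ge0_le_integral => //.
- by move=> t _; apply: integral_ge0 => x _; rewrite lee_fin mulr_ge0.
- apply: measurable_funTS.
  have mj' : measurable_fun setT (fun z : 'rV[R]_n * measurableTypeR R => (\1_K z.1 * j z.1 z.2)%:E).
    apply/measurable_EFinP; apply: measurable_funM => //.
    exact: (measurableT_comp (measurable_indic mK) measurable_fst).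
  have j0' (z : 'rV[R]_n * measurableTypeR R) : (0 <= (\1_K z.1 * j z.1 z.2)%:E)%E.
    by rewrite lee_fin mulr_ge0.
  exact: (@measurable_fun_fubini_tonelli_G _ _ _ _ _ (@leb R n) _ mj' j0').
move=> t; rewrite /= in_itv/= => /andP[t0 t1].
have ts01 : 0 <= t * s <= 1 by rewrite mulr_ge0//= mulr_ile1//; case/andP: s01.
have -> : (\int[mu]_x (\1_K x * j x t)%:E = \int[mu]_(x in K) (j x t)%:E)%E.
  rewrite [RHS]integral_mkcond; apply: eq_integral => x _; rewrite patchE indicE.
  by case: ifPn => _; rewrite ?mul1r ?mul0r.
rewrite /j; under eq_integral do rewrite EFinD EFinM EFinD (EFinM 2).
have m1 k : measurable_fun K (fun x => `|v (x + k) - v x|%:E : \bar R).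
  apply: measurable_funTS; apply/measurable_EFinP; apply: measurableT_comp => //.
  exact: measurable_funB.
have m2 : measurable_fun setT (fun x => (excess N (ga x))%:E).
  by apply/measurable_EFinP; exact: measurable_excess.
have m3 : measurable_fun setT (fun x => (excess N (ga (x + t *: (s *: h))))%:E).
  by apply/measurable_EFinP; apply: measurable_excess; exact: (measurableT_comp mg (measurable_shift _)).
rewrite ge0_integralD//; last 4 first.
- by move=> x _; rewrite mule_ge0 ?lee_fin// adde_ge0.
- by apply: measurable_funeM; exact: emeasurable_funD.
- by move=> x _; rewrite mule_ge0 ?lee_fin ?excess_ge0.
- by apply: measurable_funTS; exact: measurable_funeM.
rewrite ge0_integralZl//; last 2 first.
- exact: emeasurable_funD.
- by move=> x _; rewrite adde_ge0.
rewrite ge0_integralZl ?lee_fin//; last 2 first.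
- exact: measurable_funTS.
- by move=> x _; rewrite lee_fin excess_ge0.
rewrite ge0_integralD//; apply: leeD; rewrite lee_wpmul2l ?lee_fin//.
  rewrite mulr_natl mulr2n EFinD ge0_muleDl ?lee_fin//; apply: leeD.
    exact: integral_increment_le.
  rewrite scalerA; apply: le_trans (integral_increment_le _ ts01) _.
  by rewrite lee_wpmul2r// lee_fin ler_piMl.
apply: (@le_trans _ _ (\int[mu]_x (excess N (ga (x + t *: (s *: h))))%:E)%E).
  by apply: ge0_subset_integral => // x _; rewrite lee_fin excess_ge0.
rewrite (ge0_integral_shift _ (fun x => (excess N (ga x))%:E))//.
by move=> x; rewrite lee_fin excess_ge0.
Qed.

Context (phi : 'rV[R]_n -> R) (tphi : test_function setT phi)
  (phiK : forall x, ~ K x -> phi x = 0).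

(* Testing against the difference quotients of step [s] along [h] and splitting
   the gradient at height [N]. *)
Lemma chain_rule_defect : exists C1 C2 C3 : R, forall s N, 0 < s -> s <= 1 -> 0 <= N ->
  `|\int[mu]_x (f (v x) * dir_partial h phi x) + \int[mu]_x (Ga x * phi x)| <=
  s * (C1 + C2 * N) + C3 * \int[mu]_x excess N (ga x).
Proof.
have [sphi _ _] := tphi.
have [M M0 hM] := test_function_bounded _ _ tphi.
have td := test_function_dir_partial setT h phi tphi.
have [M1 M10 hM1] := test_function_bounded _ _ td.
have [M2 M20 hM2] := test_function_bounded _ _ (test_function_dir_partial setT h _ td).
have mphi := test_function_measurable _ _ tphi.
have mdphi := test_function_measurable _ _ td.
pose nF := \int[mu]_x `|f (v x)|; pose nG := \int[mu]_x `|Ga x|; pose ng := \int[mu]_x `|ga x|.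
exists (M2 * nF + M1 * nG), (2 * M * L * ng), (2 * M) => s N s0 s1 N0.
have s01 : 0 <= s <= 1 by rewrite (ltW s0).
set Lam := _ + _.
have iFp w B : measurable_fun setT w -> (forall x, `|w x| <= B) ->
    mu.-integrable setT (fun x => (f (v x) * w x)%:E).
  by move=> mw wB; exact: (integrable_mul_bounded (f \o v) w B iF).
have mphis : measurable_fun setT (fun x => phi (x - s *: h)).
  exact: measurableT_comp mphi (measurable_shift _).
have i1 := iFp _ _ mphis (fun x => hM (x - s *: h)).
have i2 := iFp _ _ mphi hM.
have i3 := iFp _ _ mdphi hM1.
have iC := integrable_line_Rintegral Ga (s *: h) iGa.
have iCp := integrable_mul_bounded _ phi M iC mphi hM.
pose C x := \int[leb1]_(t in I01) Ga (x + t *: (s *: h)).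
have iFs : mu.-integrable setT (fun x => (f (v (x + s *: h)))%:E).
  exact: (integrable_shift (s *: h) _ iF).
have iFsp := integrable_mul_bounded (fun x => f (v (x + s *: h))) phi M iFs mphi hM.
(* Three kinds of error: [T1] carries the Taylor remainder of [phi], [T2] the failure of the chain
   rule along segments, [T3] the replacement of [Ga] by its average over a segment. *)
pose T1 := \int[mu]_x (f (v x) * (phi (x - s *: h) - phi x + s * dir_partial h phi x)).
pose T2 := \int[mu]_x ((f (v (x + s *: h)) - f (v x) - s * C x) * phi x).
pose T3 := \int[mu]_x (C x * phi x) - \int[mu]_x (Ga x * phi x).
have i2s := integrableZl measurableT s i3.
have isC := integrableZl measurableT s iC.
have sLam : s * Lam = T1 - T2 - s * T3.
  have E1 : T1 = \int[mu]_x (f (v x) * phi (x - s *: h)) - \int[mu]_x (f (v x) * phi x)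
      + s * \int[mu]_x (f (v x) * dir_partial h phi x).
    rewrite /T1 -RintegralB// -RintegralZl// -RintegralD//.
      by apply: eq_Rintegral => x _; ring.
    exact: (integrableB measurableT i1 i2).
  have E2 : T2 = \int[mu]_x (f (v (x + s *: h)) * phi x) - \int[mu]_x (f (v x) * phi x)
      - s * \int[mu]_x (C x * phi x).
    rewrite /T2 -RintegralB// -RintegralZl// -RintegralB//.
    - by apply: eq_Rintegral => x _; ring.
    - exact: (integrableB measurableT iFsp i2).
    - exact: (integrableZl measurableT s iCp).
  have E3 : \int[mu]_x (f (v (x + s *: h)) * phi x) = \int[mu]_x (f (v x) * phi (x - s *: h)).
    rewrite /Rintegral; congr fine.
    rewrite -(integral_shift (s *: h) (fun x => (f (v x) * phi (x - s *: h))%:E)).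
      by apply: eq_integral => x _; rewrite addrK.
    exact: measurable_int i1.
  by rewrite E1 E2 E3 /T3 /Lam; ring.
have b1 : `|T1| <= s ^+ 2 * M2 * nF.
  have dk x : `|phi (x - s *: h) - phi x + s * dir_partial h phi x| <= s ^+ 2 * M2.
    have := smooth_taylor1 phi h M2 x (- s) sphi hM2.
    by rewrite scaleNr mulNr opprK sqrrN.
  have iT1 : mu.-integrable setT (fun x => (f (v x) * (phi (x - s *: h) - phi x + s * dir_partial h phi x))%:E).
    apply: (iFp _ (s ^+ 2 * M2)) => //; apply: measurable_funD; last exact: measurable_funM.
    exact: measurable_funB.
  apply: le_trans (le_normr_Rintegral measurableT iT1) _.
  rewrite /nF -RintegralZl//; last exact: integrable_abse iF.
  apply: le_Rintegral => //.
  - exact: integrable_abse iT1.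
  - exact: (integrableZl measurableT _ (integrable_abse iF)).
  by move=> x _; rewrite normrM mulrC ler_wpM2r.
have b3 : `|T3| <= s * M1 * nG.
  apply: line_average_test => //; first by exists M.
  move=> x t /andP[t0 t1]; rewrite scalerA.
  apply: le_trans (smooth_lipschitz phi h M1 x (t * s) sphi hM1) _.
  by rewrite ler_wpM2r// normrM !ger0_norm// ?(ltW s0)// ler_piMl// ltW.
have b2 : `|T2| <= M * (s * (N * L * (2 * s * ng) + 2 * \int[mu]_x excess N (ga x))).
  have iT2 : mu.-integrable setT (fun x => ((f (v (x + s *: h)) - f (v x) - s * C x) * phi x)%:E).
    apply: (integrable_mul_bounded _ phi M) => //.
    exact: (integrableB measurableT (integrableB measurableT iFs iF) isC).
  have exN : (\int[mu]_x excess N (ga x))%:E = (\int[mu]_x (excess N (ga x))%:E)%E.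
    rewrite /Rintegral fineK//; apply: integrable_fin_num => //.
    apply: (le_integrable measurableT _ _ ig); first by apply/measurable_EFinP; exact: measurable_excess.
    by move=> x _; rewrite /= lee_fin ger0_norm ?excess_ge0// excess_le.
  have ngE : ng%:E = norm_g.
    by rewrite /ng /Rintegral fineK//; apply: integrable_fin_num => //; exact: integrable_abse ig.
  rewrite -lee_fin EFin_normr_Rintegral//.
  apply: le_trans (le_abse_integral _ _ _) _ => //; first exact: measurable_int iT2.
  have -> : (M * (s * (N * L * (2 * s * ng) + 2 * \int[mu]_x excess N (ga x))))%:E =
      (M%:E * (s%:E * ((N * L)%:E * ((2 * s)%:E * norm_g) + 2%:E * \int[mu]_x (excess N (ga x))%:E)))%E.
    by rewrite -ngE -exN -(EFinM (2 * s)) -(EFinM (N * L)) -(EFinM 2) -EFinD -(EFinM s) -(EFinM M).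
  apply: le_trans (lee_wpmul2l _ (integral_chain_defect_le s N s01 N0)); last by rewrite lee_fin.
  rewrite -ge0_integralZl//; last first.
    apply: measurable_funTS; apply/measurable_EFinP; apply: measurableT_comp => //.
    apply/measurable_EFinP; exact: measurable_int (integrableB measurableT (integrableB measurableT iFs iF) isC).
  rewrite [leRHS]integral_mkcond; apply: ge0_le_integral => //.
  - by apply: measurableT_comp => //; exact: measurable_int iT2.
  - apply/(measurable_restrictT _ mK); apply: measurable_funTS; apply: measurable_funeM.
    apply/measurable_EFinP; apply: measurableT_comp => //.
    apply/measurable_EFinP; exact: measurable_int (integrableB measurableT (integrableB measurableT iFs iF) isC).
  move=> x _; rewrite patchE; case: ifPn => [_|xK].
    by rewrite -EFinM lee_fin normrM mulrC ler_wpM2r.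
  have nKx : ~ K x by move=> Kx; move: xK; rewrite mem_set.
  by rewrite (phiK x nKx) mulr0 abse_EFin normr0.
have : `|s * Lam| <= s * (s * (M2 * nF + M1 * nG + 2 * M * L * ng * N) + 2 * M * \int[mu]_x excess N (ga x)).
  rewrite sLam; apply: le_trans (ler_normB _ _) _.
  apply: (@le_trans _ _ ((s ^+ 2 * M2 * nF + M * (s * (N * L * (2 * s * ng) + 2 * \int[mu]_x excess N (ga x)))) + s * (s * M1 * nG))).
    apply: lerD; last by rewrite normrM ger0_norm ?(ltW s0)// ler_wpM2l// ltW.
    by apply: le_trans (ler_normB _ _) _; exact: lerD.
  by rewrite le_eqVlt; apply/orP; left; apply/eqP; ring.
by rewrite normrM ger0_norm ?(ltW s0)// ler_pM2l.
Qed.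

(** For each height [N] the step [s] is taken so small that the first error term of
    [chain_rule_defect] disappears; then [N] tends to infinity and the excess term vanishes too. *)
Lemma chain_rule_integral :
  \int[mu]_x (f (v x) * dir_partial h phi x) = - \int[mu]_x (f' (v x) * ga x * phi x).
Proof.
have [C1 [C2 [C3 H]]] := chain_rule_defect.
apply/eqP; rewrite -addr_eq0 -normr_le0; set X := `|_| in H *.
have h1 (k : nat) : X <= C3 * \int[mu]_x excess k%:R (ga x).
  apply/ler_addgt0Pr => e e0.
  pose B := `|C1 + C2 * k%:R| + 1.
  have B0 : 0 < B by rewrite ltr_wpDl.
  pose s := Num.min 1 (e / B).
  have s0 : 0 < s by rewrite lt_min ltr01 divr_gt0.
  apply: le_trans (H s k%:R s0 _ _) _; rewrite ?ge_min ?lexx// addrC lerD2l.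
  apply: (@le_trans _ _ (s * B)).
    by rewrite ler_wpM2l ?(ltW s0)// (le_trans (ler_norm _))// lerDl.
  by rewrite -ler_pdivlMr// ge_min lexx orbT.
have cv : C3 * \int[mu]_x excess k%:R (ga x) @[k --> \oo] --> C3 * 0.
  apply: cvgM; first exact: cvg_cst.
  exact: (fine_cvg (excess_cvg0 _ _ mu ga ig)).
rewrite mulr0 in cv; rewrite -(cvg_lim _ cv)//; apply: limr_ge; first by apply/cvg_ex; exists 0.
exact: nearW.
Qed.

End chain_rule.

Section weak_gradient_chain.
Context {R : realType} {n : nat}.
Local Notation mu := (lebesgue_rV R n).
Local Notation leb1 := (@lebesgue_measure R).
Local Notation I01 := (`[0, 1]%classic : set R).
Implicit Types (D K : set 'rV[R]_n) (u : 'rV[R]_n -> R) (g : 'rV[R]_n -> 'rV[R]_n).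

Lemma compact_ball_sub K D : compact K -> open D -> K `<=` D ->
  exists2 d : R, 0 < d & forall x, K x -> ball x d `<=` D.
Proof.
move=> cK oD KD.
have /(_ R (0^'+)%R (fun d x => ball x d `<=` D)) := proj1 (compact_near_coveringP K) cK.
move=> /(_ _)[|].
  move=> x Kx; have /nbhs_ballP[e /= e0 he] : nbhs x D by apply: open_nbhs_nbhs; split => //; exact: KD.
  have e20 : 0 < e / 2 by rewrite divr_gt0.
  exists (ball x (e / 2), [set d | d < e / 2]).
    split => /=; first exact: nbhsx_ballx.
    exact: nbhs_right_lt.
  move=> [y d] /= [xy de] z yz; apply: he.
  rewrite [e]splitr; apply: ball_triangle xy _; exact: le_ball (ltW de) _ yz.
move=> d' /= d'0 H; exists (d' / 2); first by rewrite divr_gt0.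
apply: (H (d' / 2)) => /=; last by rewrite divr_gt0.
by rewrite sub0r normrN gtr0_norm ?divr_gt0// ltr_pdivrMr// ltr_pMr// ltr1n.
Qed.

Lemma compact_sub_seg K D : compact K -> open D -> K `<=` D ->
  exists2 d : R, 0 < d & forall i : 'I_n, K `<=` seg D (d *: delta_mx ord0 i).
Proof.
move=> cK oD KD; have [d d0 hd] := compact_ball_sub K D cK oD KD.
exists (d / 2) => [|i x Kx t /andP[t0 t1]]; first by rewrite divr_gt0.
apply: (hd x Kx); apply/ball_rV => // j.
rewrite !mxE eqxx/= opprD addNKr normrN; apply: (@le_lt_trans _ _ (d / 2)); last first.
  by rewrite ltr_pdivrMr// ltr_pMr// ltr1n.
have d20 : 0 <= d / 2 by rewrite divr_ge0// ltW.
case: (j == i); rewrite ?mulr1 ?mulr0 ?normr0//.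
by rewrite normrM !ger0_norm// ler_piMl.
Qed.

Lemma dir_gradZ s h g x : dir_grad (s *: h) g x = s * dir_grad h g x :> R.
Proof. by rewrite /dir_grad mulr_sumr; apply: eq_bigr => i _; rewrite mxE mulrA. Qed.

Lemma locally_integrable_le D (w u : 'rV[R]_n -> R) : measurable D -> measurable_fun D w ->
  locally_integrable_rV D u -> (forall x, D x -> `|w x| <= `|u x|) -> locally_integrable_rV D w.
Proof.
move=> mD mw [mu' lu] wu; split => // K KD cK.
have mK := compact_measurable_rV _ cK.
apply: le_lt_trans (lu K KD cK); apply: ge0_le_integral => //.
- apply/measurable_EFinP; apply: measurableT_comp => //; exact: measurable_funS mw.
- apply/measurable_EFinP; apply: measurableT_comp => //; exact: measurable_funS mu'.
- by move=> x Kx; rewrite lee_fin; apply: wu; exact: KD.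
Qed.

Context (f f' : R -> R) (L : R).
Context (df : forall x : R, is_derive x (1 : R) f (f' x)) (f'1 : forall y, `|f' y| <= 1)
  (f'L : forall y z, `|f' y - f' z| <= L * `|y - z|) (L0 : 0 <= L) (f0 : f 0 = 0).
Context (mf : measurable_fun setT f) (mf' : measurable_fun setT f').

(** For a test function with support [K], the step [d] is so small that all segments from [K] in
    direction [d e_i] stay in [D]. Cut off to the swept set, [u] and its derivative along this
    direction are integrable, [chain_rule_integral] applies, and the factor [d] cancels. *)
Lemma weak_gradient_chain D u g : open D -> locally_integrable_rV D u ->
  is_weak_gradient D u g ->
  locally_integrable_rV D (f \o u) /\ is_weak_gradient D (f \o u) (fun x => f' (u x) *: g x).
Proof.
move=> oD lu wg; have mD := open_measurable_rV _ oD.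
have mu' : measurable_fun D u by case: lu.
have lfu : locally_integrable_rV D (f \o u).
  apply: (locally_integrable_le D _ u) => //; first exact: measurableT_comp.
  by move=> x _; exact: (chain_fun_le f f' df f'1 f0).
have lg i : locally_integrable_rV D (fun x => (f' (u x) *: g x) ord0 i).
  have lgi := is_weak_gradient_locint D u g i wg.
  apply: (locally_integrable_le D _ (fun x => g x ord0 i)) => //.
    rewrite (_ : (fun _ => _) = fun x => f' (u x) * g x ord0 i).
      by apply: measurable_funM; [exact: measurableT_comp|case: lgi].
    by apply/funext => x; rewrite mxE.
  by move=> x _; rewrite mxE normrM ler_piMl.
split => // i; split => // phi tphi.
have [sphi cK KD] := tphi; set K := closure _ in cK KD.
have [d d0 hd] := compact_sub_seg K D cK oD KD.
set h : 'rV[R]_n := d *: delta_mx ord0 i; have KS : K `<=` seg D h by exact: hd.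
have cKK := compact_segs K h cK; have KKD := segs_sub K D h KS.
have lG := locally_integrable_dir_grad D u g h mD wg.
have iv := integrable_restrict_compact D u _ mD lu cKK KKD.
have ig := integrable_restrict_compact D _ _ mD lG cKK KKD.
have notK x : ~ K x -> phi x = 0 by exact: (test_function_support D).
have KKx x t : K x -> 0 <= t <= 1 -> segs K h (x + t *: h).
  by move=> Kx t01; exists (x, t) => //; split => //=; rewrite in_itv.
have KKx0 x : K x -> segs K h x.
  by move=> Kx; have := KKx x 0 Kx; rewrite scale0r addr0; apply; rewrite lexx ler01.
have line s : 0 <= s <= 1 -> {ae mu, forall x, K x ->
    (u \_ (segs K h)) (x + s *: h) - (u \_ (segs K h)) x =
    s * \int[leb1]_(t in I01) (dir_grad h g \_ (segs K h)) (x + t *: (s *: h))}.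
  move=> s01; have /andP[s0 s1] := s01.
  have := weak_gradient_line D u g (s *: h) oD lu wg.
  apply: filterS => x hx Kx.
  have tsh t : 0 <= t <= 1 -> segs K h (x + t *: (s *: h)).
    move=> /andP[t0 t1]; rewrite scalerA; apply: KKx => //.
    by rewrite mulr_ge0//= mulr_ile1.
  have [|ix] := hx; first by move=> t t01; apply: KKD; exact: tsh.
  rewrite !patchE !mem_set//; last 2 first.
  - exact: KKx0.
  - exact: KKx.
  move=> ->.
  have e t : t \in I01 -> dir_grad (s *: h) g (x + t *: (s *: h)) =
      s * (dir_grad h g \_ (segs K h)) (x + t *: (s *: h)).
    rewrite inE/= in_itv/= => t01; rewrite dir_gradZ patchE mem_set//; exact: tsh.
  (* Integrability of the derivative along [h] is obtained from that along [s h] by dividing by [s],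
     so the trivial step is treated apart. *)
  have [->|sn0] := eqVneq s 0.
    rewrite mul0r /Rintegral; under eq_integral do rewrite scale0r /dir_grad.
    rewrite integral0_eq// => t _; rewrite big1// => j _; by rewrite mxE mul0r.
  have ix' : leb1.-integrable I01 (fun t => ((dir_grad h g \_ (segs K h)) (x + t *: (s *: h)))%:E).
    have mI01 : @measurable _ (measurableTypeR R) I01 by exact: measurable_itv.
    have := integrableZl mI01 s^-1 ix; apply: eq_integrable => // t t01.
    by rewrite /= e// -EFinM mulrA mulVf// mul1r.
  have mI01 : @measurable _ (measurableTypeR R) I01 by exact: measurable_itv.
  by rewrite -(RintegralZl s mI01 ix'); apply: eq_Rintegral => t t01; exact: e.
have tphiT : test_function setT phi by split.
have mK := compact_measurable_rV _ cK.
have := chain_rule_integral f f' L df f'1 f'L L0 f0 K h (u \_ (segs K h))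
  (dir_grad h g \_ (segs K h)) mK iv ig line phi tphiT notK.
have -> : \int[mu]_x (f ((u \_ (segs K h)) x) * dir_partial h phi x) =
    d * \int[mu]_(x in D) ((f \o u) x * partial i phi x).
  rewrite -RintegralZl//; last first.
    exact: (integrable_mul_test D (f \o u) _ mD lfu (test_function_partial D phi i tphi)).
  rewrite [RHS]Rintegral_mkcond; apply: eq_Rintegral => x _; rewrite [RHS]patchE.
  have [Kx|nKx] := pselect (K x).
    rewrite patchE !mem_set//; try (by exact: KKx0); try (by exact: KD).
    by rewrite dir_partialZ partial_dir mulrCA.
  by rewrite partial_dir !dir_partial_support// !mulr0; case: ifPn.
have -> : \int[mu]_x (f' ((u \_ (segs K h)) x) * (dir_grad h g \_ (segs K h)) x * phi x) =
    d * \int[mu]_(x in D) ((f' (u x) *: g x) ord0 i * phi x).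
  rewrite -RintegralZl//; last exact: (integrable_mul_test D _ _ mD (lg i) tphi).
  rewrite [RHS]Rintegral_mkcond; apply: eq_Rintegral => x _; rewrite [RHS]patchE.
  have [Kx|nKx] := pselect (K x); last by rewrite notK// !mulr0; case: ifPn.
  rewrite !patchE !mem_set//; try (by exact: KKx0); try (by exact: KD).
  rewrite dir_gradZ mxE.
  have -> : dir_grad (delta_mx ord0 i) g x = g x ord0 i.
    rewrite /dir_grad (bigD1 i)//= !mxE !eqxx mul1r big1 ?addr0// => j ji.
    by rewrite mxE eqxx (negbTE ji) mul0r.
  ring.
by rewrite -mulrN => /mulfI; apply; rewrite gt_eqF.
Qed.

End weak_gradient_chain.

(** * Smooth truncation by the sine *)

Section sine_truncation.
Context {R : realType}.

(** Bounded by [k], with derivative [cos (a / k)], which is bounded by 1 and has Lipschitz constant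
    [1 / k]: exactly what the chain rule asks for. The distance to [a] is at most [a ^ 2 / k]. *)
Definition sin_trunc (k a : R) : R := k * sin (a / k).

Lemma is_derive_sin_trunc k x : k != 0 -> is_derive x (1 : R) (sin_trunc k) (cos (x / k)).
Proof.
move=> k0.
have dl : is_derive x (1 : R) (fun y : R => y / k) k^-1.
  have -> : (fun y : R => y / k) = (k^-1 \*: id) by apply/funext => y; rewrite /GRing.scale/= mulrC.
  by apply: is_derive_eq; rewrite /GRing.scale/= mulr1.
have ds : is_derive x (1 : R) (fun y : R => sin (y / k)) (cos (x / k) * k^-1).
  exact: (@is_derive1_comp _ sin (fun y : R => y / k)).
have -> : cos (x / k) = k *: (cos (x / k) * k^-1) by rewrite /GRing.scale/= mulrCA divff// mulr1.
exact: is_deriveZ.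
Qed.

Lemma cos_lipschitz (x y : R) : `|cos x - cos y| <= `|x - y|.
Proof.
have [xi _ ->] := mean_value_slope (@cos R) (fun x => - sin x) (fun z => is_derive_cos z) y x.
by rewrite normrM normrN ler_piMl// sin_max.
Qed.

Lemma sin_trunc_le k a : 0 < k -> `|sin_trunc k a| <= k.
Proof. by move=> k0; rewrite normrM gtr0_norm// ler_piMr ?sin_max// ltW. Qed.

Lemma sin_trunc_dist k a : 0 < k -> `|sin_trunc k a - a| <= a ^+ 2 / k.
Proof.
move=> k0; set x := a / k.
have [xi + E] := mean_value_slope (@sin R) (@cos R) (fun z => is_derive_sin z) 0 x.
rewrite sin0 !subr0 in E *; move=> hxi.
have -> : sin_trunc k a - a = k * ((cos xi - 1) * x).
  by rewrite /sin_trunc -/x E /x; field; rewrite gt_eqF.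
rewrite normrM gtr0_norm// normrM.
apply: (@le_trans _ _ (k * (`|x| * `|x|))).
  rewrite ler_pM2l// ler_wpM2r//; apply: le_trans hxi.
  by have := cos_lipschitz xi 0; rewrite cos0 subr0.
rewrite -normrM -expr2 ger0_norm ?sqr_ge0// /x exprMn exprVn.
by rewrite le_eqVlt; apply/orP; left; apply/eqP; field; rewrite gt_eqF.
Qed.

Lemma sin_trunc_cvg a : sin_trunc k.+1%:R a @[k --> \oo] --> a.
Proof.
apply/cvgrPdist_le => e e0; near=> k.
rewrite distrC; apply: le_trans (sin_trunc_dist _ _ _) _ => //.
rewrite ler_pdivrMr// mulrC -ler_pdivrMr//; near: k.
exists (Num.truncn (a ^+ 2 / e)) => // k /= hk.
by apply: (le_trans (ltW (truncnS_gt _))); rewrite ler_nat.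
Unshelve. all: by end_near.
Qed.

End sine_truncation.

Section weak_gradient_calculus.
Context {R : realType} {n : nat}.
Local Notation mu := (lebesgue_rV R n).
Implicit Types (D K : set 'rV[R]_n) (u phi eta : 'rV[R]_n -> R) (g : 'rV[R]_n -> 'rV[R]_n).

Lemma weak_gradient_ae_unique D u u' g g' : open D ->
  {ae mu, forall x, D x -> u x = u' x} ->
  locally_integrable_rV D u -> locally_integrable_rV D u' ->
  is_weak_gradient D u g -> is_weak_gradient D u' g' ->
  {ae mu, forall x, D x -> g x = g' x}.
Proof.
move=> oD uu' lu lu' wg wg'; have mD := open_measurable_rV _ oD.
have h i : {ae mu, forall x, D x -> g x ord0 i - g' x ord0 i = 0}.
  have lg := is_weak_gradient_locint D u g i wg.
  have lg' := is_weak_gradient_locint D u' g' i wg'.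
  apply: fundamental_lemma => //.
    split; first by apply: measurable_funB; [case: lg|case: lg'].
    move=> K KD cK; have mK := compact_measurable_rV _ cK.
    have i1 := locally_integrable_integrable D _ K mD lg cK KD.
    have i2 := locally_integrable_integrable D _ K mD lg' cK KD.
    by have /integrableP[_] := integrableB mK i1 i2.
  move=> phi tphi.
  have i1 := integrable_mul_test D _ phi mD lg tphi.
  have i2 := integrable_mul_test D _ phi mD lg' tphi.
  have -> : \int[mu]_(x in D) ((g x ord0 i - g' x ord0 i) * phi x) =
      \int[mu]_(x in D) (g x ord0 i * phi x) - \int[mu]_(x in D) (g' x ord0 i * phi x).
    by rewrite -RintegralB//; apply: eq_Rintegral => x _; rewrite mulrBl.
  have [_ /(_ phi tphi) e1] := wg i; have [_ /(_ phi tphi) e2] := wg' i.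
  apply/eqP; rewrite subr_eq0 -eqr_opp -e1 -e2; apply/eqP.
  have td := test_function_partial D phi i tphi.
  have j1 := integrable_mul_test D _ _ mD lu td.
  have j2 := integrable_mul_test D _ _ mD lu' td.
  rewrite /Rintegral; congr fine; apply: ae_eq_integral => //.
  - exact: measurable_int j1.
  - exact: measurable_int j2.
  by apply: filterS uu' => x hx Dx /=; rewrite hx.
have : {ae mu, forall x, forall i, D x -> g x ord0 i - g' x ord0 i = 0}.
  by apply: filter_forall => i; exact: h.
apply: filterS => x hx Dx; apply/rowP => i; apply/eqP; rewrite -subr_eq0; apply/eqP; exact: hx.
Qed.

Lemma locally_integrable_cst D (c : R) : locally_integrable_rV D (cst c).
Proof.
split; first exact: measurable_cst.
move=> K KD cK; rewrite (integral_cst mu (compact_measurable_rV _ cK) `|c|%:E).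
by rewrite lte_mul_pinfty//; exact: compact_lebesgue_fin.
Qed.

Lemma locally_integrableD D u w : measurable D -> locally_integrable_rV D u ->
  locally_integrable_rV D w -> locally_integrable_rV D (fun x => u x + w x).
Proof.
move=> mD lu lw; split; first by apply: measurable_funD; [case: lu|case: lw].
move=> K KD cK; have mK := compact_measurable_rV _ cK.
have i1 := locally_integrable_integrable D _ K mD lu cK KD.
have i2 := locally_integrable_integrable D _ K mD lw cK KD.
by have /integrableP[_] := integrableD mK i1 i2.
Qed.

(** Averaging along [h] does not change the integral, and by the fundamental theorem of calculus it
    turns the derivative into [phi (x + h) - phi x], whose integral is zero by translation
    invariance. *)
Lemma integral_test_dir_partial h phi : test_function setT phi ->
  \int[mu]_x dir_partial h phi x = 0.
Proof.
move=> tphi; have td := test_function_dir_partial setT h phi tphi.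
have i0 w : test_function setT w -> mu.-integrable setT (EFin \o w).
  move=> tw; have := integrable_mul_test setT (cst 1) w measurableT (locally_integrable_cst _ 1) tw.
  by apply: eq_integrable => // x _ /=; rewrite mul1r.
have [sphi _ _] := tphi.
rewrite -(Rintegral_line _ h (i0 _ td)).
transitivity (\int[mu]_x (phi (x + h) - phi x)).
  by apply: eq_Rintegral => x _; rewrite /Rintegral smooth_FTC.
have ih := integrable_shift h _ (i0 _ tphi).
rewrite RintegralB//; last exact: i0.
rewrite /Rintegral (integral_shift h (EFin \o phi)) ?subrr//.
exact: measurable_int (i0 _ tphi).
Qed.

Lemma weak_gradient_add_cst D u g c : open D -> locally_integrable_rV D u ->
  is_weak_gradient D u g -> is_weak_gradient D (fun x => u x + c) g.
Proof.
move=> oD lu wg i; have mD := open_measurable_rV _ oD; have [lg hg] := wg i.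
split => // phi tphi; rewrite -hg//.
have td := test_function_partial D phi i tphi.
have i1 := integrable_mul_test D _ _ mD lu td.
have i2 := integrable_mul_test D _ _ mD (locally_integrable_cst D c) td.
have i3 := integrable_mul_test D _ _ mD (locally_integrable_cst D 1) td.
transitivity (\int[mu]_(x in D) (u x * partial i phi x) + c * \int[mu]_(x in D) (cst 1 x * partial i phi x)).
  rewrite -RintegralZl// -RintegralD//.
    by apply: eq_Rintegral => x _ /=; ring.
  exact: (integrableZl mD c i3).
have -> : \int[mu]_(x in D) (cst 1 x * partial i phi x) = \int[mu]_x dir_partial (delta_mx ord0 i) phi x.
  rewrite Rintegral_mkcond; apply: eq_Rintegral => x _; rewrite patchE partial_dir /=.
  case: ifPn => [_|xD]; first by rewrite mul1r.
  rewrite dir_partial_support// => Kx; move/negP: xD; apply; apply: mem_set.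
  by have [_ _] := tphi; exact.
rewrite integral_test_dir_partial ?mulr0 ?addr0//.
by have [h1 h2 _] := tphi.
Qed.

Lemma partialM i eta phi x : smooth eta -> smooth phi ->
  partial i (fun x => eta x * phi x) x = partial i eta x * phi x + eta x * partial i phi x.
Proof.
move=> se sp; rewrite /partial.
have d1 : derivable eta x (delta_mx ord0 i) by apply: diff_derivable; exact: smooth_differentiable.
have d2 : derivable phi x (delta_mx ord0 i) by apply: diff_derivable; exact: smooth_differentiable.
by rewrite (deriveM d1 d2) addrC /GRing.scale/= mulrC.
Qed.

Lemma test_functionM D eta phi : smooth eta -> test_function D phi ->
  test_function D (fun x => eta x * phi x).
Proof.
move=> se [sp cp pD]; have sub : closure [set x | eta x * phi x != 0] `<=` closure [set x | phi x != 0].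
  by apply: closure_subset => x /=; apply: contra_neq => ->; rewrite mulr0.
split; first exact: smoothM.
- apply: subclosed_compact cp sub; exact: closed_closure.
- exact: subset_trans pD.
Qed.

Lemma locally_integrableM D u eta : measurable D -> locally_integrable_rV D u ->
  continuous eta -> locally_integrable_rV D (fun x => eta x * u x).
Proof.
move=> mD lu ce; have me : measurable_fun D eta.
  by apply: measurable_funTS; exact: continuous_measurable_rV.
split; first by apply: measurable_funM => //; case: lu.
move=> K KD cK; have mK := compact_measurable_rV _ cK.
have [M [_ hM]] : bounded_set (eta @` K).
  apply: compact_bounded; apply: continuous_compact => //; exact: continuous_subspaceT.
pose B := `|M| + 1.
have hB x : K x -> `|eta x| <= B.
  by move=> Kx; apply: (hM B); [rewrite /B ltr_pwDr// ler_norm|exists x].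
have iu := locally_integrable_integrable D _ K mD lu cK KD.
have muK : measurable_fun K u by apply: measurable_funS mD KD _; case: lu.
have B0 : 0 <= B by rewrite addr_ge0.
have /integrableP[_] := integrableZl mK B iu.
apply: le_lt_trans; apply: ge0_le_integral => //.
- apply/measurable_EFinP; apply: measurableT_comp => //; apply: measurable_funM => //.
  exact: measurable_funS mD KD me.
- apply/measurable_EFinP; apply: measurableT_comp => //; exact: measurable_funM.
by move=> x Kx; rewrite /= lee_fin !normrM ler_wpM2r// (ger0_norm B0); exact: hB.
Qed.

(** The weak gradient of [u] is tested against [eta * phi]; the product rule for smooth functions
    leaves the extra term with [partial i eta]. *)
Lemma weak_gradient_mul_smooth D u g eta : open D -> locally_integrable_rV D u ->
  is_weak_gradient D u g -> smooth eta ->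
  is_weak_gradient D (fun x => eta x * u x)
    (fun x => eta x *: g x + u x *: \row_i partial i eta x).
Proof.
move=> oD lu wg se i; have mD := open_measurable_rV _ oD; have [lg hg] := wg i.
have lG : locally_integrable_rV D (fun x => eta x * g x ord0 i + partial i eta x * u x).
  apply: locally_integrableD => //; apply: locally_integrableM => //.
    exact: smooth_continuous.
  by apply: smooth_continuous; exact: smooth_partial.
have GE x : (eta x *: g x + u x *: \row_i partial i eta x) ord0 i =
  eta x * g x ord0 i + partial i eta x * u x by rewrite !mxE (mulrC (u x)).
split; first by under eq_fun do rewrite GE.
move=> phi tphi; under [in RHS]eq_Rintegral do rewrite GE.
have [sphi _ _] := tphi.
have te := test_functionM D eta phi se tphi.
have td := test_function_partial D phi i tphi.
have tde := test_function_partial D _ i te.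
have tpe := test_functionM D _ phi (smooth_partial eta i se) tphi.
have i1 := integrable_mul_test D u _ mD lu tde.
have i2 := integrable_mul_test D u _ mD lu tpe.
have i3 := integrable_mul_test D _ _ mD lg te.
transitivity (\int[mu]_(x in D) (u x * partial i (fun x => eta x * phi x) x) -
    \int[mu]_(x in D) (u x * (partial i eta x * phi x))).
  rewrite -RintegralB//; apply: eq_Rintegral => x _; rewrite partialM//; ring.
rewrite hg// -opprD; congr (- _); rewrite -RintegralD//.
by apply: eq_Rintegral => x _; ring.
Qed.

End weak_gradient_calculus.

(** * Cutoff functions *)

Section cutoff.
Context {R : realType} {n : nat}.

(** A smooth transition from 0 to 1 over the unit interval; the denominator is positive because [t]
    and [1 - t] are not both nonpositive. *)
Definition smooth_step (t : R) : R := flat_bump 0 t / (flat_bump 0 t + flat_bump 0 (1 - t)).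

Lemma smooth_step_den t : 0 < flat_bump 0 t + flat_bump 0 (1 - t) :> R.
Proof.
have [t0|t0] := leP t 0.
  by rewrite ltr_wpDl ?flat_bump_ge0// flat_bump_gt0; lra.
by rewrite ltr_wpDr ?flat_bump_ge0// flat_bump_gt0.
Qed.

Lemma smooth_step_ge0 t : 0 <= smooth_step t.
Proof. by rewrite divr_ge0 ?flat_bump_ge0// ltW// smooth_step_den. Qed.

Lemma smooth_step_le1 t : smooth_step t <= 1.
Proof. by rewrite ler_pdivrMr ?smooth_step_den// mul1r lerDl flat_bump_ge0. Qed.

Lemma smooth_step_eq0 t : t <= 0 -> smooth_step t = 0.
Proof. by move=> t0; rewrite /smooth_step flat_bump_eq0// mul0r. Qed.

Lemma smooth_step_eq1 t : 1 <= t -> smooth_step t = 1.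
Proof.
move=> t1; rewrite /smooth_step (flat_bump_eq0 0 (1 - t)) ?subr_le0// addr0 divff// gt_eqF//.
by rewrite flat_bump_gt0 (lt_le_trans ltr01).
Qed.

Lemma smooth_smooth_step (i : 'I_n) (s a : R) :
  smooth (fun x : 'rV[R]_n => smooth_step (s * x ord0 i + a)).
Proof.
have h : smooth (fun x : 'rV[R]_n => flat_bump 0 (s * x ord0 i + a) +
    flat_bump 0 (1 - (s * x ord0 i + a))).
  apply: smoothD; first exact: smooth_flat_bump.
  rewrite (_ : (fun _ => _) = fun x : 'rV[R]_n => flat_bump 0 (- s * x ord0 i + (1 - a))).
    exact: smooth_flat_bump.
  by apply/funext => x; congr flat_bump; ring.
apply: smoothM; first exact: smooth_flat_bump.
by apply: smoothV => // x; rewrite gt_eqF// smooth_step_den.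
Qed.

Lemma exists_cutoff (k : R) : 0 <= k -> exists eta : 'rV[R]_n -> R,
  [/\ smooth eta, forall x, 0 <= eta x <= 1,
      forall x, box (const_mx (- k)) (const_mx k) x -> eta x = 1,
      forall x, ~ box (const_mx (- (k + 1))) (const_mx (k + 1)) x -> eta x = 0 &
      exists2 B, 0 <= B & forall i x, `|partial i eta x| <= B].
Proof.
move=> k0.
pose eta (x : 'rV[R]_n) := \prod_(i < n) (smooth_step (1 * x ord0 i + (k + 1)) *
  smooth_step (- 1 * x ord0 i + (k + 1))).
have se : smooth eta.
  by apply: smooth_prod => i; apply: smoothM; exact: smooth_smooth_step.
have eta0 x : ~ box (const_mx (- (k + 1))) (const_mx (k + 1)) x -> eta x = 0.
  move=> nb; have [i hi] : exists i, ~ - (k + 1) < x ord0 i < k + 1.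
    by apply/not_existsP => h; apply: nb => i; rewrite !mxE; exact: contrapT (h i).
  rewrite /eta (bigD1 i)//=; have [h1|h1] := leP (x ord0 i) (- (k + 1)).
    by rewrite smooth_step_eq0 ?mul0r//; lra.
  have [h2|h2] := leP (k + 1) (x ord0 i).
    by rewrite [X in _ * X * _]smooth_step_eq0 ?mulr0 ?mul0r//; lra.
  by case: hi; rewrite h1 h2.
exists eta; split => //.
- move=> x; apply/andP; split.
    by apply: prodr_ge0 => i _; rewrite mulr_ge0 ?smooth_step_ge0.
  apply: prodr_ile1 => i _; rewrite mulr_ge0 ?smooth_step_ge0//=.
  by rewrite mulr_ile1 ?smooth_step_ge0 ?smooth_step_le1.
- move=> x hx; rewrite /eta big1// => i _; have := hx i; rewrite !mxE => /andP[h1 h2].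
  by rewrite !smooth_step_eq1 ?mulr1//; lra.
have te : test_function setT eta.
  apply: (test_function_box setT eta (const_mx (- (k + 1))) (const_mx (k + 1))) => //.
  by move=> x /= ex; apply: contrapT => nb; move: ex; rewrite eta0 ?eqxx.
have hB i : exists M, 0 <= M /\ forall x, `|partial i eta x| <= M.
  by have [M M0 hM] := test_function_bounded _ _ (test_function_partial setT eta i te); exists M.
have [M hM] := choice hB.
have M0 i : 0 <= M i by have [] := hM i.
exists (\sum_i M i); first exact: sumr_ge0.
move=> i x; have [_ h] := hM i; apply: le_trans (h x) _.
by rewrite (bigD1 i)//= lerDl sumr_ge0.
Qed.

End cutoff.

(** * Extension operators *)

Section sobolev_norms.
Context {R : realType} {n : nat}.
Local Notation mu := (lebesgue_rV R n).
Implicit Types (D Om : set 'rV[R]_n) (u v w : 'rV[R]_n -> R) (g G : 'rV[R]_n -> 'rV[R]_n)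
  (p q r C : R).

Lemma measurable_weak_gradient D u g i : is_weak_gradient D u g ->
  measurable_fun D (fun x => g x ord0 i).
Proof. by move=> /(_ i)[[]]. Qed.

Lemma measurable_norm_weak_gradient D u g : is_weak_gradient D u g ->
  measurable_fun D (fun x => euclidean_norm (g x)).
Proof. by move=> wg; apply: measurable_euclidean_norm => i; exact: measurable_weak_gradient wg. Qed.

Lemma pint_ae_eq D r v w : measurable D -> measurable_fun D v -> measurable_fun D w ->
  {ae mu, forall x, D x -> v x = w x} -> pint mu r D v = pint mu r D w.
Proof.
move=> mD mv mw vw; apply: ae_eq_integral => //; try exact: measurable_powR_norm.
by apply: filterS vw => x vw Dx; rewrite vw.
Qed.

(** Weak gradients are unique almost everywhere, so the integral does not see the choice made in
    [weak_gradient]; from here on any weak gradient [g] may be used in the norms. *)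
Lemma pint_grad_norm D u u' g r : open D -> locally_integrable_rV D u ->
  locally_integrable_rV D u' -> {ae mu, forall x, D x -> u x = u' x} ->
  (exists g', is_weak_gradient D u' g') -> is_weak_gradient D u g ->
  pint mu r D (grad_norm D u') = pint mu r D (fun x => euclidean_norm (g x)).
Proof.
move=> oD lu lu' uu' ex wg; have wg' := weak_gradientP ex.
have mD := open_measurable_rV _ oD.
apply: pint_ae_eq => //.
- exact: measurable_norm_weak_gradient wg'.
- exact: measurable_norm_weak_gradient wg.
have := weak_gradient_ae_unique D u u' g _ oD uu' lu lu' wg wg'.
by apply: filterS => x gg' Dx; rewrite /grad_norm gg'.
Qed.

Lemma Lnorm_onE D r w : 0 < r -> measurable D ->
  Lnorm_on D r%:E w = (pint mu r D w `^ r^-1)%E.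
Proof.
move=> r0 mD; rewrite /Lnorm_on unlock -(pint_restrict r D w (lt0r_neq0 r0)).
by congr (poweR _ _); apply: eq_integral.
Qed.

Lemma Lnorm_on_lty D r w : 0 < r -> measurable D ->
  (Lnorm_on D r%:E w < +oo)%E <-> (pint mu r D w < +oo)%E.
Proof.
move=> r0 mD; rewrite Lnorm_onE//; split; last exact: poweR_lty.
by apply: lty_poweRy; rewrite invr_eq0 gt_eqF.
Qed.

Lemma L1p_memP D r u : 0 < r -> open D ->
  L1p_mem D r%:E u <-> locally_integrable_rV D u /\
    exists2 g, is_weak_gradient D u g & (pint mu r D (fun x => euclidean_norm (g x)) < +oo)%E.
Proof.
move=> r0 oD; have mD := open_measurable_rV _ oD.
have ae_refl : {ae mu, forall x, D x -> u x = u x} by exact: aeW.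
split => [[lu ex /(Lnorm_on_lty _ _ _ r0 mD) h]|[lu [g wg h]]].
  by split => //; exists (weak_gradient D u) => //; exact: weak_gradientP.
have ex : exists g, is_weak_gradient D u g by exists g.
split; [exact: lu|exact: ex|apply: (proj2 (Lnorm_on_lty D r _ r0 mD))].
by rewrite (pint_grad_norm D u u g r oD lu lu ae_refl ex wg).
Qed.

Lemma L1p_normE D r u g : 0 < r -> open D -> locally_integrable_rV D u ->
  is_weak_gradient D u g ->
  fun_space_norm (L1p r%:E D) u = (pint mu r D (fun x => euclidean_norm (g x)) `^ r^-1)%E.
Proof.
move=> r0 oD lu wg; rewrite /= (Lnorm_onE D r _ r0 (open_measurable_rV _ oD)).
have ae_refl : {ae mu, forall x, D x -> u x = u x} by exact: aeW.
have ex : exists g, is_weak_gradient D u g by exists g.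
by rewrite (pint_grad_norm D u u g r oD lu lu ae_refl ex wg).
Qed.

Lemma W1p_memP D r u : 0 < r -> open D ->
  fun_space_mem (W1p r%:E D) u <-> [/\ locally_integrable_rV D u, (pint mu r D u < +oo)%E &
    exists2 g, is_weak_gradient D u g & (pint mu r D (fun x => euclidean_norm (g x)) < +oo)%E].
Proof.
move=> r0 oD; have mD := open_measurable_rV _ oD; split.
  by move=> [/(L1p_memP _ _ _ r0 oD)[lu ex] /(Lnorm_on_lty _ _ _ r0 mD)].
move=> [lu hu ex]; split; first exact: (proj2 (L1p_memP D r u r0 oD)).
exact: (proj2 (Lnorm_on_lty D r _ r0 mD)).
Qed.

Lemma W1p_normE D r u g : 0 < r -> open D -> locally_integrable_rV D u ->
  is_weak_gradient D u g ->
  fun_space_norm (W1p r%:E D) u =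
    ((pint mu r D u + pint mu r D (fun x => euclidean_norm (g x))) `^ r^-1)%E.
Proof.
move=> r0 oD lu wg; have mD := open_measurable_rV _ oD; rewrite /=; congr (poweR _ _).
have ex : exists g, is_weak_gradient D u g by exists g.
have wg' := weak_gradientP ex.
have ae_refl : {ae mu, forall x, D x -> u x = u x} by exact: aeW.
rewrite -(pint_grad_norm D u u g r oD lu lu ae_refl ex wg).
have m1 : measurable_fun D (fun x => (`|u x| `^ r)%:E).
  by apply: measurable_powR_norm; case: lu.
have m2 : measurable_fun D (fun x => (`|grad_norm D u x| `^ r)%:E).
  by apply: measurable_powR_norm; exact: measurable_norm_weak_gradient wg'.
have pos w x : D x -> (0 <= (`|w x| `^ r)%:E)%E by rewrite lee_fin powR_ge0.
rewrite /pint -(ge0_integralD mu mD (pos u) m1 (pos (grad_norm D u)) m2).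
apply: eq_integral => x _; rewrite EFinD; congr (_ + (_ `^ _)%:E)%E.
by rewrite ger0_norm// euclidean_norm_ge0.
Qed.

Lemma poweR_inv_le q (x : R) (X : \bar R) : 0 < q -> 0 <= x -> (0 <= X)%E ->
  (X `^ q^-1 <= x%:E)%E <-> (X <= (x `^ q)%:E)%E.
Proof.
move=> q0 x0; case: X => [y||]//; last first.
  by rewrite poweRyr ?invr_eq0 ?gt_eqF.
rewrite poweR_EFin !lee_fin => y0; split => h.
  have := ge0_ler_powR (ltW q0) _ _ h; rewrite -powRrM mulVf ?gt_eqF// powRr1//.
  by apply; rewrite nnegrE ?powR_ge0.
have := ge0_ler_powR (ltW (_ : 0 < q^-1)) _ _ h; rewrite -powRrM mulfV ?gt_eqF// powRr1//.
by apply; rewrite ?invr_gt0 ?nnegrE ?powR_ge0.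
Qed.

(** The norm inequality raised to the power [q]. Finiteness of [Y] allows its power, with exponent
    [q / p], to be taken among the real numbers. *)
Lemma norm_ratio_le p q C (X Y : \bar R) : 0 < p -> 0 < q -> 0 <= C -> (0 <= X)%E -> (0 <= Y)%E ->
  (Y < +oo)%E ->
  (X `^ q^-1 <= C%:E * Y `^ p^-1)%E <-> (X <= (C `^ q * fine Y `^ (q / p))%:E)%E.
Proof.
move=> p0 q0 C0 X0 Y0 Yoo; rewrite -{1}(fineK (_ : Y \is a fin_num)); last by rewrite ge0_fin_numE.
have y0 : 0 <= fine Y by exact: fine_ge0.
rewrite poweR_EFin -EFinM poweR_inv_le ?mulr_ge0 ?powR_ge0//.
by rewrite powRM ?powR_ge0// -powRrM (mulrC q).
Qed.

(** As no linearity is asked of the operator, choice reduces it to an extension of each function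
    separately, with arbitrary values outside the space. *)
Lemma extension_domainP (X Y : set 'rV[R]_n -> fun_space R n) Om :
  extension_domain X Y Om <-> exists2 C, 0 < C & forall u, fun_space_mem (X Om) u ->
    exists v, [/\ fun_space_mem (Y setT) v, {ae mu, forall x, Om x -> v x = u x} &
      (fun_space_norm (Y setT) v <= C%:E * fun_space_norm (X Om) u)%E].
Proof.
split => [[E [C [C0 h]]]|[C C0 h]]; first by exists C => // u /h; exists (E u).
have {}h u : exists v, fun_space_mem (X Om) u ->
    [/\ fun_space_mem (Y setT) v, {ae mu, forall x, Om x -> v x = u x} &
      (fun_space_norm (Y setT) v <= C%:E * fun_space_norm (X Om) u)%E].
  have [/h[v hv]|nu] := pselect (fun_space_mem (X Om) u); first by exists v.
  by exists u => /nu.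
by have [E hE] := choice h; exists E, C.
Qed.

(** The extension property in terms of integrals and of explicit weak gradients on both sides, free
    of roots and of the choice [weak_gradient]. The exponent [q / p] accounts for the two different
    powers. *)
Definition L1p_extension p q Om C := forall u g, locally_integrable_rV Om u ->
  is_weak_gradient Om u g -> (pint mu p Om (fun x => euclidean_norm (g x)) < +oo)%E ->
  exists v G, [/\ locally_integrable_rV setT v, is_weak_gradient setT v G,
    {ae mu, forall x, Om x -> v x = u x} &
    (pint mu q setT (fun x => euclidean_norm (G x)) <=
      (C * fine (pint mu p Om (fun x => euclidean_norm (g x))) `^ (q / p))%:E)%E].

Definition W1p_extension p q Om C := forall u g, locally_integrable_rV Om u ->
  is_weak_gradient Om u g -> (pint mu p Om u < +oo)%E ->
  (pint mu p Om (fun x => euclidean_norm (g x)) < +oo)%E ->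
  exists v G, [/\ locally_integrable_rV setT v, is_weak_gradient setT v G,
    {ae mu, forall x, Om x -> v x = u x} &
    (pint mu q setT v + pint mu q setT (fun x => euclidean_norm (G x)) <=
      (C * fine (pint mu p Om u + pint mu p Om (fun x => euclidean_norm (g x))) `^ (q / p))%:E)%E].

(** The summand 1 keeps the norm constant positive, as [extension_domain] demands, even when
    [C = 0]. *)
Let powR_root q C : 0 < q -> 0 <= C -> C <= (C `^ q^-1 + 1) `^ q.
Proof.
move=> q0 C0; apply: (@le_trans _ _ ((C `^ q^-1) `^ q)).
  by rewrite -powRrM mulVf ?gt_eqF// powRr1.
by rewrite ge0_ler_powR ?nnegrE ?addr_ge0 ?powR_ge0 ?(ltW q0)// lerDl.
Qed.

Lemma extension_domain_L1p p q Om : 0 < p -> 0 < q -> open Om ->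
  extension_domain (L1p p%:E) (L1p q%:E) Om <-> exists2 C, 0 <= C & L1p_extension p q Om C.
Proof.
move=> p0 q0 oOm; rewrite extension_domainP; split => [[C C0 h]|[C C0 h]].
  exists (C `^ q); first exact: powR_ge0.
  move=> u g lu wg gfin.
  have [|v [/(L1p_memP _ _ _ q0 openT)[lv [G wG Gfin]] vu hn]] := h u.
    by apply: (proj2 (L1p_memP Om p u p0 oOm)); split; [exact: lu|exists g].
  exists v, G; split; [exact: lv|exact: wG|exact: vu|].
  move: hn; rewrite (L1p_normE setT q v G q0 openT lv wG) (L1p_normE Om p u g p0 oOm lu wg).
  by move=> /norm_ratio_le; apply; rewrite ?pint_ge0// ltW.
exists (C `^ q^-1 + 1); first by rewrite ltr_wpDl ?powR_ge0.
move=> u /(L1p_memP _ _ _ p0 oOm)[lu [g wg gfin]].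
have [v [G [lv wG vu hn]]] := h u g lu wg gfin.
exists v; split; [|exact: vu|].
  apply: (proj2 (L1p_memP setT q v q0 openT)); split; first exact: lv.
  by exists G; [exact: wG|apply: le_lt_trans hn _; exact: ltry].
rewrite (L1p_normE setT q v G q0 openT lv wG) (L1p_normE Om p u g p0 oOm lu wg).
apply/norm_ratio_le => //; rewrite ?pint_ge0 ?addr_ge0 ?powR_ge0//.
by apply: le_trans hn _; rewrite lee_fin ler_wpM2r ?powR_ge0//; exact: powR_root.
Qed.

Lemma extension_domain_W1p p q Om : 0 < p -> 0 < q -> open Om ->
  extension_domain (W1p p%:E) (W1p q%:E) Om <-> exists2 C, 0 <= C & W1p_extension p q Om C.
Proof.
move=> p0 q0 oOm; rewrite extension_domainP; split => [[C C0 h]|[C C0 h]].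
  exists (C `^ q); first exact: powR_ge0.
  move=> u g lu wg ufin gfin.
  have [|v [/(W1p_memP _ _ _ q0 openT)[lv vfin [G wG Gfin]] vu hn]] := h u.
    by apply: (proj2 (W1p_memP Om p u p0 oOm)); split; [exact: lu|exact: ufin|exists g].
  exists v, G; split; [exact: lv|exact: wG|exact: vu|].
  move: hn; rewrite (W1p_normE setT q v G q0 openT lv wG) (W1p_normE Om p u g p0 oOm lu wg).
  have a0 D r w w' : (0 <= pint mu r D w + pint mu r D w')%E by rewrite adde_ge0 ?pint_ge0.
  move=> hn.
  exact: (proj1 (norm_ratio_le p q C _ _ p0 q0 (ltW C0) (a0 _ _ _ _) (a0 _ _ _ _) (lte_add_pinfty ufin gfin)) hn).
exists (C `^ q^-1 + 1); first by rewrite ltr_wpDl ?powR_ge0.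
move=> u /(W1p_memP _ _ _ p0 oOm)[lu ufin [g wg gfin]].
have [v [G [lv wG vu hn]]] := h u g lu wg ufin gfin.
have vGfin := le_lt_trans hn (ltry _).
exists v; split; [|exact: vu|].
  apply: (proj2 (W1p_memP setT q v q0 openT)); split; first exact: lv.
    by apply: le_lt_trans vGfin; rewrite leeDl ?pint_ge0.
  by exists G; first exact: wG; apply: le_lt_trans vGfin; rewrite leeDr ?pint_ge0.
rewrite (W1p_normE setT q v G q0 openT lv wG) (W1p_normE Om p u g p0 oOm lu wg).
have a0 D r w w' : (0 <= pint mu r D w + pint mu r D w')%E by rewrite adde_ge0 ?pint_ge0.
have C10 : 0 <= C `^ q^-1 + 1 by rewrite addr_ge0 ?powR_ge0.
apply: (proj2 (norm_ratio_le p q _ _ _ p0 q0 C10 (a0 _ _ _ _) (a0 _ _ _ _) (lte_add_pinfty ufin gfin))).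
by apply: le_trans hn _; rewrite lee_fin ler_wpM2r ?powR_ge0//; exact: powR_root.
Qed.

End sobolev_norms.

Section pint_constants.
Context {d} {T : measurableType d} {R : realType} (nu : {measure set T -> \bar R}).
Implicit Types (E : set T) (w : T -> R) (r c : R).

Lemma pint_cst_le r E w c : measurable E -> measurable_fun E w -> 0 <= r ->
  ((`|c| `^ r)%:E * nu E <= (2 `^ r)%:E * (pint nu r E w + pint nu r E (fun x => w x - c)%R))%E.
Proof.
move=> mE mw r0; rewrite -pint_cst//.
have mwc : measurable_fun E (fun x => w x - c) by exact: measurable_funB.
have -> : cst c = w \+ (fun x => - (w x - c)) by apply/funext => x /=; ring.
apply: le_trans (pint_add _ _ _ _ _ mE mw _ r0) _; first exact: measurableT_comp.
have -> // : pint nu r E (fun x => - (w x - c)) = pint nu r E (fun x => w x - c).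
by apply: eq_integral => x _; rewrite normrN.
Qed.

Lemma pint_sub_cst_le r E w c : measurable E -> measurable_fun E w -> 0 <= r ->
  (pint nu r E w <= (2 `^ r)%:E * (pint nu r E (fun x => w x - c)%R + (`|c| `^ r)%:E * nu E))%E.
Proof.
move=> mE mw r0; rewrite -pint_cst//.
have {1}-> : w = (fun x => w x - c) \+ cst c by apply/funext => x /=; ring.
by apply: pint_add => //; exact: measurable_funB.
Qed.

Lemma pintZ r E w c : measurable E -> measurable_fun E w ->
  (pint nu r E (fun x => c * w x)%R = (`|c| `^ r)%:E * pint nu r E w)%E.
Proof.
move=> mE mw; rewrite /pint -ge0_integralZl ?lee_fin ?powR_ge0//; last exact: measurable_powR_norm.
by apply: eq_integral => x _; rewrite normrM powRM// EFinM.
Qed.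

End pint_constants.

Section bounded_domain.
Context {R : realType} {n : nat}.
Local Notation mu := (lebesgue_rV R n).

Lemma bounded_domain_measure (Om : set 'rV[R]_n) : domain Om -> bounded_set Om ->
  exists2 m, 0 < m & mu Om = m%:E.
Proof.
move=> [[x Omx] oOm _] bOm; have mOm := open_measurable_rV _ oOm.
have mE : mu Om = (fine (mu Om))%:E.
  by rewrite fineK// ge0_fin_numE ?measure_ge0//; exact: bounded_set_lebesgue_fin.
exists (fine (mu Om)) => //.
have /nbhs_ballP[e /= e0 he] : nbhs x Om by exact: open_nbhs_nbhs.
have e20 : 0 < e / 2 by rewrite divr_gt0.
rewrite -lte_fin -mE; apply: (@lt_le_trans _ _ (mu (cube (x - const_mx (e / 2)) (2 * (e / 2))))).
  by rewrite lebesgue_cube ?lte_fin ?exprn_gt0 ?mulr_gt0.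
apply: le_measure; rewrite ?inE//; first exact: measurable_cube.
by apply: subset_trans (cube_center_sub x _ e20) _; rewrite mulrC divfK.
Qed.

End bounded_domain.

Section fine_powR.
Context {R : realType}.
Implicit Types (x y : \bar R) (s : R).

Lemma fine_powR_le x y s : 0 <= s -> (0 <= x)%E -> (x <= y)%E -> (y < +oo)%E ->
  fine x `^ s <= fine y `^ s.
Proof.
move=> s0 x0 xy yoo; have y0 := le_trans x0 xy.
rewrite ge0_ler_powR ?nnegrE ?fine_ge0// fine_le// ge0_fin_numE//.
exact: le_lt_trans yoo.
Qed.

Lemma fine_powR_addl x y s : 0 <= s -> (0 <= x)%E -> (0 <= y)%E -> (x < +oo)%E -> (y < +oo)%E ->
  fine x `^ s <= fine (x + y) `^ s.
Proof.
by move=> s0 x0 y0 xoo yoo; apply: fine_powR_le => //; [rewrite leeDl|rewrite lte_add_pinfty].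
Qed.

Lemma fine_powR_addr x y s : 0 <= s -> (0 <= x)%E -> (0 <= y)%E -> (x < +oo)%E -> (y < +oo)%E ->
  fine y `^ s <= fine (x + y) `^ s.
Proof.
by move=> s0 x0 y0 xoo yoo; apply: fine_powR_le => //; [rewrite leeDr|rewrite lte_add_pinfty].
Qed.

End fine_powR.

(** * From homogeneous to inhomogeneous extensions *)

Section extension_equivalence.
Context {R : realType} {n : nat}.
Local Notation mu := (lebesgue_rV R n).
Context (Om : set 'rV[R]_n) (dOm : domain Om) (bOm : bounded_set Om).
Context (p q : R) (q1 : 1 <= q) (qp : q <= p).

Let oOm : open Om. Proof. by case: dOm. Qed.
Let mOm : measurable Om. Proof. exact: open_measurable_rV. Qed.
Let q0 : 0 < q. Proof. exact: lt_le_trans q1. Qed.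
Let p1 : 1 <= p. Proof. exact: le_trans qp. Qed.
Let p0 : 0 < p. Proof. exact: lt_le_trans p1. Qed.
Context (m : R) (mE : mu Om = m%:E) (m0 : 0 < m).

Let pint_Om_q w : measurable_fun Om w -> (pint mu p Om w < +oo)%E ->
  (pint mu q Om w <= ((1 + m) * fine (pint mu p Om w) `^ (q / p))%:E)%E.
Proof.
move=> mw wfin; apply: pint_le_exponent => //.
by rewrite fineK// ge0_fin_numE ?pint_ge0.
Qed.

Lemma W1p_extension_of_L1p C : 0 <= C -> L1p_extension p q Om C ->
  exists2 C', 0 <= C' & W1p_extension p q Om C'.
Proof.
move=> C0 ext.
have [k k0 Omk] := bounded_sub_box Om bOm.
have [eta [se eta01 eta1 eta_out [B B0 hB]]] := @exists_cutoff R n k%:R (ler0n _ _).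
(* The cutoff vanishes off the box of half-side [k + 1]; with half-side [k + 2] the half-open cube
   contains the closure of that box, off which the partial derivatives of [eta] vanish as well. *)
pose l : R := 2 * (k%:R + 2).
have l0 : 0 < l by rewrite mulr_gt0 // ltr_wpDl.
pose Q := cube (const_mx (- (k%:R + 2))) l : set 'rV[R]_n.
have mQ : measurable Q by exact: measurable_cube.
pose M := l ^+ n; have M0 : 0 <= M by rewrite exprn_ge0 ?ltW.
have muQ : mu Q = M%:E by exact: lebesgue_cube.
have OmQ : Om `<=` Q.
  move=> x /Omk h i; have := h i; rewrite !mxE => /andP[h1 h2].
  by apply/andP; split; rewrite /l; lra.
have boxQ x : ~ Q x -> ~ cbox (const_mx (- (k%:R + 1))) (const_mx (k%:R + 1)) x.
  move=> nQ h; apply: nQ => i; have := h i; rewrite !mxE => /andP[h1 h2].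
  by apply/andP; split; rewrite /l; lra.
have etaQ x : ~ Q x -> eta x = 0.
  by move=> /boxQ h; apply: eta_out => /sub_box_cbox.
have detaQ i x : ~ Q x -> partial i eta x = 0.
  move=> /boxQ h; rewrite partial_dir; apply: dir_partial_support => hx; apply: h.
  have /closure_id -> := closed_cbox (const_mx (- (k%:R + 1))) (const_mx (k%:R + 1) : 'rV[R]_n).
  apply: closure_subset hx => y /= ey; apply: sub_box_cbox.
  by apply: contrapT => /eta_out ey0; move: ey; rewrite ey0 eqxx.
pose P := 2 * 2 ^+ n * (2 * (n%:R * l)) `^ q.
have P0 : 0 <= P by rewrite !mulr_ge0 ?exprn_ge0 ?powR_ge0.
(* [A1] is the Poincare bound for [v - c] on [Q]; [A2] is the resulting bound for [v] on [Q], once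
   [c] is estimated on [Om], where [v = u]; [A3] bounds the gradient of [eta * v] through
   [n |G| + n B |v|]. *)
pose A1 := P * C.
pose A2 := 2 `^ q * (A1 + 2 `^ q * (1 + m + A1) / m * M).
pose A3 := 2 `^ q * (n%:R `^ q * C + (n%:R * B) `^ q * A2).
have A10 : 0 <= A1 by exact: mulr_ge0.
have A20 : 0 <= A2.
  rewrite mulr_ge0 ?powR_ge0// addr_ge0// mulr_ge0// divr_ge0 ?(ltW m0)//.
  by rewrite mulr_ge0 ?powR_ge0// !addr_ge0// ltW.
have A30 : 0 <= A3.
  by apply: mulr_ge0; [exact: powR_ge0|apply: addr_ge0; apply: mulr_ge0 => //; exact: powR_ge0].
exists (A2 + A3); first exact: addr_ge0.
move=> u g lu wg ufin gfin.
have mu' : measurable_fun Om u by case: lu.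
have [v [G [lv wG vu Gfin]]] := ext u g lu wg gfin.
set Up := pint mu p Om u in ufin *; set Gp := pint mu p Om (fun x => euclidean_norm (g x)) in gfin Gfin *.
have Up0 : (0 <= Up)%E by exact: pint_ge0.
have Gp0 : (0 <= Gp)%E by exact: pint_ge0.
set t := fine (Up + Gp) `^ (q / p).
have t0 : 0 <= t by exact: powR_ge0.
have qp0 : 0 <= q / p by rewrite divr_ge0 ?ltW.
have Ut : fine Up `^ (q / p) <= t := fine_powR_addl _ _ _ qp0 Up0 Gp0 ufin gfin.
have Gt : fine Gp `^ (q / p) <= t := fine_powR_addr _ _ _ qp0 Up0 Gp0 ufin gfin.
clearbody t.
have mv : measurable_fun setT v by case: lv.
have mvE (E : set 'rV[R]_n) : measurable_fun E v by exact: measurable_funTS.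
have mNG := measurable_norm_weak_gradient setT v G wG.
have a0 : (pint mu q setT (fun x => euclidean_norm (G x)) <= (C * t)%:E)%E.
  by apply: le_trans Gfin _; rewrite lee_fin ler_wpM2l.
have a1 : (pint mu q Q (fun x => euclidean_norm (G x)) <= (C * t)%:E)%E.
  by apply: le_trans a0; apply: pint_subset.
have [c hc] := poincare_cube setT v G (const_mx (- (k%:R + 2))) l q openT lv wG (@subsetT _ _) q1 l0.
have {}hc : (pint mu q Q (fun x => v x - c)%R <= (A1 * t)%:E)%E.
  apply: le_trans hc _; rewrite -/P /A1 -mulrA (EFinM P) lee_wpmul2l ?lee_fin//; exact: a1.
have mvc (E : set 'rV[R]_n) : measurable_fun E (fun x => v x - c) by exact: measurable_funB.
have a2 : (pint mu q Om v <= ((1 + m) * t)%:E)%E.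
  rewrite (pint_ae_eq Om q v u mOm (mvE _) mu' vu).
  apply: le_trans (pint_Om_q u mu' ufin) _; rewrite lee_fin; apply: ler_wpM2l; [by rewrite addr_ge0// ltW|exact: Ut].
(* Since [Om] has positive measure, [c] is controlled by the [L^q] integrals over [Om] of [v] and
   [v - c]. *)
have a3 : `|c| `^ q <= 2 `^ q * (1 + m + A1) / m * t.
  rewrite mulrAC ler_pdivlMr// -lee_fin EFinM -mE.
  apply: le_trans (pint_cst_le mu q Om v c mOm (mvE _) (ltW q0)) _.
  rewrite -mulrA (EFinM (2 `^ q)) lee_wpmul2l ?lee_fin ?powR_ge0// (mulrDl (1 + m)) EFinD.
  by apply: leeD => //; apply: le_trans hc; exact: pint_subset.
have a4 : (pint mu q Q v <= (A2 * t)%:E)%E.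
  apply: le_trans (pint_sub_cst_le mu q Q v c mQ (mvE _) (ltW q0)) _.
  rewrite /A2 -mulrA (EFinM (2 `^ q)) lee_wpmul2l ?lee_fin ?powR_ge0// mulrDl EFinD.
  by apply: leeD => //; rewrite muQ -EFinM lee_fin (mulrAC _ M) ler_wpM2r.
pose w x := eta x * v x.
have lw : locally_integrable_rV setT w.
  by apply: locally_integrableM => //; exact: smooth_continuous.
have wH := weak_gradient_mul_smooth setT v G eta openT lv wG se.
set H := fun x => eta x *: G x + v x *: \row_i partial i eta x in wH.
exists w, H; split => //.
  move: vu; apply: filterS => x vux Omx.
  by rewrite /w eta1 ?mul1r ?vux//; exact: Omk.
have mw : measurable_fun setT w by case: lw.
have b1 : (pint mu q setT w <= (A2 * t)%:E)%E.
  apply: le_trans a4.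
  have -> : w = w \_ Q.
    by apply/funext => x; rewrite patchE; case: ifPn => // xQ; rewrite /w etaQ ?mul0r//; move/negP: xQ; rewrite inE.
  rewrite (pint_restrict q Q w (lt0r_neq0 q0)).
  apply: (pint_le mu q Q w v mQ (measurable_funTS mw) (mvE Q) (ltW q0)) => x _.
  rewrite /w normrM; have /andP[h1 h2] := eta01 x.
  by rewrite ger0_norm// ler_piMl.
have mNH := measurable_norm_weak_gradient setT _ _ wH.
have b2 : (pint mu q setT (fun x => euclidean_norm (H x)) <= (A3 * t)%:E)%E.
  have mvQ : measurable_fun setT (v \_ Q) by apply/(measurable_restrictT _ mQ).
  have m1 : measurable_fun setT (fun x => n%:R * euclidean_norm (G x)) by exact: measurable_funM.
  have m2 : measurable_fun setT (fun x => n%:R * B * `|(v \_ Q) x|).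
    by apply: measurable_funM => //; exact: measurableT_comp.
  apply: (@le_trans _ _ (pint mu q setT ((fun x => n%:R * euclidean_norm (G x)) \+
      (fun x => n%:R * B * `|(v \_ Q) x|)))).
    apply: (pint_le mu q setT _ _ measurableT mNH (measurable_funD m1 m2) (ltW q0)) => x _.
    rewrite !ger0_norm ?euclidean_norm_ge0//; last first.
      by rewrite addr_ge0 ?mulr_ge0 ?euclidean_norm_ge0.
    apply: le_trans (euclidean_norm_le_sum _) _.
    rewrite [leRHS]/= -(mulrA n%:R) -mulrDr mulr_natl -[X in _ *+ X]card_ord -sumr_const.
    apply: ler_sum => i _; rewrite !mxE; apply: le_trans (ler_normD _ _) _; apply: lerD.
      rewrite normrM; have /andP[h1 h2] := eta01 x.
      apply: le_trans (coord_le_euclidean_norm _ i).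
      by rewrite ger0_norm// ler_piMl.
    rewrite normrM mulrC patchE; case: ifPn => [_|xQ]; first by rewrite ler_wpM2r.
    by rewrite detaQ ?normr0 ?mul0r ?mulr0//; move/negP: xQ; rewrite inE.
  apply: le_trans (pint_add _ _ _ _ _ measurableT m1 m2 (ltW q0)) _.
  rewrite /A3 -mulrA (EFinM (2 `^ q)) lee_wpmul2l ?lee_fin ?powR_ge0// mulrDl EFinD.
  apply: leeD.
    rewrite pintZ// ger0_norm// -mulrA EFinM lee_wpmul2l ?lee_fin ?powR_ge0//.
  rewrite pintZ//; last exact: measurableT_comp.
  have -> : pint mu q setT (fun x => `|(v \_ Q) x|) = pint mu q Q v.
    rewrite -(pint_restrict q Q v (lt0r_neq0 q0)); apply: eq_integral => x _.
    by rewrite normr_id.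
  rewrite (ger0_norm (mulr_ge0 (ler0n R n) B0)) -(mulrA ((n%:R * B) `^ q)) (EFinM ((n%:R * B) `^ q)).
  by apply: lee_wpmul2l a4; rewrite lee_fin; exact: powR_ge0.
by rewrite mulrDl EFinD; exact: leeD.
Qed.

End extension_equivalence.

Lemma pint_fineK {d} {T : measurableType d} {R : realType} (nu : {measure set T -> \bar R})
    (r : R) (E : set T) (w : T -> R) : (pint nu r E w < +oo)%E ->
  pint nu r E w = (fine (pint nu r E w))%:E.
Proof. by move=> fin; rewrite fineK// ge0_fin_numE// pint_ge0. Qed.

Lemma pint_sub_cst_lty {d} {T : measurableType d} {R : realType} (nu : {measure set T -> \bar R})
    (r c : R) (E : set T) (w : T -> R) : measurable E -> (nu E < +oo)%E -> measurable_fun E w ->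
  0 <= r -> (pint nu r E w < +oo)%E -> (pint nu r E (fun x => w x - c)%R < +oo)%E.
Proof.
move=> mE Efin mw r0 wfin; apply: le_lt_trans (pint_add nu r E w (cst (- c)) mE mw (measurable_cst _) r0) _.
have fin_mul (y : R) (z : \bar R) : 0 <= y -> (z < +oo)%E -> (y%:E * z < +oo)%E.
  by move=> y0; apply: lte_mul_pinfty.
apply: (fin_mul); [exact: powR_ge0|apply: lte_add_pinfty; first exact: wfin].
by rewrite pint_cst//; apply: fin_mul; [exact: powR_ge0|exact: Efin].
Qed.

(** * Gain of integrability and the Poincare inequality on the whole domain *)

Section sobolev_gain.
Context {R : realType} {n : nat}.
Local Notation mu := (lebesgue_rV R n).
Context (Om : set 'rV[R]_n) (dOm : domain Om) (bOm : bounded_set Om).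
Context (p q r : R) (q1 : 1 <= q) (qp : q <= p) (pr : p < r).
Context (gam0 : 0 < r + n%:R - n%:R * (r / q)).
Context (m : R) (mE : mu Om = m%:E) (m0 : 0 < m).

Let oOm : open Om. Proof. by case: dOm. Qed.
Let mOm : measurable Om. Proof. exact: open_measurable_rV. Qed.
Let q0 : 0 < q. Proof. exact: lt_le_trans q1. Qed.
Let p1 : 1 <= p. Proof. exact: le_trans qp. Qed.
Let p0 : 0 < p. Proof. exact: lt_le_trans p1. Qed.
Let qr : q < r. Proof. exact: le_lt_trans pr. Qed.
Let r0 : 0 < r. Proof. exact: lt_trans qr. Qed.

(** The extension [v] has its gradient in [L^q] on a cube around [Om], where [sobolev_poincare_cube]
    bounds [v - c] in [L^r]. The unknown [c] is estimated on [Om] from the [L^q] integrals of [v]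
    and of [v - c]; [pint_le_exponent] derives the latter from the [L^r] bound. *)
Lemma W1p_extension_gain C : 0 <= C -> W1p_extension p q Om C ->
  exists2 C', 0 <= C' & forall w g, locally_integrable_rV Om w -> is_weak_gradient Om w g ->
    (pint mu p Om w < +oo)%E -> (pint mu p Om (fun x => euclidean_norm (g x)) < +oo)%E ->
    (pint mu r Om w <=
      (C' * fine (pint mu p Om w + pint mu p Om (fun x => euclidean_norm (g x))) `^ (r / p))%:E)%E.
Proof.
move=> C0 ext.
have [k k0 Omk] := bounded_sub_box Om bOm.
pose l : R := 2 * k%:R.
have l0 : 0 < l by rewrite mulr_gt0 // ltr0n.
pose Q := cube (const_mx (- k%:R)) l : set 'rV[R]_n.
have mQ : measurable Q by exact: measurable_cube.
have OmQ : Om `<=` Q.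
  move=> x /Omk h i; have := h i; rewrite !mxE => /andP[h1 h2].
  by apply/andP; split; rewrite /l; lra.
have [A A0 hA] := sobolev_poincare_cube R n q r l q1 qr gam0 l0.
have s0 : 0 <= r / q by rewrite divr_ge0 ?ltW.
have s'0 : 0 <= q / r by rewrite divr_ge0 ?ltW.
pose B := 2 `^ q * (C + (1 + m) * (A `^ (q / r) * C)) / m.
have B0 : 0 <= B.
  rewrite divr_ge0 ?(ltW m0)// mulr_ge0 ?powR_ge0// addr_ge0// mulr_ge0 ?addr_ge0 ?(ltW m0)//.
  by rewrite mulr_ge0 ?powR_ge0.
exists (2 `^ r * (A * C `^ (r / q) + B `^ (r / q) * m)).
  by rewrite mulr_ge0 ?powR_ge0// addr_ge0// mulr_ge0 ?powR_ge0// ltW.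
move=> w g lw wg wfin gfin.
have [v [G [lv wG vw hvG]]] := ext w g lw wg wfin gfin.
set Z := fine _ in hvG *.
have Z0 : 0 <= Z by rewrite fine_ge0// adde_ge0 ?pint_ge0.
clearbody Z.
set z := Z `^ (q / p) in hvG.
have z0 : 0 <= z by exact: powR_ge0.
(* The bounds on the extension are linear in [z]; in terms of it the exponent [r / p] of the claim
   becomes [r / q], that of the Sobolev inequality. *)
have zE : Z `^ (r / p) = z `^ (r / q).
  by rewrite /z -powRrM; congr (_ `^ _); field; rewrite !gt_eqF.
rewrite zE; clearbody z; clear zE.
have mv (E : set 'rV[R]_n) : measurable_fun E v by apply: measurable_funTS; case: lv.
have mw : measurable_fun Om w by case: lw.
have mNG := measurable_norm_weak_gradient setT v G wG.
have hv : (pint mu q setT v <= (C * z)%:E)%E.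
  by apply: le_trans hvG; rewrite leeDl// pint_ge0.
have hG : (pint mu q Q (fun x => euclidean_norm (G x)) <= (C * z)%:E)%E.
  apply: le_trans (pint_subset mu q Q setT _ mQ measurableT (@subsetT _ _) mNG) _.
  by apply: le_trans hvG; rewrite leeDr// pint_ge0.
have [c hc] := hA setT v G (const_mx (- k%:R)) openT lv wG (@subsetT _ _) (le_lt_trans hG (ltry _)).
have {}hc : (pint mu r Q (fun x => v x - c)%R <= (A * (C * z) `^ (r / q))%:E)%E.
  apply: le_trans hc _; rewrite lee_fin ler_wpM2l//.
  have := fine_powR_le _ _ _ s0 (pint_ge0 mu q Q (fun x => euclidean_norm (G x))) hG (ltry _).
  exact.
have mvc (E : set 'rV[R]_n) : measurable_fun E (fun x => v x - c) by exact: measurable_funB.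
have hcOm : (pint mu r Om (fun x => v x - c)%R <= (A * (C * z) `^ (r / q))%:E)%E.
  exact: le_trans (pint_subset mu r Om Q _ mOm mQ OmQ (mvc Q)) hc.
have hcq : (pint mu q Om (fun x => v x - c)%R <= ((1 + m) * (A `^ (q / r) * C) * z)%:E)%E.
  have fin := pint_fineK _ _ _ _ (le_lt_trans hcOm (ltry _)).
  have := pint_le_exponent mu q r Om _ m _ mOm (mvc Om) q0 (ltW qr) mE fin.
  move=> h; apply: le_trans h _; rewrite lee_fin -mulrA ler_wpM2l ?addr_ge0 ?(ltW m0)//.
  have := fine_powR_le _ _ _ s'0 (pint_ge0 mu r Om (fun x => v x - c)%R) hcOm (ltry _).
  move=> h; apply: le_trans h _ => /=.
  rewrite powRM ?powR_ge0// -powRrM.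
  have -> : r / q * (q / r) = 1 by field; rewrite !gt_eqF.
  by rewrite powRr1 ?mulr_ge0// mulrA.
have hcB : `|c| `^ q <= B * z.
  rewrite /B mulrAC ler_pdivlMr// -lee_fin EFinM -mE.
  apply: le_trans (pint_cst_le mu q Om v c mOm (mv _) (ltW q0)) _.
  rewrite -(mulrA (2 `^ q)) (EFinM (2 `^ q)); apply: lee_wpmul2l; first by rewrite lee_fin powR_ge0.
  rewrite (mulrDl C) EFinD; apply: leeD hcq.
  exact: le_trans (pint_subset mu q Om setT _ mOm measurableT (@subsetT _ _) (mv _)) hv.
have hcr : `|c| `^ r <= B `^ (r / q) * z `^ (r / q).
  have -> : `|c| `^ r = (`|c| `^ q) `^ (r / q) by rewrite -powRrM mulrC divfK// gt_eqF.
  by rewrite -powRM// ge0_ler_powR ?nnegrE ?powR_ge0// mulr_ge0.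
rewrite -(pint_ae_eq Om r v w mOm (mv _) mw vw).
apply: le_trans (pint_sub_cst_le mu r Om v c mOm (mv _) (ltW r0)) _.
rewrite -(mulrA (2 `^ r)) (EFinM (2 `^ r)); apply: lee_wpmul2l; first by rewrite lee_fin powR_ge0.
rewrite (mulrDl (A * _)) EFinD; apply: leeD; first by rewrite -mulrA -powRM.
by rewrite mE -EFinM lee_fin mulrAC ler_wpM2r// ltW.
Qed.

(* The inequality holds on a set [A0] that fills [Om] up to measure [eta]; on the
   rest, Hoelder's inequality and the gain of exponent [p < r] leave a small
   multiple of the [W^{1,p}] norm, which is absorbed. *)
Lemma W1p_extension_poincare C : 0 <= C -> W1p_extension p q Om C ->
  exists2 C', 0 <= C' & forall w g, locally_integrable_rV Om w -> is_weak_gradient Om w g ->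
    (pint mu p Om w < +oo)%E -> (pint mu p Om (fun x => euclidean_norm (g x)) < +oo)%E ->
    exists c, (pint mu p Om (fun x => w x - c)%R <=
      C'%:E * pint mu p Om (fun x => euclidean_norm (g x)))%E.
Proof.
move=> C0 ext; have [C2 C20 gain] := W1p_extension_gain C C0 ext.
(* [tau] is chosen to make the coefficient [tau ^ (p - r) * C2] of the gain term at most [1 / 4];
   then [eta] makes [tau ^ p * eta] equal to [1 / 4] in the measure term. *)
pose tau := (4 * C2 + 1) `^ (r - p)^-1.
have tau0 : 0 < tau by rewrite powR_gt0// ltr_wpDl// mulr_ge0.
have rp0 : 0 < r - p by rewrite subr_gt0.
have tauE : tau `^ (p - r) = (4 * C2 + 1)^-1.
  rewrite -opprB powRN /tau -powRrM mulVf ?gt_eqF// powRr1//.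
  by rewrite addr_ge0// mulr_ge0.
have tau4 : tau `^ (p - r) * C2 <= 4^-1.
  by rewrite tauE mulrC ler_pdivrMr ?ltr_wpDl ?mulr_ge0//; lra.
pose eta := (4 * tau `^ p)^-1.
have eta0 : 0 < eta by rewrite invr_gt0 mulr_gt0// powR_gt0.
have finOm : (mu Om < +oo)%E by rewrite mE ltry.
have [A0 [mA A0Om [CA CA0 hA]] etaA] := poincare_set_exhaust Om p oOm finOm p1 eta dOm eta0.
exists (2 * CA + 1); first by rewrite addr_ge0// mulr_ge0// ltW.
move=> w g lw wg wfin gfin.
have [c hc] := hA w g lw wg; exists c.
have lwc : locally_integrable_rV Om (fun x => w x - c).
  exact: (locally_integrableD Om w (cst (- c)) mOm lw (locally_integrable_cst Om (- c))).
have wgc := weak_gradient_add_cst Om w g (- c) oOm lw wg.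
have mwc : measurable_fun Om (fun x => w x - c) by case: lwc.
have mw : measurable_fun Om w by case: lw.
have wcfin := pint_sub_cst_lty mu p c Om w mOm finOm mw (ltW p0) wfin.
(* The gain is applied to [w - c], not to [w]: its right-hand side then contains the very integral
   [Y] to be bounded, which is finite and can be absorbed. *)
have := gain _ g lwc wgc wcfin gfin.
set Y := pint mu p Om (fun x => w x - c)%R in wcfin *.
set I := pint mu p Om (fun x => euclidean_norm (g x)) in gfin hc *.
have YE : Y = (fine Y)%:E := pint_fineK mu p Om _ wcfin.
have IE : I = (fine I)%:E := pint_fineK mu p Om _ gfin.
have y0 : 0 <= fine Y by apply: fine_ge0; exact: pint_ge0.
have i0 : 0 <= fine I by apply: fine_ge0; exact: pint_ge0.
have mD : measurable (Om `\` A0) by exact: measurableD.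
have split_le : (Y <= pint mu p A0 (fun x => w x - c)%R + pint mu p (Om `\` A0) (fun x => w x - c)%R)%E.
  have OmE : Om = A0 `|` (Om `\` A0) by rewrite (setDUK A0Om).
  rewrite /Y {1}OmE; apply: pint_setU_le => //; by rewrite -OmE.
have interp s : 0 < s -> (pint mu p (Om `\` A0) (fun x => w x - c)%R <=
    (s `^ (p - r))%:E * pint mu r Om (fun x => w x - c)%R + (s `^ p * eta)%:E)%E.
  move=> s0; have mwcD : measurable_fun (Om `\` A0) (fun x => w x - c).
    by apply: measurable_funS mOm _ mwc; exact: subDsetl.
  apply: le_trans (pint_interp mu p r s _ _ mD mwcD (ltW p0) (ltW pr) s0) _.
  apply: leeD; last by rewrite EFinM lee_wpmul2l ?lee_fin ?powR_ge0.
  rewrite lee_wpmul2l ?lee_fin ?powR_ge0//.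
  exact: (pint_subset mu r (Om `\` A0) Om _ mD mOm (@subDsetl _ _ _) mwc).
clearbody Y I; move: YE IE y0 i0; set y := fine Y; set i := fine I; clearbody y i => YE IE y0 i0.
subst Y I; rewrite -EFinD /= => gain_w.
have [yi0|yi0] := eqVneq (y + i) 0.
  have /eqP -> : y == 0 by move/eqP: yi0; rewrite paddr_eq0// => /andP[].
  by rewrite -EFinM lee_fin mulr_ge0// addr_ge0// mulr_ge0// ltW.
have z0 : 0 < y + i by rewrite lt0r yi0 addr_ge0.
(* The threshold scales with the [p]-th root of [y + i], so that each of the two error terms is at
   most [(y + i) / 4]. *)
have sp : 0 < tau * (y + i) `^ p^-1 by rewrite mulr_gt0// powR_gt0.
have {}split_le := le_trans split_le (leeD hc (interp _ sp)).
have {split_le} : (y%:E <= (CA * i)%:E + (((y + i) / 4)%:E + ((y + i) / 4)%:E))%E.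
  apply: le_trans split_le _; rewrite EFinM leeD2l//; apply: leeD.
    apply: (@le_trans _ _ (((tau * (y + i) `^ p^-1) `^ (p - r))%:E * (C2 * (y + i) `^ (r / p))%:E)%E).
      by rewrite lee_wpmul2l ?lee_fin ?powR_ge0.
    rewrite -EFinM lee_fin powRM ?powR_ge0 ?(ltW tau0)// -powRrM.
    have -> : tau `^ (p - r) * (y + i) `^ (p^-1 * (p - r)) * (C2 * (y + i) `^ (r / p)) =
        tau `^ (p - r) * C2 * ((y + i) `^ (p^-1 * (p - r)) * (y + i) `^ (r / p)) by ring.
    rewrite -powRD; last by rewrite yi0 implybT.
    have -> : p^-1 * (p - r) + r / p = 1 by field; rewrite gt_eqF.
    by rewrite powRr1 ?(ltW z0)// mulrC ler_wpM2l// ltW.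
  rewrite lee_fin powRM ?powR_ge0 ?(ltW tau0)// -powRrM mulVf ?gt_eqF// powRr1 ?(ltW z0)//.
  rewrite /eta le_eqVlt; apply/orP; left; apply/eqP; field.
  by rewrite gt_eqF// powR_gt0.
(* The inequality [y <= CA i + (y + i) / 2] is solved for [y], whence the constant [2 CA + 1]. *)
rewrite -!EFinD -EFinM !lee_fin => h.
have -> : (2 * CA + 1) * i = 2 * (CA * i) + i by ring.
by move: h; set K := CA * i => h; lra.
Qed.

End sobolev_gain.

Lemma euclidean_norm_scale_le (R : realType) (n : nat) (a : R) (x : 'rV[R]_n) : `|a| <= 1 ->
  euclidean_norm (a *: x) <= euclidean_norm x.
Proof.
move=> a1; rewrite /euclidean_norm ler_wsqrtr//; apply: ler_sum => i _.
by rewrite mxE exprMn ler_piMl ?sqr_ge0// -real_normK ?num_real// exprn_ile1.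
Qed.

(** [E] is the countable union of these sublevel sets, so they cannot all be null. *)
Lemma exists_positive_sublevel (R : realType) (n : nat) (E : set 'rV[R]_n) (u : 'rV[R]_n -> R) :
  measurable E -> measurable_fun E u -> (0 < lebesgue_rV R n E)%E ->
  exists k : nat, (0 < lebesgue_rV R n (E `&` [set x | (`|u x| <= k%:R)%R]))%E.
Proof.
move=> mE mu' E0; apply/not_existsP => h.
have mF k : measurable (E `&` [set x | (`|u x| <= k%:R)%R]).
  have := measurableT_comp (@normr_measurable R setT) mu'.
  move=> /(_ mE _ (measurable_itv `]-oo, k%:R])).
  by congr measurable; apply/seteqP; split => x /=; rewrite in_itv.
have neg : (lebesgue_rV R n).-negligible (\bigcup_k (E `&` [set x | (`|u x| <= k%:R)%R])).
  apply: negligible_bigcup => k; apply/negligibleP => //.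
  by apply/eqP; rewrite -measure_le0 leNgt; apply/negP; exact: h.
have EE : \bigcup_(k : nat) (E `&` [set x | (`|u x| <= k%:R)%R]) = E.
  apply/seteqP; split => [x [k _ []]//|x Ex].
  by exists (Num.truncn `|u x|).+1 => //; split => //=; rewrite ltW// truncnS_gt.
move: E0; rewrite -EE (measure_negligible _ neg) ?ltxx// EE.
exact: mE.
Qed.

Lemma powR_norm_cvg (R : realType) (p a : R) (s : nat -> R) : 0 < p -> a != 0 ->
  s k @[k --> \oo] --> a -> `|s k| `^ p @[k --> \oo] --> `|a| `^ p.
Proof.
move=> p0 a0 sa; have na : `|a| \in `]0, +oo[ by rewrite in_itv/= normr_gt0 a0.
have cp : {for `|a|, continuous (fun y : R => y `^ p)}.
  apply: differentiable_continuous; apply/derivable1_diffP; exact: derivable_powR.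
exact: (cvg_comp _ _ (cvg_norm sa) cp).
Qed.

Section integrability_from_poincare.
Context {R : realType} {n : nat}.
Local Notation mu := (lebesgue_rV R n).
Context (Om : set 'rV[R]_n) (oOm : open Om) (p : R) (p1 : 1 <= p).
Context (m : R) (mE : mu Om = m%:E) (m0 : 0 < m).

Let mOm : measurable Om. Proof. exact: open_measurable_rV. Qed.
Let p0 : 0 < p. Proof. exact: lt_le_trans p1. Qed.

(* [poinc] is applied to the bounded functions [sin_trunc k.+1%:R \o u]; a set of
   positive measure where [u] is bounded controls their constants [c] uniformly. *)
Lemma pint_lty_of_poincare C : 0 <= C ->
  (forall w g, locally_integrable_rV Om w -> is_weak_gradient Om w g ->
    (pint mu p Om w < +oo)%E -> (pint mu p Om (fun x => euclidean_norm (g x)) < +oo)%E ->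
    exists c, (pint mu p Om (fun x => w x - c)%R <=
      C%:E * pint mu p Om (fun x => euclidean_norm (g x)))%E) ->
  forall u g, locally_integrable_rV Om u -> is_weak_gradient Om u g ->
    (pint mu p Om (fun x => euclidean_norm (g x)) < +oo)%E -> (pint mu p Om u < +oo)%E.
Proof.
move=> C0 poinc u g lu wg gfin.
have mu' : measurable_fun Om u by case: lu.
pose w (k : nat) : 'rV[R]_n -> R := sin_trunc k.+1%:R \o u.
pose gw (k : nat) x := cos (u x / k.+1%:R) *: g x.
have k10 (k : nat) : 0 < k.+1%:R :> R by [].
have mcos (k : nat) : measurable_fun setT (fun y : R => cos (y / k.+1%:R)).
  apply: (measurableT_comp (continuous_measurable_fun (@continuous_cos R))).
  exact: measurable_funM.
have msin (k : nat) : measurable_fun setT (sin_trunc k.+1%:R : R -> R).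
  apply: measurable_funM => //.
  apply: (measurableT_comp (continuous_measurable_fun (@continuous_sin R))).
  exact: measurable_funM.
have hw k : locally_integrable_rV Om (w k) /\ is_weak_gradient Om (w k) (gw k).
  apply: (weak_gradient_chain (sin_trunc k.+1%:R) (fun y => cos (y / k.+1%:R)) k.+1%:R^-1) => //.
  - by move=> x; apply: is_derive_sin_trunc; rewrite gt_eqF.
  - by move=> y; exact: cos_max.
  - move=> y z; apply: le_trans (cos_lipschitz _ _) _.
    by rewrite -mulrBl normrM mulrC ger0_norm ?invr_ge0.
  - by rewrite /sin_trunc mul0r sin0 mulr0.
have mw k : measurable_fun Om (w k) by have [[]] := hw k.
have wfin k : (pint mu p Om (w k) < +oo)%E.
  have h := pint_le mu p Om (w k) (cst k.+1%:R) mOm (mw k) (measurable_cst _) (ltW p0).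
  apply: le_lt_trans (h _) _.
    by move=> x _; rewrite (ger0_norm (ltW (k10 k))); exact: sin_trunc_le.
  by rewrite pint_cst// mE -EFinM ltry.
set I := pint mu p Om _ in gfin.
have IE : I = (fine I)%:E := pint_fineK mu p Om _ gfin.
have gwI k : (pint mu p Om (fun x => euclidean_norm (gw k x)) <= I)%E.
  have [_ wgk] := hw k.
  apply: (pint_le mu p Om _ _ mOm (measurable_norm_weak_gradient Om _ _ wgk)
    (measurable_norm_weak_gradient Om u g wg) (ltW p0)) => x _.
  rewrite !ger0_norm ?euclidean_norm_ge0//; apply: euclidean_norm_scale_le; exact: cos_max.
have [M hM] : exists k : nat, (0 < mu (Om `&` [set x | (`|u x| <= k%:R)%R]))%E.
  by apply: exists_positive_sublevel => //; rewrite mE lte_fin.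
set E := Om `&` _ in hM.
have mE' : measurable E.
  have := measurableT_comp (@normr_measurable R setT) mu'.
  move=> /(_ mOm _ (measurable_itv `]-oo, M%:R])).
  by congr measurable; apply/seteqP; split => x /=; rewrite in_itv.
have EOm : E `<=` Om by exact: subIsetl.
have [m1 m1E] : exists m1, mu E = m1%:E.
  exists (fine (mu E)); rewrite fineK// ge0_fin_numE ?measure_ge0//.
  by apply: (@le_lt_trans _ _ (mu Om)); [apply: le_measure; rewrite ?inE|rewrite mE ltry].
have m10 : 0 < m1 by rewrite -lte_fin -m1E.
(* On [E] the truncations satisfy [|w k| <= |u| <= M]; together with the Poincare inequality for
   [w k] this gives [|c| ^ p <= Bd] for its constant [c], with [Bd] independent of [k]. *)
pose Bd := 2 `^ p * (M%:R `^ p * m1 + C * fine I) / m1.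
pose F := 2 `^ p * (C * fine I + Bd * m).
have wF k : (pint mu p Om (w k) <= F%:E)%E.
  have [lwk wgk] := hw k.
  have [c hc] := poinc (w k) (gw k) lwk wgk (wfin k) (le_lt_trans (gwI k) gfin).
  have {}hc : (pint mu p Om (fun x => w k x - c)%R <= (C * fine I)%:E)%E.
    by apply: le_trans hc _; rewrite EFinM -IE; apply: lee_wpmul2l; [rewrite lee_fin|exact: gwI].
  have mwc : measurable_fun Om (fun x => w k x - c) by exact: measurable_funB.
  have mwE : measurable_fun E (w k) by exact: measurable_funS mOm EOm (mw k).
  have cB : `|c| `^ p <= Bd.
    rewrite /Bd ler_pdivlMr// -lee_fin EFinM -m1E.
    apply: le_trans (pint_cst_le mu p E (w k) c mE' mwE (ltW p0)) _.
    rewrite (EFinM (2 `^ p)); apply: lee_wpmul2l; first by rewrite lee_fin powR_ge0.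
    rewrite EFinD; apply: leeD; last first.
      exact: le_trans (pint_subset mu p E Om _ mE' mOm EOm mwc) hc.
    have h := pint_le mu p E (w k) (cst M%:R) mE' mwE (measurable_cst _) (ltW p0).
    apply: le_trans (h _) _; last by rewrite pint_cst// m1E ger0_norm// EFinM.
    move=> x [_ /= ux]; rewrite (ger0_norm (ler0n R M)); apply: le_trans ux.
    have df y : is_derive y (1 : R) (sin_trunc k.+1%:R : R -> R) (cos (y / k.+1%:R)).
      by apply: is_derive_sin_trunc; rewrite gt_eqF.
    apply: (chain_fun_le _ _ df) => [y|]; first exact: cos_max.
    by rewrite /sin_trunc mul0r sin0 mulr0.
  apply: le_trans (pint_sub_cst_le mu p Om (w k) c mOm (mw k) (ltW p0)) _.
  rewrite /F (EFinM (2 `^ p)); apply: lee_wpmul2l; first by rewrite lee_fin powR_ge0.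
  rewrite EFinD; apply: leeD => //.
  by rewrite mE -EFinM lee_fin ler_wpM2r// ltW.
(* [F] does not depend on [k], so the bound passes to [u] by Fatou's lemma. *)
apply: le_lt_trans (ltry F).
apply: (fatou_bound mu Om (fun k x => (`|w k x| `^ p)%:E)) => //.
  by move=> k; exact: measurable_powR_norm.
move=> x _; have [ux0|ux0] := eqVneq (u x) 0.
  apply: cvg_near_cst; apply: nearW => k.
  by rewrite /w /sin_trunc /= ux0 mul0r sin0 mulr0.
apply/fine_cvgP; split; first exact: nearW.
by apply: (powR_norm_cvg R p (u x) (fun k => w k x)) => //; exact: sin_trunc_cvg.
Qed.

End integrability_from_poincare.

Lemma L1p_extension_of_W1p {R : realType} {n : nat} (Om : set 'rV[R]_n) (p q r : R) C :
  domain Om -> bounded_set Om -> 1 <= q -> q <= p -> p < r ->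
  0 < r + n%:R - n%:R * (r / q) -> 0 <= C -> W1p_extension p q Om C ->
  exists2 C', 0 <= C' & L1p_extension p q Om C'.
Proof.
move=> dOm bOm q1 qp pr gam0 C0 ext.
have [m m0 mE] := bounded_domain_measure Om dOm bOm.
have [_ oOm _] := dOm; have mOm := open_measurable_rV _ oOm.
have q0 : 0 < q by exact: lt_le_trans q1.
have p1 : 1 <= p by exact: le_trans qp.
have p0 : 0 < p by exact: lt_le_trans p1.
have finOm : (lebesgue_rV R n Om < +oo)%E by rewrite mE ltry.
have [C1 C10 poinc] := W1p_extension_poincare Om dOm bOm p q r q1 qp pr gam0 m mE m0 C C0 ext.
have C110 : 0 <= C1 + 1 by exact: addr_ge0.
exists (C * (C1 + 1) `^ (q / p)); first by rewrite mulr_ge0// powR_ge0.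
move=> u g lu wg gfin.
(* Only the gradient of [u] is known to be integrable to the power [p]; this supplies the same for
   [u] itself, so that [ext] can be applied to [u - c]. *)
have ufin := pint_lty_of_poincare Om oOm p p1 m mE m0 C1 C10 poinc u g lu wg gfin.
have [c hc] := poinc u g lu wg ufin gfin.
have mu' : measurable_fun Om u by case: lu.
have luc : locally_integrable_rV Om (fun x => u x - c).
  exact: (locally_integrableD Om u (cst (- c)) mOm lu (locally_integrable_cst Om (- c))).
have wguc := weak_gradient_add_cst Om u g (- c) oOm lu wg.
have ucfin := pint_sub_cst_lty (lebesgue_rV R n) p c Om u mOm finOm mu' (ltW p0) ufin.
have [v [G [lv wG vu hvG]]] := ext _ g luc wguc ucfin gfin.
exists (fun x => v x + c), G; split.
- exact: (locally_integrableD setT v (cst c) measurableT lv (locally_integrable_cst setT c)).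
- exact: weak_gradient_add_cst setT v G c openT lv wG.
- by move: vu; apply: filterS => x vux /vux ->; rewrite subrK.
(* The Poincare inequality bounds the integrals of [u - c] and of its gradient together by [C1 + 1]
   times the gradient integral; adding [c] back does not change gradients. *)
apply: le_trans (le_trans _ hvG) _; first by rewrite leeDr// pint_ge0.
rewrite lee_fin -mulrA ler_wpM2l//.
have qp0 : 0 <= q / p by rewrite divr_ge0 ?ltW.
have IE := pint_fineK _ _ _ _ gfin.
have I0 : 0 <= fine (pint (lebesgue_rV R n) p Om (fun x => euclidean_norm (g x))).
  by apply: fine_ge0; exact: pint_ge0.
rewrite -powRM//.
have h : (pint (lebesgue_rV R n) p Om (fun x => u x - c)%R +
    pint (lebesgue_rV R n) p Om (fun x => euclidean_norm (g x)) <=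
    ((C1 + 1) * fine (pint (lebesgue_rV R n) p Om (fun x => euclidean_norm (g x))))%:E)%E.
  by rewrite mulrDl mul1r EFinD -IE EFinM -IE; apply: leeD.
apply: (fine_powR_le _ _ _ qp0 _ h); last exact: ltry.
by rewrite adde_ge0 ?pint_ge0.
Qed.

(** The gap equals [(q n - r (n - q)) / q]. For [q < n] it is positive when [r] is below the
    conjugate exponent, and the midpoint between that exponent and [p] will do; for [q >= n] it is
    positive for every positive [r], in particular for [p + 1]. *)
Lemma sobolev_exponent_gap (R : realType) (n : nat) (p q : R) : (0 < n)%N -> 1 <= q ->
  q <= p -> (p%:E < sobolev_conjugate n q%:E)%E ->
  exists2 r, p < r & 0 < r + n%:R - n%:R * (r / q).
Proof.
move=> n0 q1 qp; have q0 : 0 < q by exact: lt_le_trans q1.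
have nR0 : 0 < n%:R :> R by rewrite ltr0n.
have gapE r : r + n%:R - n%:R * (r / q) = (q * n%:R - r * (n%:R - q)) / q.
  by field; rewrite gt_eqF.
rewrite /sobolev_conjugate; case: ifPn => [qn|]; last first.
  rewrite -leNgt => nq _; exists (p + 1); first by rewrite ltrDl.
  rewrite gapE divr_gt0// subr_gt0; apply: (@le_lt_trans _ _ 0); last exact: mulr_gt0.
  by rewrite mulr_ge0_le0 ?subr_le0//; lra.
rewrite lte_fin => pq; set s := q * n%:R / (n%:R - q) in pq.
exists ((p + s) / 2); first by lra.
have nq0 : 0 < n%:R - q by rewrite subr_gt0.
rewrite gapE divr_gt0// subr_gt0 -ltr_pdivlMr// -/s; lra.
Qed.

Theorem theorem1p2 (R : realType) (n : nat) (p q : \bar R)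
    (Omega : set 'rV[R]_n) :
  (0 < n)%N ->
  (1 <= q)%E -> (q <= p)%E -> (p < sobolev_conjugate n q)%E ->
  domain Omega -> bounded_set Omega ->
  (extension_domain (W1p p) (W1p q) Omega <->
   extension_domain (L1p p) (L1p q) Omega).
Proof.
move=> n0 q1 qp pq dOm bOm.
(* [p = +oo] is excluded by the strict inequality with the conjugate exponent; [q] then lies between
   1 and a real number, so both exponents are real. *)
case: p qp pq => [p||] qp pq; last 2 first.
- by have := lt_le_trans pq (leey _); rewrite ltxx.
- by have := le_trans q1 qp.
case: q q1 qp pq => [q||]// q1 qp pq.
rewrite !lee_fin in q1 qp.
have q0 : 0 < q by exact: lt_le_trans q1.
have p0 : 0 < p by exact: lt_le_trans qp.
have [_ oOm _] := dOm.
rewrite (extension_domain_W1p p q Omega p0 q0 oOm) (extension_domain_L1p p q Omega p0 q0 oOm).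
have [m m0 mE] := bounded_domain_measure Omega dOm bOm.
split => [[C C0 ext]|[C C0 ext]].
  have [r pr gap] := sobolev_exponent_gap R n p q n0 q1 qp pq.
  exact: L1p_extension_of_W1p dOm bOm q1 qp pr gap C0 ext.
exact: W1p_extension_of_L1p Omega dOm bOm p q q1 qp m mE m0 C C0 ext.
Qed.
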